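(* Let $A=(a_{ij})_{i,j\in I}$ be a matrix satisfying (B1)–(B3), let $J=\{i\in I: a_{ii}>0\}$, and assume that $a_{ij}<0$ whenever $i,j\in I\setminus J$ and $i\neq j$. Let $\mathfrak g$ be the Borcherds algebra of $A$, with subalgebras $\mathfrak g_J$, $\mathfrak h$, $\mathfrak u^{\pm}$ as in the context. Then, associated to the decomposition $$\mathfrak g=\mathfrak u^+\oplus(\mathfrak g_J+\mathfrak h)\oplus\mathfrak u^-,$$ there is a group $$G=G(S')\rtimes G_J,$$ where $S'$ is a basis of $V'=\coprod_{i\in I\setminus J}U(\mathfrak n_J^-)\cdot f_i$, $\mathfrak u^-=L(V')$, $G_J$ is the Kac–Moody group of $\mathfrak g_J$ relative to the representation $\pi$ of $\mathfrak g_J$ on the tensor algebra $W=T(V')$, and $G(S')=\exp(\widehat L(S'))$. If $g\in G_J$ is of the form $g=\exp(\pi(x))$ for some $x\in\mathfrak g_J$, then the action of $g$ on $G(S')$ is given, for $L\in\widehat L(S')$, by $$g\cdot\exp(L)=g\exp(L)g^{-1}=\mathrm{Ad}(g)(\exp(L))=\exp(\mathrm{Ad}(g)(L)).$$ Thus $G_J$ acts on $G(S')$ via Lie algebra automorphisms of $\widehat L(S')$, which extend to group automorphisms of $G(S')$. Multiplication in $G$ is given by $$(n_1,g_1)\cdot(n_2,g_2)=\bigl(n_1\cdot\exp(\mathrm{Ad}(g_1)(L)),\;g_1g_2\bigr),\qquad L=\log(n_2)\in\widehat L(S'),$$ for $n_1,n_2\in G(S')$ and $g_1,g_2\in G_J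$.
   Context: Let $\mathbb K\subset\mathbb C$ be a subfield, $I$ a countable index set, and $A=(a_{ij})_{i,j\in I}$ a matrix with entries in $\mathbb K$ (real, as the inequalities below presuppose) such that: (B1) $A$ is symmetric; (B2) $a_{ij}\le 0$ if $i\ne j$; (B3) if $a_{ii}>0$ then $2a_{ij}/a_{ii}\in\mathbb Z$ for all $j\in I$. The Borcherds algebra $\mathfrak g$ of $A$ is the Lie algebra over $\mathbb K$ with generators $h_i,e_i,f_i$ ($i\in I$) and relations: $[h_i,h_j]=0$; $[h_i,e_k]=a_{ik}e_k$; $[h_i,f_k]=-a_{ik}f_k$; $[e_i,f_j]=\delta_{ij}h_i$; $(\mathrm{ad}\,e_i)^{-2a_{ij}/a_{ii}+1}e_j=0=(\mathrm{ad}\,f_i)^{-2a_{ij}/a_{ii}+1}f_j$ for $i\ne j$ with $a_{ii}>0$; $[e_i,e_j]=0=[f_i,f_j]$ whenever $a_{ij}=0$. Put $\mathfrak h=\mathrm{span}\{h_i\}_{i\in I}$. The root lattice is $Q=\bigoplus_{i\in I}\mathbb Z\alpha_i$, with bilinear form $(\alpha_i,\alpha_j)=a_{ij}$; $\mathfrak g$ is $Q$-graded by $\deg e_i=\alpha_i$, $\deg f_i=-\alpha_i$, $\deg h_i=0$. $J=\{i\in I:a_{ii}>0\}$; $\mathfrak g_J$ is the subalgebra generated by $e_i,f_i$ ($i\in J$), which is the Kac–Moody (or semi-simple) algebra of $(a_{ij})_{i,j\in J}$, with triangular decomposition $\mathfrak g_J=\mathfrak n_J^+\oplus\mathfrak h_J\oplus\mathfrak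 n_J^-$ ($\mathfrak n_J^{+}$, $\mathfrak n_J^-$ generated by the $e_i$, respectively the $f_i$, $i\in J$). The real roots $\Delta_J^{\mathrm{re}}$ of $\mathfrak g_J$ are the images of the $\alpha_j$ ($j\in J$) under the Weyl group generated by the reflections $\beta\mapsto\beta-\frac{2(\beta,\alpha_j)}{a_{jj}}\alpha_j$, $j\in J$. Put $V'=\coprod_{i\in I\setminus J}U(\mathfrak n_J^-)\cdot f_i$ and $V=\coprod_{i\in I\setminus J}U(\mathfrak n_J^+)\cdot e_i$, where $U(\cdot)$ denotes the universal enveloping algebra, acting on $\mathfrak g$ by the adjoint action; $\coprod$ is direct sum. When $a_{ij}<0$ for all distinct $i,j\in I\setminus J$, it is known (Jurisich) that $\mathfrak g=\mathfrak u^+\oplus(\mathfrak g_J+\mathfrak h)\oplus\mathfrak u^-$, where $\mathfrak u^-=L(V')$ and $\mathfrak u^+=L(V)$ are the free Lie algebras on $V'$, $V$, and each $U(\mathfrak n_J^-)\cdot f_i$ ($i \in I\setminus J$) is an integrable highest weight $\mathfrak g_J$-module. The adjoint action of $\mathfrak g_J$ on $V'$ extends by derivations to a representation $\pi:\mathfrak g_J\to\mathfrak{gl}(T(V'))$ on the tensor algebra $T(V')=\bigoplus_{n\ge0}T^n(V')$. Root vectors $x_\alpha\in(\mathfrak g_J)_\alpha$, $\alpha\in\Delta_J^{\mathrm{re}}$, act locally nilpotently. Let $\widehat G_J=*_{\alpha\in\Delta_J^{\mathrm{re}}}(\mathfrak g_J)_\alpha$ be the free product of the additive groups $(\mathfrak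 g_J)_\alpha$, let $\widehat\pi:\widehat G_J\to GL(T(V'))$ be the homomorphism given by $x_\alpha\mapsto\exp(\pi(x_\alpha))$, and let $G_J=\widehat G_J/\ker\widehat\pi$; thus $G_J$ is identified with the subgroup of $GL(T(V'))$ generated by all $\exp(\pi(x_\alpha))$. Let $S'$ be a basis of $V'$, viewed as a set of non-commuting variables. Let $A(S')$ be the free associative algebra over $\mathbb K$ on $S'$, identified with $T(V')$ (so $A_n(S')=T^n(V')$). Let $\widehat A(S')=\prod_{n\ge0}A_n(S')$ be its completion (formal power series), and let $\widehat L(S')\subset\widehat A(S')$ be the Lie subalgebra of series $\sum_{n\ge1}u_n$ with $u_n\in L_n(S')$, the degree-$n$ part of the free Lie algebra $L(S')\subset A(S')$. The Magnus group is $G(S')=\exp(\widehat L(S'))$, a group under multiplication in $\widehat A(S')$; $\exp:\widehat L(S')\to G(S')$ is a bijection with inverse $\log$. The group $G_J$ acts on $\widehat A(S')$ degreewise: $g\cdot\sum_n u_n=\sum_n g(u_n)$. This action, restricted to $\widehat L(S')$ and to $G(S')$, is written $g\cdot(-)=\mathrm{Ad}(g)(-)$. The semi-direct product is formed with respect to this action, with multiplication $(n_1,g_1)(n_2,g_2)=(n_1\cdot(g_1\cdot n_2),g_1g_2)$; $g\exp(L)g^{-1}$ denotes conjugation in $G$, where $G(S')$ and $G_J$ are identified with subgroups of $G$ in the usual way. *)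

(* Defs.v *)
From HB Require Import structures.
From mathcomp Require Import all_boot all_order all_algebra.
From mathcomp Require Import finmap complex generic_quotient.
From mathcomp Require Import boolp classical_sets functions reals.
From mathcomp.multinomials Require Import monalg.

Set Implicit Arguments.
Unset Strict Implicit.
Unset Printing Implicit Defensive.

Import Order.TTheory GRing.Theory Num.Theory.

Local Open Scope ring_scope.
Local Open Scope classical_set_scope.
Local Open Scope quotient_scope.

HB.mixin Record Lmodule_isLieAlgebra (K : fieldType) L of GRing.Lmodule K L := {
  lie : L -> L -> L;
  lie_linearl : forall (c : K) (x y z : L),
    lie (c *: x + y) z = c *: lie x z + lie y z;
  lie_linearr : forall (c : K) (x y z : L),
    lie z (c *: x + y) = c *: lie z x + lie z y;
  liexx : forall x : L, lie x x = 0;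
  lie_jacobi : forall x y z : L,
    lie x (lie y z) + lie y (lie z x) + lie z (lie x y) = 0
}.

#[short(type="lieAlgType")]
HB.structure Definition LieAlgebra (K : fieldType) :=
  { L of GRing.Lmodule K L & Lmodule_isLieAlgebra K L }.

Fact commutator_jacobi_ring (B : nzRingType) (x y z : B) :
  (x * (y * z - z * y) - (y * z - z * y) * x)
  + (y * (z * x - x * z) - (z * x - x * z) * y)
  + (z * (x * y - y * x) - (x * y - y * x) * z) = 0.
Proof.
have cancel6 (V : zmodType) (a b c d e f : V) :
    (a - b - (c - d)) + (c - e - (f - b)) + (f - d - (a - e)) = 0.
  rewrite !opprB !addrA [LHS](ACl (1*12*2*7*3*10*4*5*6*11*8*9))%AC /=.
  by rewrite subrr add0r addNr add0r subrr add0r !(addNr, add0r).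
rewrite !mulrBr !mulrBl !mulrA; exact: cancel6.
Qed.

(* The monoid algebra K[M], in particular the free associative algebra, is a
   Lie algebra for the commutator. *)
Section MonoidAlgebraLie.
Context (K : fieldType) (M : monomType).
Local Notation A := {malg K[M]}.
Implicit Types x y z : A.

Let malg_scalerAr (c : K) x y : x * (c *: y) = c *: (x * y).
Proof.
apply/malgP => k; rewrite mcoeffZ.
rewrite (mcoeffMlw _ (fsubset_refl _) (msuppZ_le c y)) mcoeffMl mulr_sumr.
apply: eq_bigr => k1 _; rewrite mulr_sumr; apply: eq_bigr => k2 _.
by rewrite mcoeffZ mulrCA mulrnAr.
Qed.

Definition commutator x y : A := x * y - y * x.

Let commutator_linearl (c : K) x y z :
  commutator (c *: x + y) z = c *: commutator x z + commutator y z.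
Proof.
rewrite /commutator mulrDl mulrDr -scalerAl malg_scalerAr scalerBr.
by rewrite opprD addrACA.
Qed.

Let commutator_linearr (c : K) x y z :
  commutator z (c *: x + y) = c *: commutator z x + commutator z y.
Proof.
rewrite /commutator mulrDl mulrDr -scalerAl malg_scalerAr scalerBr.
by rewrite opprD addrACA.
Qed.

Let commutatorxx x : commutator x x = 0.
Proof. exact: subrr. Qed.

Let commutator_jacobi x y z :
  commutator x (commutator y z) + commutator y (commutator z x)
  + commutator z (commutator x y) = 0.
Proof. exact: commutator_jacobi_ring. Qed.

HB.instance Definition _ := Lmodule_isLieAlgebra.Build K A
  commutator_linearl commutator_linearr commutatorxx commutator_jacobi.
End MonoidAlgebraLie.

Section LieNotions.
Context (K : fieldType).

Definition subspace (V : lmodType K) (W : set V) : Prop :=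
  W 0 /\ forall (c : K) x y, W x -> W y -> W (c *: x + y).

Definition lspan (V : lmodType K) (X : set V) : set V := smallest (@subspace V) X.

Definition lie_subalgebra (L : lieAlgType K) (H : set L) : Prop :=
  subspace H /\ forall x y, H x -> H y -> H (lie x y).

Definition lie_closure (L : lieAlgType K) (X : set L) : set L :=
  smallest (@lie_subalgebra L) X.

Definition lie_hom_on (L L' : lieAlgType K) (H : set L) (phi : L -> L') : Prop :=
  (forall (c : K) x y, H x -> H y -> phi (c *: x + y) = c *: phi x + phi y) /\
  (forall x y, H x -> H y -> phi (lie x y) = lie (phi x) (phi y)).

(* U(n).v for the adjoint action: U(n) is spanned by the products x1 ... xk of
   elements of n, and x1 ... xk acts as ad x1 o ... o ad xk. *)
Definition Uorbit (L : lieAlgType K) (n : set L) (v : L) : set L :=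
  lspan [set y | exists2 xs : seq L,
                   (forall x, x \in xs -> n x) & y = foldr lie v xs].

Definition direct_sum3 (V : lmodType K) (X Y Z : set V) : Prop :=
  forall v : V, exists! t : V * V * V,
    [/\ X t.1.1, Y t.1.2, Z t.2 & v = t.1.1 + t.1.2 + t.2].

Definition independent_family (V : lmodType K) (I : countType) (P : set I)
    (W : I -> set V) : Prop :=
  forall (r : seq I) (x : I -> V), uniq r -> (forall i, i \in r -> P i /\ W i (x i)) ->
    \sum_(i <- r) x i = 0 -> forall i, i \in r -> x i = 0.

(* {malg K[S]} is the space of finitely supported functions S -> K. *)
Definition lincomb (V : lmodType K) (S : choiceType) (b : S -> V)
    (c : {malg K[S]}) : V := \sum_(s <- msupp c) c@_s *: b s.

Definition is_basis (V : lmodType K) (S : choiceType) (W : set V) (b : S -> V) : Prop :=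
  set_bij setT W (lincomb b).

Definition coord (V : lmodType K) (S : choiceType) (b : S -> V) (v : V) : {malg K[S]} :=
  xget 0 [set c | lincomb b c = v].

Definition linear_map (V V' : lmodType K) (f : V -> V') : Prop :=
  forall (c : K) x y, f (c *: x + y) = c *: f x + f y.

Definition locally_nilpotent (V : lmodType K) (D : V -> V) : Prop :=
  forall v, exists n, iter n D v = 0.

(* exp(D) v for a locally nilpotent linear map D; the truncation index is some
   n with D^n v = 0, on which the value does not depend. *)
Definition lnexp (V : lmodType K) (D : V -> V) (v : V) : V :=
  \sum_(k < xget 0%N [set n | iter n D v = 0]) (k`!%:R : K)^-1 *: iter k D v.

End LieNotions.

Inductive lie_term (K X : Type) : Type :=
| LVar of X
| LZero
| LAdd of lie_term K X & lie_term K X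
| LScale of K & lie_term K X
| LBra of lie_term K X & lie_term K X.
Arguments LVar {K X}.
Arguments LZero {K X}.

HB.instance Definition _ (K X : Type) := gen_eqMixin (lie_term K X).
HB.instance Definition _ (K X : Type) := gen_choiceMixin (lie_term K X).

Section Presentation.
Context (K : fieldType) (X : Type).
Local Notation term := (lie_term K X).
Context (R : term -> term -> Prop).

Inductive lie_cong : term -> term -> Prop :=
| lc_rel t u : R t u -> lie_cong t u
| lc_refl t : lie_cong t t
| lc_sym t u : lie_cong t u -> lie_cong u t
| lc_trans t u v : lie_cong t u -> lie_cong u v -> lie_cong t v
| lc_add t t' u u' : lie_cong t t' -> lie_cong u u' ->
    lie_cong (LAdd t u) (LAdd t' u')
| lc_scale c t t' : lie_cong t t' -> lie_cong (LScale c t) (LScale c t')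
| lc_bra t t' u u' : lie_cong t t' -> lie_cong u u' ->
    lie_cong (LBra t u) (LBra t' u')
| lc_addA t u v : lie_cong (LAdd t (LAdd u v)) (LAdd (LAdd t u) v)
| lc_addC t u : lie_cong (LAdd t u) (LAdd u t)
| lc_add0 t : lie_cong (LAdd LZero t) t
| lc_addN t : lie_cong (LAdd (LScale (-1) t) t) LZero
| lc_scaleA c d t : lie_cong (LScale c (LScale d t)) (LScale (c * d) t)
| lc_scale1 t : lie_cong (LScale 1 t) t
| lc_scaleDr c t u : lie_cong (LScale c (LAdd t u)) (LAdd (LScale c t) (LScale c u))
| lc_scaleDl c d t : lie_cong (LScale (c + d) t) (LAdd (LScale c t) (LScale d t))
| lc_braDl t u v : lie_cong (LBra (LAdd t u) v) (LAdd (LBra t v) (LBra u v))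
| lc_braDr t u v : lie_cong (LBra v (LAdd t u)) (LAdd (LBra v t) (LBra v u))
| lc_braZl c t u : lie_cong (LBra (LScale c t) u) (LScale c (LBra t u))
| lc_braZr c t u : lie_cong (LBra t (LScale c u)) (LScale c (LBra t u))
| lc_braxx t : lie_cong (LBra t t) LZero
| lc_jacobi t u v :
    lie_cong (LAdd (LAdd (LBra t (LBra u v)) (LBra u (LBra v t))) (LBra v (LBra t u)))
             LZero.

Let congb (t u : term) : bool := `[< lie_cong t u >].

Let congb_refl : reflexive congb.
Proof. by move=> t; apply/asboolP; exact: lc_refl. Qed.

Let congb_sym : symmetric congb.
Proof. by move=> t u; apply/asboolP/asboolP; exact: lc_sym. Qed.

Let congb_trans : transitive congb.
Proof. by move=> u t v /asboolP tu /asboolP uv; apply/asboolP; exact: lc_trans tu uv. Qed.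

Canonical lie_cong_equiv := EquivRel congb congb_refl congb_sym congb_trans.

Definition lie_presented : Type := {eq_quot lie_cong_equiv}.
HB.instance Definition _ := Choice.copy lie_presented {eq_quot lie_cong_equiv}.

Definition lie_class (t : term) : lie_presented := \pi_{eq_quot lie_cong_equiv} t.
Let rep (x : lie_presented) : term := repr (x : {eq_quot lie_cong_equiv}).

Let lie_classE t u : lie_cong t u -> lie_class t = lie_class u.
Proof. by move=> tu; apply/eqmodP/asboolP. Qed.

Let repK x : lie_class (rep x) = x.
Proof. exact: reprK. Qed.

Let cong_rep t : lie_cong (rep (lie_class t)) t.
Proof.
by have /eqmodP/asboolP := reprK (lie_class t : {eq_quot lie_cong_equiv}).
Qed.

Definition lp_add (x y : lie_presented) := lie_class (LAdd (rep x) (rep y)).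
Definition lp_scale (c : K) (x : lie_presented) := lie_class (LScale c (rep x)).
Definition lp_bra (x y : lie_presented) := lie_class (LBra (rep x) (rep y)).

Let lp_addE t u : lp_add (lie_class t) (lie_class u) = lie_class (LAdd t u).
Proof. by apply: lie_classE; apply: lc_add; exact: cong_rep. Qed.

Let lp_scaleE c t : lp_scale c (lie_class t) = lie_class (LScale c t).
Proof. by apply: lie_classE; apply: lc_scale; exact: cong_rep. Qed.

Let lp_braE t u : lp_bra (lie_class t) (lie_class u) = lie_class (LBra t u).
Proof. by apply: lie_classE; apply: lc_bra; exact: cong_rep. Qed.

Let lpE := (lp_addE, lp_scaleE, lp_braE).

Let lp_addA : associative lp_add.
Proof.
move=> x y z; rewrite -(repK x) -(repK y) -(repK z) !lpE.
exact/lie_classE/lc_addA.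
Qed.

Let lp_addC : commutative lp_add.
Proof. by move=> x y; apply: lie_classE; exact: lc_addC. Qed.

Let lp_add0 : left_id (lie_class LZero) lp_add.
Proof. by move=> x; rewrite -(repK x) !lpE; exact/lie_classE/lc_add0. Qed.

Let lp_addN : left_inverse (lie_class LZero) (lp_scale (-1)) lp_add.
Proof. by move=> x; rewrite -(repK x) !lpE; exact/lie_classE/lc_addN. Qed.

HB.instance Definition _ := GRing.isZmodule.Build lie_presented
  lp_addA lp_addC lp_add0 lp_addN.

Let lp_scaleA c d x : lp_scale c (lp_scale d x) = lp_scale (c * d) x.
Proof. by rewrite -(repK x) !lpE; exact/lie_classE/lc_scaleA. Qed.

Let lp_scale1 : left_id 1 lp_scale.
Proof. by move=> x; rewrite -(repK x) !lpE; exact/lie_classE/lc_scale1. Qed.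

Let lp_scaleDr : right_distributive lp_scale +%R.
Proof.
move=> c x y; rewrite -(repK x) -(repK y) /GRing.add /= !lpE.
exact/lie_classE/lc_scaleDr.
Qed.

Let lp_scaleDl x : {morph lp_scale^~ x : c d / c + d}.
Proof.
move=> c d; rewrite -(repK x) [in RHS]/GRing.add /= !lpE.
exact/lie_classE/lc_scaleDl.
Qed.

HB.instance Definition _ := GRing.Zmodule_isLmodule.Build K lie_presented
  lp_scaleA lp_scale1 lp_scaleDr lp_scaleDl.

Let lp_bra_linearl (c : K) (x y z : lie_presented) :
  lp_bra (c *: x + y) z = c *: lp_bra x z + lp_bra y z.
Proof.
rewrite -(repK x) -(repK y) -(repK z) /GRing.add /GRing.scale /= !lpE.
apply: lie_classE; apply: lc_trans (lc_braDl _ _ _) _.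
by apply: lc_add; [exact: lc_braZl | exact: lc_refl].
Qed.

Let lp_bra_linearr (c : K) (x y z : lie_presented) :
  lp_bra z (c *: x + y) = c *: lp_bra z x + lp_bra z y.
Proof.
rewrite -(repK x) -(repK y) -(repK z) /GRing.add /GRing.scale /= !lpE.
apply: lie_classE; apply: lc_trans (lc_braDr _ _ _) _.
by apply: lc_add; [exact: lc_braZr | exact: lc_refl].
Qed.

Let lp_braxx (x : lie_presented) : lp_bra x x = 0.
Proof. by apply: lie_classE; exact: lc_braxx. Qed.

Let lp_jacobi (x y z : lie_presented) :
  lp_bra x (lp_bra y z) + lp_bra y (lp_bra z x) + lp_bra z (lp_bra x y) = 0.
Proof.
rewrite -(repK x) -(repK y) -(repK z) /GRing.add /= !lpE.
exact/lie_classE/lc_jacobi.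
Qed.

HB.instance Definition _ := Lmodule_isLieAlgebra.Build K lie_presented
  lp_bra_linearl lp_bra_linearr lp_braxx lp_jacobi.

End Presentation.

Inductive borcherds_gen (I : Type) : Type :=
| genH of I | genE of I | genF of I.

Section Borcherds.
(* The subfield K of the complex numbers is given by its embedding iota; the
   order on R[i] compares numbers with equal imaginary part. *)
Context (R : realType) (K : fieldType) (iota : {rmorphism K -> R[i]}).
Context (I : countType) (A : I -> I -> K).

Definition J (i : I) : Prop := 0 < iota (A i i).

Local Notation term := (lie_term K (borcherds_gen I)).
Local Notation tH i := (LVar (genH i) : term).
Local Notation tE i := (LVar (genE i) : term).
Local Notation tF i := (LVar (genF i) : term).

Inductive borcherds_rel : term -> term -> Prop :=
| br_hh i j : borcherds_rel (LBra (tH i) (tH j)) LZero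
| br_he i k : borcherds_rel (LBra (tH i) (tE k)) (LScale (A i k) (tE k))
| br_hf i k : borcherds_rel (LBra (tH i) (tF k)) (LScale (- A i k) (tF k))
| br_ef i : borcherds_rel (LBra (tE i) (tF i)) (tH i)
| br_ef0 i j : i <> j -> borcherds_rel (LBra (tE i) (tF j)) LZero
| br_serre_e i j (n : nat) : i <> j -> J i ->
    n%:R = - (2 * A i j / A i i) + 1 ->
    borcherds_rel (iter n (LBra (tE i)) (tE j)) LZero
| br_serre_f i j (n : nat) : i <> j -> J i ->
    n%:R = - (2 * A i j / A i i) + 1 ->
    borcherds_rel (iter n (LBra (tF i)) (tF j)) LZero
| br_ee i j : A i j = 0 -> borcherds_rel (LBra (tE i) (tE j)) LZero
| br_ff i j : A i j = 0 -> borcherds_rel (LBra (tF i) (tF j)) LZero.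

Definition borcherds : Type := lie_presented borcherds_rel.
HB.instance Definition _ := LieAlgebra.on borcherds.

Definition bh (i : I) : borcherds := lie_class borcherds_rel (tH i).
Definition be (i : I) : borcherds := lie_class borcherds_rel (tE i).
Definition bf (i : I) : borcherds := lie_class borcherds_rel (tF i).

Definition hspan : set borcherds := lspan (range bh).
Definition gJ : set borcherds := lie_closure ((be @` J) `|` (bf @` J)).
Definition nJplus : set borcherds := lie_closure (be @` J).
Definition nJminus : set borcherds := lie_closure (bf @` J).

Definition Vplus : set borcherds :=
  lspan (\bigcup_(i in ~` J) Uorbit nJplus (be i)).
Definition Vminus : set borcherds :=
  lspan (\bigcup_(i in ~` J) Uorbit nJminus (bf i)).

Definition uplus : set borcherds := lie_closure Vplus.
Definition uminus : set borcherds := lie_closure Vminus.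

(* The root lattice Q is the free abelian group {malg int[I]}, with basis
   alpha_i = << i >>. *)
Definition root_form (x y : {malg int[I]}) : K :=
  \sum_(i <- msupp x) \sum_(j <- msupp y) (x@_i)%:~R * (y@_j)%:~R * A i j.

Inductive real_root : {malg int[I]} -> Prop :=
| rr_simple j : J j -> real_root << j >>
| rr_reflection (beta : {malg int[I]}) j (m : int) : real_root beta -> J j ->
    m%:~R = 2 * root_form beta << j >> / A j j ->
    real_root (beta - << j >> *~ m).

Inductive degree_space : {malg int[I]} -> set borcherds :=
| ds_e i : degree_space << i >> (be i)
| ds_f i : degree_space (- << i >>) (bf i)
| ds_h i : degree_space 0 (bh i)
| ds_lie alpha beta x y : degree_space alpha x -> degree_space beta y ->
    degree_space (alpha + beta) (lie x y)
| ds_0 alpha : degree_space alpha 0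
| ds_lin alpha (c : K) x y : degree_space alpha x -> degree_space alpha y ->
    degree_space alpha (c *: x + y).

Definition gJ_root_space (alpha : {malg int[I]}) : set borcherds :=
  gJ `&` degree_space alpha.

End Borcherds.

Arguments J {R K} iota {I} A i.
Arguments borcherds {R K} iota {I} A.
Arguments bh {R K} iota {I} A i.
Arguments be {R K} iota {I} A i.
Arguments bf {R K} iota {I} A i.
Arguments hspan {R K} iota {I} A _.
Arguments gJ {R K} iota {I} A _.
Arguments nJplus {R K} iota {I} A _.
Arguments nJminus {R K} iota {I} A _.
Arguments Vplus {R K} iota {I} A _.
Arguments Vminus {R K} iota {I} A _.
Arguments uplus {R K} iota {I} A _.
Arguments uminus {R K} iota {I} A _.
Arguments real_root {R K} iota {I} A _.
Arguments gJ_root_space {R K} iota {I} A alpha _.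
Arguments degree_space {R K} iota {I} A _ _.
Arguments root_form {K I} A x y.

Notation free_alg K S := {malg K[{fmonom S}]}.

Section FreeAlgebra.
Context (K : fieldType) (S : choiceType).
Local Notation T := (free_alg K S).
Implicit Types (s : S) (u v : nat -> T).

Definition fvar s : T := << fmu s >>.

Definition homogeneous (n : nat) : set T :=
  [set a | forall w, w \in msupp a -> fdeg w = n].

Definition freeLie : set T := lie_closure (range fvar).

Fixpoint word_derivation (d : S -> T) (w : seq S) : T :=
  if w is s :: w' then
    d s * (\prod_(t <- w') fvar t) + fvar s * word_derivation d w'
  else 0.

(* The derivation of A(S) extending d on the variables. *)
Definition free_derivation (d : S -> T) (a : T) : T :=
  \sum_(w <- msupp a) a@_w *: word_derivation d w.

(* A formal series is represented by the sequence of its components. *)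
Definition smul u v : nat -> T := fun n => \sum_(i < n.+1) u i * v (n - i)%N.
Definition sone : nat -> T := fun n => if n == 0%N then 1 else 0.
Definition spow u (k : nat) : nat -> T := iter k (smul u) sone.
Definition slie u v : nat -> T := fun n => smul u v n - smul v u n.

(* If u has no constant term then u^k has no component of degree < k, so that
   the following exponential and logarithmic series stop at k = n in degree n. *)
Definition sexp u : nat -> T :=
  fun n => \sum_(k < n.+1) (k`!%:R : K)^-1 *: spow u k n.
Definition slog u : nat -> T :=
  fun n => \sum_(1 <= k < n.+1)
    ((-1) ^+ k.+1 / k%:R : K) *: spow (fun m => u m - sone m) k n.

Definition Lhat : set (nat -> T) :=
  [set u | u 0%N = 0 /\ forall n, freeLie (u n) /\ homogeneous n (u n)].

Definition magnus : set (nat -> T) := sexp @` Lhat.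

Definition Ad (g : T -> T) u : nat -> T := fun n => g (u n).

End FreeAlgebra.

Arguments fvar K {S} s.
Arguments freeLie : clear implicits.
Arguments Lhat : clear implicits.
Arguments magnus : clear implicits.
Arguments sone {K S} _.
Arguments homogeneous {K S} n _.

Definition Lhat_automorphism (K : fieldType) (S : choiceType)
    (phi : (nat -> free_alg K S) -> nat -> free_alg K S) : Prop :=
  [/\ set_bij (Lhat K S) (Lhat K S) phi,
      forall (c : K) u v, Lhat K S u -> Lhat K S v ->
        phi (fun n => c *: u n + v n) = (fun n => c *: phi u n + phi v n)
    & forall u v, Lhat K S u -> Lhat K S v -> phi (slie u v) = slie (phi u) (phi v)].

Definition magnus_automorphism (K : fieldType) (S : choiceType)
    (phi : (nat -> free_alg K S) -> nat -> free_alg K S) : Prop :=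
  set_bij (magnus K S) (magnus K S) phi /\
  forall u v, magnus K S u -> magnus K S v -> phi (smul u v) = smul (phi u) (phi v).

(* u is the free Lie algebra L(W), realised inside A(S) by means of a basis S of
   the subspace W of u. *)
Definition is_free_lie (K : fieldType) (L : lieAlgType K) (W u : set L) : Prop :=
  forall (S : choiceType) (b : S -> L), is_basis W b ->
  exists phi : free_alg K S -> L,
    [/\ set_bij (freeLie K S) u phi, lie_hom_on (freeLie K S) phi
      & forall s, phi (fvar K s) = b s].

Section KacMoodyGroup.
Context (R : realType) (K : fieldType) (iota : {rmorphism K -> R[i]}).
Context (I : countType) (A : I -> I -> K).
Context (S : choiceType) (b : S -> borcherds iota A).
Local Notation T := (free_alg K S).

(* The identification of V' with A_1(S) = T^1(V') given by the basis b of V'. *)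
Definition tensor1 (v : borcherds iota A) : T := lincomb (fvar K) (coord b v).

Definition pi_rep (x : borcherds iota A) : T -> T :=
  free_derivation (fun s => tensor1 (lie x (b s))).

(* The subgroup of GL(T(V')) generated by the exp(pi(x)), for x in a real root
   space of g_J. *)
Inductive KM_group : set (T -> T) :=
| KM_exp alpha x : real_root iota A alpha -> gJ_root_space iota A alpha x ->
    KM_group (lnexp (pi_rep x))
| KM_id : KM_group id
| KM_comp g g' : KM_group g -> KM_group g' -> KM_group (g \o g')
| KM_inv g g' : KM_group g -> cancel g g' -> cancel g' g -> KM_group g'.

(* pi is a representation of g_J on T(V') by derivations, and it extends the
   adjoint action of g_J on V'. *)
Definition pi_is_representation : Prop :=
  [/\ forall x, gJ iota A x -> linear_map (pi_rep x) /\
        (forall a c, pi_rep x (a * c) = pi_rep x a * c + a * pi_rep x c),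
      forall x v, gJ iota A x -> Vminus iota A v ->
        Vminus iota A (lie x v) /\ pi_rep x (tensor1 v) = tensor1 (lie x v),
      forall (c : K) x y a, gJ iota A x -> gJ iota A y ->
        pi_rep (c *: x + y) a = c *: pi_rep x a + pi_rep y a
    & forall x y a, gJ iota A x -> gJ iota A y ->
        pi_rep (lie x y) a = pi_rep x (pi_rep y a) - pi_rep y (pi_rep x a)].

End KacMoodyGroup.

Definition is_group_on (X : Type) (N : set X) (mul : X -> X -> X) (e : X) : Prop :=
  [/\ N e,
      forall x y, N x -> N y -> N (mul x y),
      forall x y z, N x -> N y -> N z -> mul x (mul y z) = mul (mul x y) z,
      forall x, N x -> mul e x = x /\ mul x e = x
    & forall x, N x -> exists2 y, N y & mul x y = e /\ mul y x = e].

(* The group G is the semi-direct product of N and H for the action act of H on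
   N, the pair (n, h) being written q n h in G. *)
Definition is_semidirect_product (X Y : Type) (N : set X) (mulN : X -> X -> X)
    (H : set Y) (mulH : Y -> Y -> Y) (act : Y -> X -> X)
    (G : groupType) (q : X -> Y -> G) : Prop :=
  set_bij (N `*` H) [set: G] (fun p => q p.1 p.2) /\
  forall n1 h1 n2 h2, N n1 -> H h1 -> N n2 -> H h2 ->
    [/\ N (mulN n1 (act h1 n2)), H (mulH h1 h2)
      & (q n1 h1 * q n2 h2)%g = q (mulN n1 (act h1 n2)) (mulH h1 h2)].

(* Main.v *)
Require Import Defs.
From HB Require Import structures.
From mathcomp Require Import all_boot all_order all_algebra.
From mathcomp Require Import finmap complex generic_quotient ring zify.
From mathcomp Require Import boolp classical_sets functions reals.
From mathcomp.multinomials Require Import monalg.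

(** Three independent facts make up the theorem.

    The decomposition. The sum [u^+ + (g_J + h) + u^-] contains the generators
    and is stable under bracketing with them, hence is everything
    ([triangularT]): [e_i] with [i] outside [J] commutes with [n_J^-], so that it
    maps [V'] into [g_J + h], and therefore maps the subalgebra generated by [V']
    into the sum. The sum is direct because the diagonal automorphism that scales
    the [e_i] with [i] outside [J] by [2] has disjoint sets of eigenvalues on the
    three parts ([triangular_direct]). For freeness, Dynkin's map shows that in
    characteristic zero the Lie elements of the free associative algebra have the
    universal property of the free Lie algebra ([free_lie_lift_hom]), which gives
    a surjection from them to [u^-]. It is injective because [g] acts on the
    tensor algebra [T(V')], the module induced from the trivial representation of
    [u^+ + g_J + h], where [V'] acts by left multiplications
    ([tensor_representation], [free_uminus]). The Chevalley involution carries
    these results to [u^+].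

    The group [G_J]. For [j] in [J] the Serre relations make [ad e_j] and
    [ad f_j] locally nilpotent, and the product
    [exp (ad e_j) exp (- ad f_j) exp (ad e_j)], with suitably scaled [f_j], is an
    automorphism of [g] that maps the space of degree [alpha] to the one of the
    reflected degree ([reflection_degree]). Hence a root vector of a real root is
    conjugate to a multiple of some [e_j] ([real_root_vector]) and is ad-locally
    nilpotent. It then acts on [T(V')] by a locally nilpotent derivation that
    preserves the degree and the Lie elements, and the exponential of such a
    derivation is an automorphism with the same properties ([KM_group_graded]).

    The Magnus group. Let [theta] multiply the component of degree [n] of a
    series by [n]. A series [u] without constant term consists of Lie elements if
    and only if [exp (- u) theta (exp u)] does, because in degree [n] the latter
    is [n u_n] plus brackets of components of smaller degree
    ([lie_series_theta_fexp], [lie_series_of_theta]). The logarithmic derivative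
    of a product is the one of the second factor plus a conjugate of the one of
    the first, so that exponentials of Lie series are closed under products
    ([fexp_mul]). Graded automorphisms of the free algebra commute with products of series, hence with
    the exponential, and the semi-direct product is the usual one on pairs
    ([semidirect_group]). *)

Set Implicit Arguments.
Unset Strict Implicit.
Unset Printing Implicit Defensive.

Import Order.TTheory GRing.Theory Num.Theory.
Local Open Scope ring_scope.
Local Open Scope classical_set_scope.

(** * Linear maps, spans and eigenvectors *)

Section LinearMaps.
Context (K : fieldType).

Lemma linear_mapP (V W : lmodType K) (f : V -> W) : linear_map f -> exists g : {linear V -> W}, f = g.
Proof.
move=> f_lin.
pose g : {linear V -> W} := HB.pack f (GRing.isLinear.Build K V W _ f f_lin).
by exists g.
Qed.

Section Theory.
Context (V W : lmodType K) (f : V -> W) (f_lin : linear_map f).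

Lemma lmap0 : f 0 = 0.
Proof. by have [g ->] := linear_mapP f_lin; rewrite linear0. Qed.
Lemma lmapD x y : f (x + y) = f x + f y.
Proof. by have [g ->] := linear_mapP f_lin; rewrite linearD. Qed.
Lemma lmapZ c x : f (c *: x) = c *: f x.
Proof. by have [g ->] := linear_mapP f_lin; rewrite linearZ. Qed.
Lemma lmapN x : f (- x) = - f x.
Proof. by have [g ->] := linear_mapP f_lin; rewrite linearN. Qed.
Lemma lmapB x y : f (x - y) = f x - f y.
Proof. by have [g ->] := linear_mapP f_lin; rewrite linearB. Qed.
Lemma lmap_sum (I : Type) (r : seq I) (P : pred I) (F : I -> V) :
  f (\sum_(i <- r | P i) F i) = \sum_(i <- r | P i) f (F i).
Proof. by have [g ->] := linear_mapP f_lin; rewrite linear_sum. Qed.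
End Theory.

Lemma linear_map_comp (U V W : lmodType K) (f : V -> W) (g : U -> V) :
  linear_map f -> linear_map g -> linear_map (f \o g).
Proof. by move=> fl gl c x y /=; rewrite gl fl. Qed.

Lemma linear_map_iter (V : lmodType K) (f : V -> V) n : linear_map f -> linear_map (iter n f).
Proof. by move=> fl; elim: n => [|n IHn] c x y //=; rewrite IHn fl. Qed.

Lemma linear_mapN (V W : lmodType K) (f : V -> W) : linear_map f -> linear_map (fun x => - f x).
Proof. by move=> fl c x y; rewrite fl opprD scalerN. Qed.

Lemma linear_mapD (V W : lmodType K) (f g : V -> W) :
  linear_map f -> linear_map g -> linear_map (fun x => f x + g x).
Proof. by move=> fl gl c x y; rewrite fl gl scalerDr addrACA. Qed.

Lemma linear_mapZ (V W : lmodType K) (f : V -> W) a :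
  linear_map f -> linear_map (fun x => a *: f x).
Proof. by move=> fl c x y; rewrite fl scalerDr !scalerA mulrC. Qed.

Section Subspaces.
Context (V : lmodType K) (W : set V) (W_sub : subspace W).

Lemma sub0 : W 0. Proof. by case: W_sub. Qed.
Lemma subD x y : W x -> W y -> W (x + y).
Proof. by case: W_sub => _ WL Wx Wy; have := WL 1 x y Wx Wy; rewrite scale1r. Qed.
Lemma subZ c x : W x -> W (c *: x).
Proof. by case: W_sub => W0 WL Wx; have := WL c x 0 Wx W0; rewrite addr0. Qed.
Lemma subN x : W x -> W (- x).
Proof. by move=> Wx; rewrite -scaleN1r; exact: subZ. Qed.
Lemma subB x y : W x -> W y -> W (x - y).
Proof. by move=> Wx Wy; apply: subD => //; exact: subN. Qed.
Lemma sub_sum (I : eqType) (r : seq I) (F : I -> V) :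
  (forall i, i \in r -> W (F i)) -> W (\sum_(i <- r) F i).
Proof.
elim: r => [|i r IHr] WF; first by rewrite big_nil; exact: sub0.
rewrite big_cons; apply: subD; first by apply: WF; rewrite mem_head.
by apply: IHr => j jr; apply: WF; rewrite in_cons jr orbT.
Qed.
End Subspaces.

Section Span.
Context (V : lmodType K).
Implicit Types X Y W : set V.

Lemma subspace_lspan X : subspace (lspan X).
Proof.
split=> [|c x y Xx Xy] W [W_sub XW]; first exact: sub0.
by case: (W_sub) => _; apply; [exact: Xx | exact: Xy].
Qed.

Lemma sub_lspan X : X `<=` lspan X.
Proof. by move=> x Xx W [_]; apply. Qed.

Lemma lspan_sub X W : subspace W -> X `<=` W -> lspan X `<=` W.
Proof. by move=> W_sub XW x; apply. Qed.

Lemma lspanS X Y : X `<=` Y -> lspan X `<=` lspan Y.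
Proof.
move=> XY; apply: lspan_sub; first exact: subspace_lspan.
by move=> x /XY; exact: sub_lspan.
Qed.

Lemma lspan_map (V' : lmodType K) (f : V -> V') X (W : set V') :
  linear_map f -> subspace W -> (forall x, X x -> W (f x)) ->
  forall x, lspan X x -> W (f x).
Proof.
move=> fl W_sub XW; apply: (@lspan_sub X (f @^-1` W)) => //.
split; rewrite /preimage /=; first by rewrite lmap0 //; exact: sub0.
by move=> c x y Wx Wy; rewrite fl; case: W_sub => _; apply.
Qed.

Lemma subspace_sum X Y : subspace X -> subspace Y ->
  subspace [set x + y | x in X & y in Y].
Proof.
move=> X_sub Y_sub; split.
  exists 0; first exact: sub0.
  by exists 0; [exact: sub0 | rewrite addr0].
move=> c _ _ [x Xx [y Yy <-]] [x' Xx' [y' Yy' <-]].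
exists (c *: x + x'); first by case: X_sub => _; apply.
exists (c *: y + y'); first by case: Y_sub => _; apply.
by rewrite scalerDr addrACA.
Qed.

End Span.

(** A vector in the span of eigenvectors of [T] is killed by a product of
    factors [T - a], with [a] among the eigenvalues; two such products without
    a common factor kill only [0]. *)
Section EigenSeparation.
Context (V : lmodType K) (T : V -> V) (T_lin : linear_map T).
Implicit Types (r : seq K) (E F : set K).

Definition eig_kill r (v : V) : V := foldr (fun a u => T u - a *: u) v r.

Definition eig_span E : set V := lspan [set v | exists2 a, E a & T v = a *: v].

Let shift_lin a : linear_map (fun u => T u - a *: u).
Proof.
apply: linear_mapD => //; apply: linear_mapN; exact: linear_mapZ.
Qed.

Lemma eig_kill_lin r : linear_map (eig_kill r).
Proof. by elim: r => [|a r IHr] c x y //=; rewrite IHr shift_lin. Qed.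

Let eig_kill_shift r a v : eig_kill r (T v - a *: v) = T (eig_kill r v) - a *: eig_kill r v.
Proof.
elim: r => [|d r IHr] //=; rewrite IHr.
rewrite !(lmapB T_lin) !(lmapZ T_lin) !scalerBr !scalerA (mulrC a d).
by rewrite !opprB !addrA [LHS](ACl (1*4*3*2))%AC /=.
Qed.

Lemma eig_kill_cat r1 r2 v : eig_kill (r1 ++ r2) v = eig_kill r1 (eig_kill r2 v).
Proof. by rewrite /eig_kill foldr_cat. Qed.

Lemma eig_killC r1 r2 v : eig_kill r1 (eig_kill r2 v) = eig_kill r2 (eig_kill r1 v).
Proof. by elim: r2 => //= a r IHr; rewrite eig_kill_shift IHr. Qed.

Lemma eig_kill_eigen r a v : T v = a *: v ->
  eig_kill r v = (\prod_(d <- r) (a - d)) *: v.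
Proof.
move=> Tv; elim: r => [|d r IHr] /=; first by rewrite big_nil scale1r.
by rewrite IHr (lmapZ T_lin) Tv big_cons !scalerA -scalerBl; congr (_ *: _); ring.
Qed.

Lemma eig_spanP E v : eig_span E v ->
  exists2 r, (forall a, a \in r -> E a) & eig_kill r v = 0.
Proof.
move: v; apply: lspan_sub; last first.
  move=> v [a Ea Tv]; exists [:: a] => [d|/=]; last by rewrite Tv subrr.
  by rewrite inE => /eqP->.
split; first by exists [::].
move=> c x y [r Er rx] [s Es sy]; exists (r ++ s).
  by move=> a; rewrite mem_cat => /orP[/Er|/Es].
rewrite eig_kill_lin eig_kill_cat eig_killC rx eig_kill_cat sy.
by rewrite !(lmap0 (eig_kill_lin _)) scaler0 addr0.
Qed.

(** By induction on [r]: [T v - a *: v] is killed by the other factors,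
    hence zero, so [v] is an eigenvector for [a], on which the factors [T - d]
    with [d] in [s] act by the nonzero scalars [a - d]. *)
Lemma eig_kill_disjoint r s v : (forall a, a \in r -> a \notin s) ->
  eig_kill r v = 0 -> eig_kill s v = 0 -> v = 0.
Proof.
elim: r v => [|a r IHr] v // rs rv sv.
have Tv : T v = a *: v.
  apply/eqP; rewrite -subr_eq0; apply/eqP/IHr.
  - by move=> d dr; apply: rs; rewrite in_cons dr orbT.
  - by rewrite eig_kill_shift.
  - by rewrite eig_kill_shift sv lmap0 // scaler0 subr0.
have /eqP := eig_kill_eigen s Tv; rewrite sv eq_sym scaler_eq0.
case/orP=> [|/eqP//]; rewrite prodf_seq_eq0 => /hasP[d ds /=].
by rewrite subr_eq0 => /eqP ad; have := rs a (mem_head _ _); rewrite ad ds.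
Qed.

Lemma eig_span_disjoint E F v : E `&` F `<=` set0 ->
  eig_span E v -> eig_span F v -> v = 0.
Proof.
move=> EF /eig_spanP[r Er rv] /eig_spanP[s Fs sv].
apply: eig_kill_disjoint rv sv => a /Er Ea; apply/negP => /Fs Fa.
exact: (EF a).
Qed.

Lemma eig_spanS E F : E `<=` F -> eig_span E `<=` eig_span F.
Proof. by move=> EF; apply: lspanS => v [a /EF]; exists a. Qed.

End EigenSeparation.

Section LinComb.
Context (X : choiceType).

(** The sum may range over any finite set containing the support, so that two
    combinations can be compared over a common one. *)
Lemma lincombEw (V : lmodType K) (b : X -> V) (c : {malg K[X]}) (d : {fset X}) :
  (msupp c `<=` d)%fset -> lincomb b c = \sum_(x <- d) c@_x *: b x.
Proof.
move=> cd; rewrite /lincomb [RHS](bigID (mem (msupp c))) /= [X in _ + X]big1 ?addr0.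
  by rewrite -[RHS]big_filter; apply: perm_big; apply: uniq_perm;
    rewrite ?filter_uniq ?fset_uniq // => x; rewrite mem_filter andbC;
    case: (boolP (x \in d)) => //= /negP xd; apply/negP => /(fsubsetP cd).
by move=> x xc; rewrite mcoeff_outdom ?scale0r.
Qed.

Lemma lincomb_linear (V : lmodType K) (b : X -> V) : linear_map (lincomb b).
Proof.
move=> c x y; pose d := (msupp x `|` msupp y)%fset.
have xd : (msupp x `<=` d)%fset by rewrite fsubsetUl.
have yd : (msupp y `<=` d)%fset by rewrite fsubsetUr.
have cd : (msupp (c *: x + y) `<=` d)%fset.
  by apply: fsubset_trans (msuppD_le _ _) _; apply: fsetSU; exact: msuppZ_le.
rewrite !(lincombEw _ xd, lincombEw _ yd, lincombEw _ cd) scaler_sumr -big_split.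
by apply: eq_bigr => i _; rewrite mcoeffD mcoeffZ scalerDl scalerA.
Qed.

Lemma lincombU (V : lmodType K) (b : X -> V) x : lincomb b << x >> = b x.
Proof. by rewrite /lincomb msuppU oner_eq0 big_seq_fset1 mcoeffUU scale1r. Qed.

Lemma malg_lincomb (c : {malg K[X]}) : c = lincomb (fun x => << x >>) c.
Proof.
apply/malgP => k; rewrite {1}(monalgE c) /lincomb.
congr (_@__); apply: eq_bigr => x _; apply/malgP => j.
by rewrite mcoeffZ !mcoeffU mulrnAr mulr1.
Qed.

Lemma malg_ext (V : lmodType K) (f g : {malg K[X]} -> V) :
  linear_map f -> linear_map g -> (forall x, f << x >> = g << x >>) -> f =1 g.
Proof.
move=> fl gl fg c; rewrite (malg_lincomb c) /lincomb !lmap_sum //.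
by apply: eq_bigr => x _; rewrite !lmapZ // fg.
Qed.

Lemma malg_sub (W : set {malg K[X]}) : subspace W ->
  (forall x, W << x >>) -> forall c, W c.
Proof.
move=> W_sub WX c; rewrite (malg_lincomb c).
by apply: sub_sum => // x _; exact: subZ.
Qed.

End LinComb.

End LinearMaps.

(** * Exponentials of locally nilpotent maps *)

(** Regrouping by antidiagonals, for a product of two terminating series. *)
Lemma triangle_sum (V : nmodType) (f : nat -> nat -> V) N :
  (forall i j, (N <= i + j)%N -> f i j = 0) ->
  \sum_(n < N) \sum_(i < n.+1) f i (n - i)%N = \sum_(i < N) \sum_(j < N) f i j.
Proof.
move=> f0; under eq_bigr => n _.
  rewrite -(big_mkord xpredT (fun i => f i (n - i)%N)) (big_nat_widen _ _ _ _ _ (ltn_ord n)).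
  rewrite big_mkord; under eq_bigl do rewrite /= ltnS.
  over.
rewrite (exchange_big_dep xpredT) //=; apply: eq_bigr => i _.
rewrite -(big_mkord (fun n => i <= n)%N (fun n => f i (n - i)%N)).
rewrite (big_cat_nat (n := i)) //=; last exact: ltnW.
rewrite big_nat_cond big_pred0 ?add0r; last first.
  by move=> n; apply/negP => /andP[/andP[_ ni] ni']; move: ni; rewrite ltnNge ni'.
rewrite -{1}(add0n i) big_addn.
rewrite -[RHS](big_mkord xpredT) [RHS](big_cat_nat (n := (N - i)%N)) ?leq_subr //=.
rewrite [X in _ = _ + X]big_nat_cond [X in _ = _ + X]big1 ?addr0; last first.
  by move=> j /andP[/andP[Nij _] _]; apply: f0; rewrite -leq_subLR.
by apply: congr_big_nat => // j; rewrite ?leq_addl ?addnK.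
Qed.

Section CharZero.
Context (K : fieldType) (K_char0 : forall n, (n.+1%:R : K) != 0).

Lemma fact_neq0 n : (n`!%:R : K) != 0.
Proof. by rewrite -(prednK (fact_gt0 n)). Qed.

Lemma invfact_S n : (n.+1%:R : K) * (n.+1`!%:R)^-1 = (n`!%:R)^-1.
Proof.
by rewrite factS natrM invfM mulrCA mulrA mulVf ?mul1r // K_char0.
Qed.

(** This is [(1 - 1) ^+ n / n`!]. *)
Lemma exp_coef_inv n :
  \sum_(i < n.+1) (i`!%:R : K)^-1 * ((-1) ^+ (n - i) * ((n - i)`!%:R)^-1) = (n == 0%N)%:R.
Proof.
case: n => [|n]; first by rewrite big_ord1 /= fact0 invr1 expr0 !mulr1.
have /eqP := erefl ((1 - 1 : K) ^+ n.+1); rewrite {1}subrr expr0n /= => /eqP.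
rewrite [1 - 1]addrC exprDn => /(congr1 (fun x => (n.+1`!%:R)^-1 * x)).
rewrite mulr0 mulr_sumr => sum0; rewrite [RHS]sum0; apply: eq_bigr => i _.
have ni : (i <= n.+1)%N by rewrite -ltnS.
rewrite expr1n mulr1 -[_ *+ 'C(_, _)]mulr_natl.
have -> : ('C(n.+1, i)%:R : K) = n.+1`!%:R * ((i`!%:R)^-1 * ((n.+1 - i)`!%:R)^-1).
  rewrite -(bin_fact ni) !natrM -invfM mulfK // mulf_neq0 //; exact: fact_neq0.
by rewrite !mulrA mulVf ?fact_neq0 // mul1r mulrAC -!mulrA.
Qed.

Section LocallyNilpotent.
Context (V : lmodType K) (D : V -> V) (D_lin : linear_map D).
Implicit Types (v w : V).

Definition divpow n v : V := (n`!%:R)^-1 *: iter n D v.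

Lemma iter_ge_nil n m v : (n <= m)%N -> iter n D v = 0 -> iter m D v = 0.
Proof.
by move=> /subnK<- nv; rewrite iterD nv (lmap0 (linear_map_iter _ D_lin)).
Qed.

Lemma divpow_nil n m v : (n <= m)%N -> iter n D v = 0 -> divpow m v = 0.
Proof. by move=> nm nv; rewrite /divpow (iter_ge_nil nm nv) scaler0. Qed.

Lemma divpowS n v : D (divpow n v) = n.+1%:R *: divpow n.+1 v.
Proof. by rewrite /divpow (lmapZ D_lin) scalerA invfact_S. Qed.

Lemma divpow_lin n : linear_map (divpow n).
Proof. by apply: linear_mapZ; exact: linear_map_iter. Qed.

Lemma sum_divpow_trunc n m v : (n <= m)%N -> iter n D v = 0 ->
  \sum_(k < m) divpow k v = \sum_(k < n) divpow k v.
Proof.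
move=> nm nv; rewrite -!(big_mkord xpredT (fun k => divpow k v)).
rewrite (big_cat_nat (n := n)) //= [X in _ + X]big_nat_cond [X in _ + X]big1 ?addr0 //.
by move=> k /andP[/andP[nk _] _]; exact: divpow_nil nk nv.
Qed.

(** Beyond any index at which the iterates of [D] vanish on [v] the terms of the
    series are zero. *)
Lemma lnexpE n v : iter n D v = 0 -> lnexp D v = \sum_(k < n) divpow k v.
Proof.
move=> nv; rewrite /lnexp -/(divpow _ _).
set m := xget _ _; have mv : iter m D v = 0.
  by apply: (@xgetPex _ 0%N [set n | iter n D v = 0]); exists n.
have [nm|/ltnW mn] := leqP n m; first exact: sum_divpow_trunc.
by rewrite -(sum_divpow_trunc mn mv).
Qed.

Lemma iter_nilD n m v w : iter n D v = 0 -> iter m D w = 0 ->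
  iter (n + m) D (v + w) = 0.
Proof.
move=> nv mw; rewrite (lmapD (linear_map_iter _ D_lin)).
by rewrite (iter_ge_nil (leq_addr _ _) nv) (iter_ge_nil (leq_addl _ _) mw) addr0.
Qed.

Lemma iter_nilZ n c v : iter n D v = 0 -> iter n D (c *: v) = 0.
Proof. by move=> nv; rewrite (lmapZ (linear_map_iter _ D_lin)) nv scaler0. Qed.

Lemma nil_subspace : subspace [set v | exists n, iter n D v = 0].
Proof.
split=> [|c v w [n nv] [m mw]]; first by exists 0%N.
by exists (n + m)%N; apply: iter_nilD => //; exact: iter_nilZ.
Qed.

Lemma lnexp_lin : locally_nilpotent D -> linear_map (lnexp D).
Proof.
move=> D_nil c v w; have [n nv] := D_nil v; have [m mw] := D_nil w.
have nv' := iter_nilZ c nv.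
rewrite (lnexpE (iter_nilD nv' mw)).
rewrite (lnexpE (iter_ge_nil (leq_addr m n) nv)) (lnexpE (iter_ge_nil (leq_addl n m) mw)).
by rewrite scaler_sumr -big_split; apply: eq_bigr => k _; rewrite divpow_lin.
Qed.

Lemma lnexp_preserve (W : set V) : locally_nilpotent D -> subspace W ->
  (forall w, W w -> W (D w)) -> forall w, W w -> W (lnexp D w).
Proof.
move=> D_nil W_sub WD w Ww; have [n nv] := D_nil w; rewrite (lnexpE nv).
apply: sub_sum => // k _; apply: subZ => //.
by elim: (k : nat) => //= j; exact: WD.
Qed.

End LocallyNilpotent.

Lemma iterN (V : lmodType K) (D : V -> V) (D_lin : linear_map D) n v :
  iter n (fun x => - D x) v = (-1) ^+ n *: iter n D v.
Proof.
elim: n => [|n IHn] /=; first by rewrite expr0 scale1r.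
by rewrite IHn (lmapZ D_lin) exprS mulN1r scaleNr.
Qed.

Lemma locally_nilpotentN (V : lmodType K) (D : V -> V) : linear_map D ->
  locally_nilpotent D -> locally_nilpotent (fun x => - D x).
Proof.
by move=> D_lin D_nil v; have [n nv] := D_nil v; exists n; rewrite iterN // nv scaler0.
Qed.

(** The product of the two series is regrouped by powers of [D], whose
    coefficients are those of [(1 - 1) ^+ n / n`!]. *)
Lemma lnexpK (V : lmodType K) (D : V -> V) : linear_map D -> locally_nilpotent D ->
  cancel (lnexp D) (lnexp (fun x => - D x)).
Proof.
move=> D_lin D_nil v; have [N Nv] := D_nil v.
have DN_lin := linear_mapN D_lin; have DN_nil := locally_nilpotentN D_lin D_nil.
have nil i j : (N <= i + j)%N -> iter i D (iter j D v) = 0.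
  by move=> Nij; rewrite -iterD; exact: iter_ge_nil Nv.
rewrite (lnexpE D_lin Nv) (lmap_sum (lnexp_lin DN_lin DN_nil)).
pose f i j := divpow (fun x => - D x) j (divpow D i v).
rewrite (eq_bigr (fun i : 'I_N => \sum_(j < N) f i j)) => [|i _]; last first.
  apply: lnexpE => //; rewrite iterN // (lmapZ (linear_map_iter _ D_lin)).
  by rewrite nil ?leq_addr // !scaler0.
rewrite -triangle_sum => [|i j Nij]; last first.
  rewrite /f /divpow iterN // (lmapZ (linear_map_iter _ D_lin)) nil ?scaler0 //.
  by rewrite addnC.
have fE n : \sum_(i < n.+1) f i (n - i)%N = (n == 0%N)%:R *: iter n D v.
  rewrite -exp_coef_inv scaler_suml; apply: eq_bigr => i _.
  rewrite /f /divpow iterN // (lmapZ (linear_map_iter _ D_lin)) -iterD subnK -1?ltnS //.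
  rewrite !scalerA; congr (_ *: _); ring.
rewrite (eq_bigr (fun n : 'I_N => ((n : nat) == 0%N)%:R *: iter n D v)) => [|n _]; last exact: fE.
case: N Nv {f nil fE} => [/= ->|N _]; first by rewrite big_ord0.
rewrite big_ord_recl /= scale1r big1 ?addr0 // => i _; exact: scale0r.
Qed.

Lemma lnexpNK (V : lmodType K) (D : V -> V) : linear_map D -> locally_nilpotent D ->
  cancel (lnexp (fun x => - D x)) (lnexp D).
Proof.
move=> D_lin D_nil v.
have := lnexpK (linear_mapN D_lin) (locally_nilpotentN D_lin D_nil) v.
by rewrite (_ : (fun x => - - D x) = D) //; apply/funext => x; rewrite opprK.
Qed.

(** A map satisfying the Leibniz rule exponentiates to a multiplicative one:
    the divided powers [D ^ n / n`!] satisfy the rule of a product of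
    exponential series. *)
Section Leibniz.
Context (V1 V2 V3 : lmodType K) (m : V1 -> V2 -> V3).
Context (m_linl : forall y, linear_map (m^~ y)) (m_linr : forall x, linear_map (m x)).
Context (D1 : V1 -> V1) (D2 : V2 -> V2) (D3 : V3 -> V3).
Context (D1_lin : linear_map D1) (D2_lin : linear_map D2) (D3_lin : linear_map D3).
Context (leibniz : forall x y, D3 (m x y) = m (D1 x) y + m x (D2 y)).

Lemma divpow_leibniz n x y :
  divpow D3 n (m x y) = \sum_(i < n.+1) m (divpow D1 i x) (divpow D2 (n - i) y).
Proof.
elim: n => [|n IHn].
  by rewrite big_ord1 /divpow /= fact0 invr1 !scale1r.
apply: (scalerI (K_char0 n)); rewrite -divpowS // IHn (lmap_sum D3_lin).
under eq_bigr => i _ do rewrite leibniz !divpowS // (lmapZ (m_linl _)) (lmapZ (m_linr _)).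
rewrite big_split scaler_sumr /=.
pose g i := m (divpow D1 i x) (divpow D2 (n.+1 - i) y).
transitivity (\sum_(i < n.+2) (i%:R *: g i + (n.+1 - i)%:R *: g i)); last first.
  apply: eq_bigr => i _; rewrite -scalerDl -natrD subnKC // -ltnS; exact: ltn_ord.
rewrite big_split /=; congr (_ + _).
  by rewrite [RHS]big_ord_recl scale0r add0r; apply: eq_bigr => i _; rewrite /g subSS.
rewrite [RHS]big_ord_recr /= subnn scale0r addr0; apply: eq_bigr => i _.
by rewrite /g subSn // -ltnS.
Qed.

Lemma iter_leibniz_nil p q x y : iter p D1 x = 0 -> iter q D2 y = 0 ->
  iter (p + q) D3 (m x y) = 0.
Proof.
move=> px qy; have /eqP : divpow D3 (p + q) (m x y) = 0.
  rewrite divpow_leibniz big1 // => i _.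
  have [pi|ip] := leqP p i; first by rewrite (divpow_nil D1_lin pi px) (lmap0 (m_linl _)).
  rewrite (divpow_nil D2_lin _ qy) ?(lmap0 (m_linr _)) //; lia.
by rewrite scaler_eq0 invr_eq0 (negPf (fact_neq0 _)) => /eqP.
Qed.

Lemma lnexp_leibniz x y : locally_nilpotent D1 -> locally_nilpotent D2 ->
  lnexp D3 (m x y) = m (lnexp D1 x) (lnexp D2 y).
Proof.
move=> D1_nil D2_nil; have [p px] := D1_nil x; have [q qy] := D2_nil y.
rewrite (lnexpE D3_lin (iter_leibniz_nil px qy)).
rewrite (lnexpE D1_lin (iter_ge_nil D1_lin (leq_addr q p) px)).
rewrite (lnexpE D2_lin (iter_ge_nil D2_lin (leq_addl p q) qy)).
rewrite (lmap_sum (m_linl _)); under eq_bigr do rewrite divpow_leibniz.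
under [RHS]eq_bigr do rewrite (lmap_sum (m_linr _)).
apply: (triangle_sum (f := fun i j => m (divpow D1 i x) (divpow D2 j y))) => i j pqij.
have [pi|ip] := leqP p i; first by rewrite (divpow_nil D1_lin pi px) (lmap0 (m_linl _)).
rewrite (divpow_nil D2_lin _ qy) ?(lmap0 (m_linr _)) //; lia.
Qed.

End Leibniz.
End CharZero.

(** * Lie algebras given by generators and relations *)

Section LieBasics.
Context (K : fieldType) (L : lieAlgType K).
Implicit Types (x y z : L) (H W X : set L).

Lemma linear_lier x : linear_map (lie x).
Proof. by move=> c y z; exact: lie_linearr. Qed.
Lemma linear_liel y : linear_map (fun x => lie x y).
Proof. by move=> c x z; exact: lie_linearl. Qed.

Definition lie0x x : lie 0 x = 0 := lmap0 (linear_liel x).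
Definition liex0 x : lie x 0 = 0 := lmap0 (linear_lier x).
Definition lieDl x y z : lie (x + y) z = lie x z + lie y z := lmapD (linear_liel z) x y.
Definition lieDr x y z : lie z (x + y) = lie z x + lie z y := lmapD (linear_lier z) x y.
Definition lieZl c x z : lie (c *: x) z = c *: lie x z := lmapZ (linear_liel z) c x.
Definition lieZr c x z : lie z (c *: x) = c *: lie z x := lmapZ (linear_lier z) c x.
Definition lieNl x z : lie (- x) z = - lie x z := lmapN (linear_liel z) x.
Definition lieNr x z : lie z (- x) = - lie z x := lmapN (linear_lier z) x.

Lemma lieC x y : lie x y = - lie y x.
Proof.
apply/eqP; rewrite -addr_eq0; have := liexx (x + y).
by rewrite lieDl !lieDr !liexx add0r addr0 => /eqP.
Qed.

Lemma lie_leibniz x y z : lie x (lie y z) = lie (lie x y) z + lie y (lie x z).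
Proof.
have /eqP := lie_jacobi x y z; rewrite -addrA addr_eq0 => /eqP->.
by rewrite opprD (lieC z x) lieNr opprK addrC (lieC z (lie x y)) opprK.
Qed.

Lemma lie_lie x y z : lie (lie x y) z = lie x (lie y z) - lie y (lie x z).
Proof. by rewrite (lie_leibniz x y z) addrK. Qed.

Lemma lie_subalgebra_closure X : lie_subalgebra (lie_closure X).
Proof.
split; first split.
- by move=> H [[H_sub _] _]; exact: sub0.
- by move=> c x y Xx Xy H HX; case: (HX) => -[[_ HL] _] _; apply: HL; [exact: Xx | exact: Xy].
- by move=> x y Xx Xy H HX; case: (HX) => -[_ HL] _; apply: HL; [exact: Xx | exact: Xy].
Qed.

Lemma sub_lie_closure X : X `<=` lie_closure X.
Proof. by move=> x Xx H [_]; apply. Qed.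

Lemma lie_closure_sub X H : lie_subalgebra H -> X `<=` H -> lie_closure X `<=` H.
Proof. by move=> H_sub XH x; apply. Qed.

Lemma lie_closureS X W : X `<=` W -> lie_closure X `<=` lie_closure W.
Proof.
move=> XW; apply: lie_closure_sub; first exact: lie_subalgebra_closure.
by move=> x /XW; exact: sub_lie_closure.
Qed.

Definition stabilizer W : set L := [set x | forall w, W w -> W (lie x w)].

Lemma stabilizer_subalgebra W : subspace W -> lie_subalgebra (stabilizer W).
Proof.
move=> W_sub; split; first split.
- by move=> w _; rewrite lie0x; exact: sub0.
- move=> c x y sx sy w Ww; rewrite lie_linearl.
  by case: W_sub => _; apply; [exact: sx | exact: sy].
- move=> x y sx sy w Ww; rewrite lie_lie; apply: subB => //.
    by apply: sx; exact: sy.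
  by apply: sy; exact: sx.
Qed.

Lemma stabilizer_closure X W : subspace W -> X `<=` stabilizer W ->
  lie_closure X `<=` stabilizer W.
Proof. by move=> W_sub; apply: lie_closure_sub; exact: stabilizer_subalgebra. Qed.

Lemma stabilizer_lspan X x : (forall w, X w -> lspan X (lie x w)) ->
  stabilizer (lspan X) x.
Proof.
move=> sX; apply: lspan_map sX; [exact: linear_lier | exact: subspace_lspan].
Qed.

(** Right-normed brackets of generators span the subalgebra. *)
Lemma lie_closure_stable X W : subspace W -> X `<=` W -> X `<=` stabilizer W ->
  lie_closure X `<=` W.
Proof.
move=> W_sub XW XS.
have S_sub := stabilizer_subalgebra W_sub.
suff : lie_closure X `<=` (W `&` stabilizer W) by move=> sub x /sub[].
apply: lie_closure_sub; last by move=> x Xx; split; [exact: XW | exact: XS].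
split; first split.
- by split; [exact: sub0 | exact: (sub0 (proj1 S_sub))].
- move=> c x y [Wx Sx] [Wy Sy]; split; first by case: W_sub => _; apply.
  by case: S_sub => -[_ + _]; apply.
- by move=> x y [_ Sx] [Wy Sy]; split; [exact: Sx | case: S_sub => _; apply].
Qed.

(** Bracketing with [x] is a derivation, so that its effect on a subalgebra is
    controlled by its effect on generators. *)
Lemma normalize_closure X x : (forall y, X y -> lie_closure X (lie x y)) ->
  stabilizer (lie_closure X) x.
Proof.
move=> XS; suff sub : lie_closure X `<=` (lie_closure X `&` (lie x @^-1` lie_closure X)).
  by move=> y /sub[].
have [C_sub C_lie] := lie_subalgebra_closure X.
apply: lie_closure_sub; last by move=> y Xy; split; [exact: sub_lie_closure | exact: XS].
split; first split.
- by split; rewrite /preimage /= ?liex0; exact: sub0.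
- move=> c y z [Cy Cxy] [Cz Cxz]; split; first by case: C_sub => _; apply.
  by rewrite /preimage /= lie_linearr; case: C_sub => _; apply.
- move=> y z [Cy Cxy] [Cz Cxz]; split; first exact: C_lie.
  by rewrite /preimage /= lie_leibniz; apply: (subD C_sub); exact: C_lie.
Qed.

(** By the Leibniz rule: brackets of elements of the closure with elements of [W]
    stay in the closure. *)
Lemma closure_into_normalizer X W x : subspace W ->
  W `<=` stabilizer (lie_closure X) -> (forall y, X y -> W (lie x y)) ->
  forall u, lie_closure X u -> [set w + v | w in W & v in lie_closure X] (lie x u).
Proof.
move=> W_sub WS XW u Xu; have [u_sub u_lie] := lie_subalgebra_closure X.
set U := lie_closure X in WS Xu u_sub u_lie *; set s := image2 W U _.
have s_sub : subspace s by exact: subspace_sum W_sub u_sub.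
have u_s z : s z -> forall u, U u -> U (lie z u).
  move=> [l ll [v uv <-]] w uw; rewrite lieDl; apply: (subD u_sub); last exact: u_lie.
  exact: WS.
have sub : U `<=` (U `&` [set u | s (lie x u)]).
  apply: lie_closure_sub.
    split; first split.
    - by split; rewrite /= ?liex0; [exact: sub0 u_sub | exact: sub0 s_sub].
    - move=> c y z [uy sy] [uz sz]; split; first by case: u_sub => _; apply.
      by rewrite /= lie_linearr; case: s_sub => _; apply.
    - move=> y z [uy sy] [uz sz]; split; first exact: u_lie.
      rewrite /= lie_leibniz; exists 0; first exact: (sub0 W_sub).
      exists (lie (lie x y) z + lie y (lie x z)); last by rewrite add0r.
      apply: (subD u_sub); first exact: u_s.
      by rewrite lieC; apply: (subN u_sub); exact: u_s.
  move=> y Xy; split; first exact: sub_lie_closure.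
  exists (lie x y); first exact: XW.
  by exists 0; [exact: (sub0 u_sub) | rewrite addr0].
by have [] := sub _ Xu.
Qed.

(** For nilpotency of order [p] on [y] and [q] on [z], the Leibniz rule gives
    order [p + q] on [lie y z]. *)
Lemma nil_ad_subalgebra (K_char0 : forall n, (n.+1%:R : K) != 0) x :
  lie_subalgebra [set y | exists n, iter n (lie x) y = 0].
Proof.
split; first exact: nil_subspace (linear_lier x).
move=> y z [p py] [q qz]; exists (p + q)%N.
exact: (@iter_leibniz_nil K K_char0 L L L (@lie _ L) linear_liel linear_lier
  _ _ _ (linear_lier x) (linear_lier x) (linear_lier x) (lie_leibniz x)).
Qed.

End LieBasics.

(** Multiplicativity extends from a spanning set by bilinearity. *)
Lemma lspan_lie_hom (K : fieldType) (L L' : lieAlgType K) (X : set L) (phi : L -> L') :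
  linear_map phi ->
  (forall a b, X a -> X b -> phi (lie a b) = lie (phi a) (phi b) /\ lspan X (lie a b)) ->
  lie_subalgebra (lspan X) /\ lie_hom_on (lspan X) phi.
Proof.
move=> ll XX; set F := lspan X.
have F_sub : subspace F by exact: subspace_lspan.
have FF a b : F a -> F b -> phi (lie a b) = lie (phi a) (phi b) /\ F (lie a b).
  move=> + Fb; move: a; apply: lspan_sub.
    split; first by rewrite /= lie0x (lmap0 ll) lie0x; split=> //; exact: sub0 F_sub.
    move=> k x y [xE xF] [yE yF]; rewrite /= lie_linearl !ll lie_linearl xE yE; split=> //.
    by case: F_sub => _; apply.
  move=> a Xa; move: b Fb; apply: lspan_sub; last by move=> b Xb; exact: XX.
  split; first by rewrite /= liex0 (lmap0 ll) liex0; split=> //; exact: sub0 F_sub.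
  move=> k x y [xE xF] [yE yF]; rewrite /= lie_linearr !ll lie_linearr xE yE; split=> //.
  by case: F_sub => _; apply.
split; first by split=> // x y Fx Fy; have [] := FF x y Fx Fy.
by split=> [k x y _ _|x y Fx Fy]; [exact: ll | have [] := FF x y Fx Fy].
Qed.

Definition lie_morph (K : fieldType) (L L' : lieAlgType K) (f : L -> L') : Prop :=
  linear_map f /\ forall x y, f (lie x y) = lie (f x) (f y).

Lemma lie_morph_closure (K : fieldType) (L L' : lieAlgType K) (f : L -> L')
    (X : set L) (H : set L') : lie_morph f -> lie_subalgebra H ->
  (forall x, X x -> H (f x)) -> forall x, lie_closure X x -> H (f x).
Proof.
move=> [fl fb] [H_sub H_lie] XH x; apply: (@lie_closure_sub _ _ _ (f @^-1` H)) => //.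
split; first split.
- by rewrite /preimage /= lmap0 //; exact: sub0.
- by move=> c y z Hy Hz; rewrite /preimage /= fl; case: H_sub => _; apply.
- by move=> y z Hy Hz; rewrite /preimage /= fb; exact: H_lie.
Qed.

Lemma lie_hom_on_closure (K : fieldType) (L L' : lieAlgType K) (X : set L) (phi : L -> L')
    (H : set L') : linear_map phi -> lie_hom_on (lie_closure X) phi -> lie_subalgebra H ->
  (forall x, X x -> H (phi x)) -> forall x, lie_closure X x -> H (phi x).
Proof.
move=> ll [_ lh] [H_sub H_lie] XH; have [C_sub C_lie] := lie_subalgebra_closure X.
suff sub : lie_closure X `<=` (lie_closure X `&` (phi @^-1` H)) by move=> x /sub[].
apply: lie_closure_sub; last by move=> x Xx; split; [exact: sub_lie_closure | exact: XH].
split; first split.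
- by split; [exact: sub0 C_sub | rewrite /preimage /= lmap0 //; exact: sub0 H_sub].
- move=> k x y [Cx Hx] [Cy Hy]; split; first by case: C_sub => _; apply.
  by rewrite /preimage /= ll; case: H_sub => _; apply.
- move=> x y [Cx Hx] [Cy Hy]; split; first exact: C_lie.
  by rewrite /preimage /= lh //; exact: H_lie.
Qed.

Lemma lie_hom_on_image (K : fieldType) (L L' : lieAlgType K) (H : set L) (phi : L -> L') :
  lie_subalgebra H -> linear_map phi -> lie_hom_on H phi -> lie_subalgebra (phi @` H).
Proof.
move=> [[H0 HL] H_lie] ll [_ lh]; split; first split.
- by exists 0 => //; rewrite lmap0.
- by move=> k _ _ [x Hx <-] [y Hy <-]; exists (k *: x + y); [exact: HL | rewrite ll].
- by move=> _ _ [x Hx <-] [y Hy <-]; exists (lie x y); [exact: H_lie | rewrite lh].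
Qed.

Lemma lie_hom_on_ext (K : fieldType) (L L' : lieAlgType K) (X : set L) (p q : L -> L') :
  linear_map p -> linear_map q -> lie_hom_on (lie_closure X) p ->
  lie_hom_on (lie_closure X) q -> (forall x, X x -> p x = q x) ->
  forall x, lie_closure X x -> p x = q x.
Proof.
move=> pl ql [_ ph] [_ qh] pq; have [C_sub C_lie] := lie_subalgebra_closure X.
suff sub : lie_closure X `<=` (lie_closure X `&` [set x | p x = q x]) by move=> x /sub[].
apply: lie_closure_sub; last by move=> x Xx; split; [exact: sub_lie_closure | exact: pq].
split; first split.
- by split; [exact: sub0 C_sub | rewrite /= !lmap0].
- move=> k x y [Cx px] [Cy py]; split; first by case: C_sub => _; apply.
  by rewrite /= pl ql px py.
- move=> x y [Cx px] [Cy py]; split; first exact: C_lie.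
  by rewrite /= ph // qh // px py.
Qed.

(** The linear endomorphisms of a vector space of any dimension, as a Lie
    algebra, so that representations are morphisms to it. *)
Section Endo.
Context (K : fieldType) (V : lmodType K).

Record endo := Endo { endo_fun :> V -> V; endo_lin : linear_map endo_fun }.

Lemma endoP (f g : endo) : endo_fun f =1 endo_fun g -> f = g.
Proof.
case: f g => [f fl] [g gl] /= /funext fg; rewrite fg in fl *.
by rewrite (Prop_irrelevance fl gl).
Qed.

HB.instance Definition _ := gen_eqMixin endo.
HB.instance Definition _ := gen_choiceMixin endo.

Definition endo_add (f g : endo) := Endo (linear_mapD (endo_lin f) (endo_lin g)).
Definition endo_opp (f : endo) := Endo (linear_mapN (endo_lin f)).
Definition endo_scale c (f : endo) := Endo (linear_mapZ c (endo_lin f)).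
Definition endo_comp (f g : endo) := Endo (linear_map_comp (endo_lin f) (endo_lin g)).
Lemma linear_map_0 : linear_map (fun _ : V => 0 : V).
Proof. by move=> c x y; rewrite scaler0 addr0. Qed.
Definition endo_0 := Endo linear_map_0.
Definition endo_lie f g := endo_add (endo_comp f g) (endo_opp (endo_comp g f)).

Let endo_addA : associative endo_add.
Proof. by move=> f g h; apply: endoP => v /=; rewrite addrA. Qed.
Let endo_addC : commutative endo_add.
Proof. by move=> f g; apply: endoP => v /=; rewrite addrC. Qed.
Let endo_add0 : left_id endo_0 endo_add.
Proof. by move=> f; apply: endoP => v /=; rewrite add0r. Qed.
Let endo_addN : left_inverse endo_0 endo_opp endo_add.
Proof. by move=> f; apply: endoP => v /=; rewrite addNr. Qed.
HB.instance Definition _ := GRing.isZmodule.Build endo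
  endo_addA endo_addC endo_add0 endo_addN.

Let endo_scaleA c d f : endo_scale c (endo_scale d f) = endo_scale (c * d) f.
Proof. by apply: endoP => v /=; rewrite scalerA. Qed.
Let endo_scale1 : left_id 1 endo_scale.
Proof. by move=> f; apply: endoP => v /=; rewrite scale1r. Qed.
Let endo_scaleDr : right_distributive endo_scale +%R.
Proof. by move=> c f g; apply: endoP => v /=; rewrite scalerDr. Qed.
Let endo_scaleDl f : {morph endo_scale^~ f : c d / c + d}.
Proof. by move=> c d; apply: endoP => v /=; rewrite scalerDl. Qed.
HB.instance Definition _ := GRing.Zmodule_isLmodule.Build K endo
  endo_scaleA endo_scale1 endo_scaleDr endo_scaleDl.

Let endo_linl (c : K) (f g h : endo) :
  endo_lie (c *: f + g) h = c *: endo_lie f h + endo_lie g h.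
Proof.
apply: endoP => v /=; rewrite (lmapD (endo_lin h)) (lmapZ (endo_lin h)).
by rewrite opprD addrACA scalerBr.
Qed.
Let endo_linr (c : K) (f g h : endo) :
  endo_lie h (c *: f + g) = c *: endo_lie h f + endo_lie h g.
Proof.
apply: endoP => v /=; rewrite (lmapD (endo_lin h)) (lmapZ (endo_lin h)).
by rewrite opprD addrACA scalerBr.
Qed.
Let endo_liexx f : endo_lie f f = 0.
Proof. by apply: endoP => v /=; rewrite subrr. Qed.
Let endo_jacobi f g h :
  endo_lie f (endo_lie g h) + endo_lie g (endo_lie h f) + endo_lie h (endo_lie f g) = 0.
Proof.
apply: endoP => v /=.
rewrite !(lmapB (endo_lin f)) !(lmapB (endo_lin g)) !(lmapB (endo_lin h)).
set a := f (g (h v)); set b := f (h (g v)); set c := g (h (f v)).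
set d := h (g (f v)); set e := g (f (h v)); set p := h (f (g v)).
rewrite !opprB !addrA [LHS](ACl (1*12*2*7*3*10*4*5*6*11*8*9))%AC /=.
by rewrite subrr add0r addNr add0r subrr add0r !(addNr, add0r).
Qed.
HB.instance Definition _ := Lmodule_isLieAlgebra.Build K endo
  endo_linl endo_linr endo_liexx endo_jacobi.

Lemma endo_scaleE c (f : endo) v : (c *: f) v = c *: f v.
Proof. by []. Qed.

End Endo.

Section Presented.
Local Open Scope quotient_scope.
Context (K : fieldType) (X : Type) (R : lie_term K X -> lie_term K X -> Prop).
Local Notation P := (lie_presented R).
Local Notation cl := (lie_class R).

Lemma lie_classP t u : cl t = cl u <-> lie_cong R t u.
Proof.
split=> [|tu]; first by move=> /eqmodP/asboolP.
by apply/eqmodP/asboolP.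
Qed.

Lemma lie_class_repr (x : P) : exists t, x = cl t.
Proof. by exists (repr (x : {eq_quot lie_cong_equiv R})); rewrite /lie_class reprK. Qed.

Let cong_repr t : lie_cong R (repr (cl t : {eq_quot lie_cong_equiv R})) t.
Proof. by apply/lie_classP; exact: reprK. Qed.

Lemma lie_class0 : cl LZero = 0.
Proof. by []. Qed.

Lemma lie_classD t u : cl (LAdd t u) = cl t + cl u.
Proof. by apply/lie_classP/lc_sym/lc_add; exact: cong_repr. Qed.

Lemma lie_classZ c t : cl (LScale c t) = c *: cl t.
Proof. by apply/lie_classP/lc_sym/lc_scale; exact: cong_repr. Qed.

Lemma lie_classL t u : cl (LBra t u) = lie (cl t) (cl u).
Proof. by apply/lie_classP/lc_sym/lc_bra; exact: cong_repr. Qed.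

(** Terms are built from variables by the operations of a Lie algebra. *)
Lemma presented_gen (x : P) : lie_closure (range (fun g => cl (LVar g))) x.
Proof.
have [t ->] := lie_class_repr x; set C := lie_closure _.
have [C_sub C_lie] : lie_subalgebra C by exact: lie_subalgebra_closure.
elim: t => [g||t IHt u IHu|c t IHt|t IHt u IHu].
- by apply: sub_lie_closure; exists g.
- by rewrite lie_class0; exact: (sub0 C_sub).
- by rewrite lie_classD; exact: (subD C_sub).
- by rewrite lie_classZ; apply: (subZ C_sub).
- by rewrite lie_classL; exact: C_lie.
Qed.

Section Lift.
Context (L : lieAlgType K) (f : X -> L).

Fixpoint lie_eval (t : lie_term K X) : L :=
  match t with
  | LVar g => f g
  | LZero => 0
  | LAdd t u => lie_eval t + lie_eval u
  | LScale c t => c *: lie_eval t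
  | LBra t u => lie (lie_eval t) (lie_eval u)
  end.

Lemma lie_eval_iter n t u :
  lie_eval (iter n (LBra t) u) = iter n (lie (lie_eval t)) (lie_eval u).
Proof. by elim: n => //= n ->. Qed.

Lemma presented_lift : (forall t u, R t u -> lie_eval t = lie_eval u) ->
  exists2 phi : P -> L, lie_morph phi & forall g, phi (cl (LVar g)) = f g.
Proof.
move=> fR.
have cong_eval t u : lie_cong R t u -> lie_eval t = lie_eval u.
  elim=> {t u} //=.
  - by move=> t u v _ -> _ ->.
  - by move=> t t' u u' _ -> _ ->.
  - by move=> c t t' _ ->.
  - by move=> t t' u u' _ -> _ ->.
  - by move=> *; rewrite addrA.
  - by move=> *; rewrite addrC.
  - by move=> *; rewrite add0r.
  - by move=> *; rewrite scaleN1r addNr.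
  - by move=> *; rewrite scalerA.
  - by move=> *; rewrite scale1r.
  - by move=> *; rewrite scalerDr.
  - by move=> *; rewrite scalerDl.
  - by move=> *; rewrite lieDl.
  - by move=> *; rewrite lieDr.
  - by move=> *; rewrite lieZl.
  - by move=> *; rewrite lieZr.
  - by move=> *; rewrite liexx.
  - by move=> *; rewrite lie_jacobi.
pose phi (x : P) := lie_eval (repr (x : {eq_quot lie_cong_equiv R})).
have phiE t : phi (cl t) = lie_eval t by apply: cong_eval; exact: cong_repr.
exists phi => [|g]; last by rewrite phiE.
split=> [c x y|x y]; have [t ->] := lie_class_repr x; have [u ->] := lie_class_repr y.
  by rewrite -lie_classZ -lie_classD !phiE.
by rewrite -lie_classL !phiE.
Qed.

End Lift.

Lemma presented_ext (L : lieAlgType K) (f g : P -> L) : lie_morph f -> lie_morph g ->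
  (forall v, f (cl (LVar v)) = g (cl (LVar v))) -> f =1 g.
Proof.
move=> [fl fb] [gl gb] fg x.
have : lie_closure (range (fun g => cl (LVar g))) `<=` [set x | f x = g x].
  apply: lie_closure_sub; last by move=> _ [v _ <-]; exact: fg.
  split; first split.
  - by rewrite /= !lmap0.
  - by move=> c y z /= fy fz; rewrite fl gl fy fz.
  - by move=> y z /= fy fz; rewrite fb gb fy fz.
by apply; exact: presented_gen.
Qed.

End Presented.

(** * The decomposition of a Borcherds algebra *)

Section Uorbits.
Context (K : fieldType) (L : lieAlgType K).
Implicit Types (x y v : L) (X W : set L).

Lemma Uorbit_base X v : Uorbit X v v.
Proof. by apply: sub_lspan; exists [::]. Qed.

Lemma Uorbit_stable X v : X `<=` stabilizer (Uorbit X v).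
Proof.
move=> x Xx; apply: stabilizer_lspan => _ [xs Xxs ->].
apply: sub_lspan; exists (x :: xs) => // y; rewrite inE => /orP[/eqP->//|]; exact: Xxs.
Qed.

Lemma Uorbit_sub X v W : subspace W -> W v -> X `<=` stabilizer W -> Uorbit X v `<=` W.
Proof.
move=> W_sub Wv XW; apply: lspan_sub => // _ [xs Xxs ->].
elim: xs Xxs => //= x xs IHxs Xxs; apply: XW; first by apply: Xxs; rewrite mem_head.
by apply: IHxs => y yxs; apply: Xxs; rewrite inE yxs orbT.
Qed.

Lemma Uorbit_subspace X v : subspace (Uorbit X v).
Proof. exact: subspace_lspan. Qed.

Lemma Uorbit_closure X v : Uorbit (lie_closure X) v = Uorbit X v.
Proof.
apply/seteqP; split.
  apply: Uorbit_sub; [exact: Uorbit_subspace | exact: Uorbit_base |].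
  by apply: stabilizer_closure; [exact: Uorbit_subspace | exact: Uorbit_stable].
apply: Uorbit_sub; [exact: Uorbit_subspace | exact: Uorbit_base |].
by move=> x /sub_lie_closure; exact: Uorbit_stable.
Qed.

(** By induction on words: bracketing with [x] moves past a generator [y] at the
    cost of [lie x y], until it reaches the base vector. *)
Lemma Uorbit_stabilizer X v x : Uorbit X v (lie x v) ->
  (forall y, X y -> stabilizer (Uorbit X v) (lie x y)) -> stabilizer (Uorbit X v) x.
Proof.
move=> xv xX; set W := Uorbit X v.
have W_sub : subspace W by exact: Uorbit_subspace.
have H_sub : subspace (W `&` [set w | W (lie x w)]).
  split; first by split; rewrite /= ?liex0; exact: (sub0 W_sub).
  move=> c y z [Wy Wxy] [Wz Wxz]; split; first by case: W_sub => _; apply.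
  by rewrite /= lie_linearr; case: W_sub => _; apply.
suff sub : W `<=` (W `&` [set w | W (lie x w)]) by move=> w /sub[].
apply: Uorbit_sub => // [|y Xy w [Ww Wxw]]; first by split=> //; exact: Uorbit_base.
split; first exact: Uorbit_stable.
rewrite /= lie_leibniz; apply: (subD W_sub); first exact: xX.
exact: Uorbit_stable.
Qed.

End Uorbits.

Lemma Uorbit_map (K : fieldType) (L L' : lieAlgType K) (f : L -> L') (X : set L) v
    (X' : set L') x :
  lie_morph f -> (forall x, X x -> X' (f x)) -> Uorbit X v x -> Uorbit X' (f v) (f x).
Proof.
move=> [fl fb] XX'; move: x; apply: (@Uorbit_sub _ _ X v (f @^-1` Uorbit X' (f v))).
- split; first by rewrite /preimage /= lmap0 //; exact: (sub0 (Uorbit_subspace _ _)).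
  by move=> c y z Wy Wz; rewrite /preimage /= fl; case: (Uorbit_subspace X' (f v)) => _; apply.
- exact: Uorbit_base.
- by move=> y /XX' Xy z; rewrite /preimage /= fb; exact: (Uorbit_stable Xy).
Qed.

(** Eigenvalues of an automorphism multiply under the bracket. *)
Lemma eig_span_lie (K : fieldType) (L : lieAlgType K) (T : L -> L) (E F G : set K) x y :
  lie_morph T -> (forall a b, E a -> F b -> G (a * b)) ->
  eig_span T E x -> eig_span T F y -> eig_span T G (lie x y).
Proof.
move=> [Tl Tb] EFG Ex Fy; move: x Ex; apply: (lspan_map (linear_liel y)).
  exact: subspace_lspan.
move=> x [a Ea Tx]; move: y Fy; apply: (lspan_map (linear_lier x)).
  exact: subspace_lspan.
move=> y [b Fb Ty]; apply: sub_lspan; exists (a * b); first exact: EFG.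
by rewrite Tb Tx Ty lieZl lieZr scalerA.
Qed.

Section BorcherdsStructure.
Context (R : realType) (K : fieldType) (iota : {rmorphism K -> R[i]}).
Context (I : countType) (A : I -> I -> K).
Local Notation g := (borcherds iota A).
Local Notation h := (bh iota A).
Local Notation e := (be iota A).
Local Notation f := (bf iota A).
Local Notation J := (J iota A).
Local Notation gJ := (gJ iota A).
Local Notation hspan := (hspan iota A).
Local Notation Vminus := (Vminus iota A).
Local Notation Vplus := (Vplus iota A).
Local Notation uminus := (uminus iota A).
Local Notation uplus := (uplus iota A).
Local Notation nJminus := (nJminus iota A).
Local Notation nJplus := (nJplus iota A).
Local Notation rel := (borcherds_rel iota A).

Let relE t u : rel t u -> lie_class rel t = lie_class rel u.
Proof. by move=> tu; apply/lie_classP; exact: lc_rel. Qed.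

Lemma lie_hh i j : lie (h i) (h j) = 0.
Proof. by rewrite -[lie _ _]lie_classL (relE (br_hh _ _ _ _)). Qed.
Lemma lie_he i k : lie (h i) (e k) = A i k *: e k.
Proof. by rewrite -[lie _ _]lie_classL (relE (br_he _ _ _ _)) lie_classZ. Qed.
Lemma lie_hf i k : lie (h i) (f k) = - A i k *: f k.
Proof. by rewrite -[lie _ _]lie_classL (relE (br_hf _ _ _ _)) lie_classZ. Qed.
Lemma lie_ef i : lie (e i) (f i) = h i.
Proof. by rewrite -[lie _ _]lie_classL (relE (br_ef _ _ _)). Qed.
Lemma lie_ef0 i j : i <> j -> lie (e i) (f j) = 0.
Proof. by move=> ij; rewrite -[lie _ _]lie_classL (relE (br_ef0 _ _ ij)). Qed.
Lemma lie_ee i j : A i j = 0 -> lie (e i) (e j) = 0.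
Proof. by move=> ij; rewrite -[lie _ _]lie_classL (relE (br_ee _ ij)). Qed.
Lemma lie_ff i j : A i j = 0 -> lie (f i) (f j) = 0.
Proof. by move=> ij; rewrite -[lie _ _]lie_classL (relE (br_ff _ ij)). Qed.

Let class_iter n t u :
  lie_class rel (iter n (LBra t) u) = iter n (lie (lie_class rel t)) (lie_class rel u).
Proof. by elim: n => //= n IHn; rewrite lie_classL IHn. Qed.

Lemma serre_e i j (n : nat) : i <> j -> J i -> n%:R = - (2 * A i j / A i i) + 1 ->
  iter n (lie (e i)) (e j) = 0.
Proof. by move=> ij Ji nE; rewrite -class_iter (relE (br_serre_e ij Ji nE)). Qed.
Lemma serre_f i j (n : nat) : i <> j -> J i -> n%:R = - (2 * A i j / A i i) + 1 ->
  iter n (lie (f i)) (f j) = 0.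
Proof. by move=> ij Ji nE; rewrite -class_iter (relE (br_serre_f ij Ji nE)). Qed.

Lemma borcherds_stable (W : set g) : subspace W ->
  (forall i, [/\ W (h i), W (e i) & W (f i)]) ->
  (forall i, [/\ stabilizer W (h i), stabilizer W (e i) & stabilizer W (f i)]) ->
  forall x, W x.
Proof.
move=> W_sub WX SX x; apply: lie_closure_stable (presented_gen x) => //.
- by move=> _ [[i|i|i] _ <-]; case: (WX i).
- by move=> _ [[i|i|i] _ <-]; case: (SX i).
Qed.

Lemma borcherds_ext (L : lieAlgType K) (p q : g -> L) : lie_morph p -> lie_morph q ->
  (forall i, [/\ p (h i) = q (h i), p (e i) = q (e i) & p (f i) = q (f i)]) -> p =1 q.
Proof.
move=> pm qm pq; apply: presented_ext => // -[i|i|i]; by have [] := pq i.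
Qed.

Lemma borcherds_lift (L : lieAlgType K) (h' e' f' : I -> L) :
  (forall i j, lie (h' i) (h' j) = 0) ->
  (forall i k, lie (h' i) (e' k) = A i k *: e' k) ->
  (forall i k, lie (h' i) (f' k) = - A i k *: f' k) ->
  (forall i, lie (e' i) (f' i) = h' i) ->
  (forall i j, i <> j -> lie (e' i) (f' j) = 0) ->
  (forall i j (n : nat), i <> j -> J i -> n%:R = - (2 * A i j / A i i) + 1 ->
     iter n (lie (e' i)) (e' j) = 0) ->
  (forall i j (n : nat), i <> j -> J i -> n%:R = - (2 * A i j / A i i) + 1 ->
     iter n (lie (f' i)) (f' j) = 0) ->
  (forall i j, A i j = 0 -> lie (e' i) (e' j) = 0) ->
  (forall i j, A i j = 0 -> lie (f' i) (f' j) = 0) ->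
  exists phi : g -> L, [/\ lie_morph phi, forall i, phi (h i) = h' i,
    forall i, phi (e i) = e' i & forall i, phi (f i) = f' i].
Proof.
move=> hh he hf ef ef0 se sf ee ff.
pose F x := match x with genH i => h' i | genE i => e' i | genF i => f' i end.
have [t u tu|phi phi_m phiE] := @presented_lift _ _ rel L F.
  case: tu => /= *; rewrite ?lie_eval_iter /=; by [auto | eauto].
exists phi; split=> // i; [exact: (phiE (genH i))|exact: (phiE (genE i))|exact: (phiE (genF i))].
Qed.

Let chevalley_exists : exists w : g -> g, [/\ lie_morph w, forall i, w (h i) = - h i,
  forall i, w (e i) = f i & forall i, w (f i) = e i].
Proof.
apply: borcherds_lift.
- by move=> i j; rewrite lieNl lieNr lie_hh !oppr0.
- by move=> i k; rewrite lieNl lie_hf scaleNr opprK.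
- by move=> i k; rewrite lieNl lie_he scaleNr.
- by move=> i; rewrite lieC lie_ef.
- by move=> i j ij; rewrite lieC lie_ef0 ?oppr0 // => /esym.
- by move=> i j n; exact: serre_f.
- by move=> i j n; exact: serre_e.
- by move=> i j; exact: lie_ff.
- by move=> i j; exact: lie_ee.
Qed.

(** The Chevalley involution exchanges the two halves of the algebra. *)
Definition chevalley : g -> g := projT1 (cid chevalley_exists).

Lemma chevalley_morph : lie_morph chevalley.
Proof. by rewrite /chevalley; case: cid => w []. Qed.
Lemma chevalley_h i : chevalley (h i) = - h i.
Proof. by rewrite /chevalley; case: cid => w []. Qed.
Lemma chevalley_e i : chevalley (e i) = f i.
Proof. by rewrite /chevalley; case: cid => w []. Qed.
Lemma chevalley_f i : chevalley (f i) = e i.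
Proof. by rewrite /chevalley; case: cid => w []. Qed.

Lemma lie_morph_comp (L1 L2 L3 : lieAlgType K) (p : L2 -> L3) (q : L1 -> L2) :
  lie_morph p -> lie_morph q -> lie_morph (p \o q).
Proof.
move=> [pl pb] [ql qb]; split; first exact: linear_map_comp.
by move=> x y /=; rewrite qb pb.
Qed.

Lemma chevalleyK : involutive chevalley.
Proof.
have wm := chevalley_morph; apply: (borcherds_ext (lie_morph_comp wm wm)) => // i /=.
by rewrite chevalley_h chevalley_e chevalley_f lmapN ?chevalley_h ?opprK ?chevalley_e //; case: wm.
Qed.

Let iter_lieZ (c d : K) n (x y : g) :
  iter n (lie (c *: x)) (d *: y) = (c ^+ n * d) *: iter n (lie x) y.
Proof.
elim: n => [|n IHn] /=; first by rewrite expr0 mul1r.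
by rewrite IHn lieZl lieZr scalerA mulrA -exprS.
Qed.

Let torus_exists (c : I -> K) : exists T : g -> g, (forall i, c i != 0) ->
  [/\ lie_morph T, forall i, T (h i) = h i,
  forall i, T (e i) = c i *: e i & forall i, T (f i) = (c i)^-1 *: f i].
Proof.
have [c0|c0] := pselect (forall i, c i != 0); last by exists id.
suff [T TP] : exists T : g -> g, [/\ lie_morph T, forall i, T (h i) = h i,
  forall i, T (e i) = c i *: e i & forall i, T (f i) = (c i)^-1 *: f i] by exists T.
apply: borcherds_lift.
- exact: lie_hh.
- by move=> i k; rewrite lieZr lie_he !scalerA mulrC.
- by move=> i k; rewrite lieZr lie_hf !scalerA mulrC.
- by move=> i; rewrite lieZr lieZl lie_ef scalerA mulVf ?scale1r.
- by move=> i j ij; rewrite lieZr lieZl lie_ef0 // !scaler0.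
- by move=> i j n ij Ji nE; rewrite iter_lieZ (serre_e ij Ji nE) scaler0.
- by move=> i j n ij Ji nE; rewrite iter_lieZ (serre_f ij Ji nE) scaler0.
- by move=> i j ij; rewrite lieZr lieZl lie_ee // !scaler0.
- by move=> i j ij; rewrite lieZr lieZl lie_ff // !scaler0.
Qed.

(** The diagonal automorphisms: their eigenvalues separate the degrees. *)
Definition torus (c : I -> K) : g -> g := projT1 (cid (torus_exists c)).

Lemma torusP c : (forall i, c i != 0) -> [/\ lie_morph (torus c),
  forall i, torus c (h i) = h i, forall i, torus c (e i) = c i *: e i
  & forall i, torus c (f i) = (c i)^-1 *: f i].
Proof. by rewrite /torus; case: cid. Qed.

(** ** Symmetry of the subspaces under the Chevalley involution *)

Lemma subspace_hspan : subspace hspan. Proof. exact: subspace_lspan. Qed.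
Lemma subalgebra_gJ : lie_subalgebra gJ. Proof. exact: lie_subalgebra_closure. Qed.
Lemma gJ_e j : J j -> gJ (e j).
Proof. by move=> Jj; apply: sub_lie_closure; left; exists j. Qed.
Lemma gJ_f j : J j -> gJ (f j).
Proof. by move=> Jj; apply: sub_lie_closure; right; exists j. Qed.
Lemma hspan_h i : hspan (h i). Proof. by apply: sub_lspan; exists i. Qed.
Lemma subspace_Vminus : subspace Vminus. Proof. exact: subspace_lspan. Qed.
Lemma subspace_Vplus : subspace Vplus. Proof. exact: subspace_lspan. Qed.
Lemma subalgebra_uminus : lie_subalgebra uminus. Proof. exact: lie_subalgebra_closure. Qed.
Lemma subalgebra_uplus : lie_subalgebra uplus. Proof. exact: lie_subalgebra_closure. Qed.

Lemma chevalley_gJ x : gJ x -> gJ (chevalley x).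
Proof.
apply: (lie_morph_closure chevalley_morph subalgebra_gJ) => _ [] [j Jj <-].
  by rewrite chevalley_e; exact: gJ_f.
by rewrite chevalley_f; exact: gJ_e.
Qed.

Lemma chevalley_hspan x : hspan x -> hspan (chevalley x).
Proof.
apply: (lspan_map (proj1 chevalley_morph) subspace_hspan) => _ [i _ <-].
by rewrite chevalley_h; apply: (subN subspace_hspan); exact: hspan_h.
Qed.

Lemma chevalley_Vminus x : Vminus x -> Vplus (chevalley x).
Proof.
apply: (lspan_map (proj1 chevalley_morph) subspace_Vplus) => y [i Ji].
rewrite /nJminus Uorbit_closure => /(Uorbit_map chevalley_morph).
move=> /(_ (e @` J)); rewrite chevalley_f => H; apply: sub_lspan; exists i => //.
by rewrite /nJplus Uorbit_closure; apply: H => _ [j Jj <-]; rewrite chevalley_f; exists j.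
Qed.

Lemma chevalley_Vplus x : Vplus x -> Vminus (chevalley x).
Proof.
apply: (lspan_map (proj1 chevalley_morph) subspace_Vminus) => y [i Ji].
rewrite /nJplus Uorbit_closure => /(Uorbit_map chevalley_morph).
move=> /(_ (f @` J)); rewrite chevalley_e => H; apply: sub_lspan; exists i => //.
by rewrite /nJminus Uorbit_closure; apply: H => _ [j Jj <-]; rewrite chevalley_e; exists j.
Qed.

Lemma chevalley_uminus x : uminus x -> uplus (chevalley x).
Proof.
apply: (lie_morph_closure chevalley_morph subalgebra_uplus) => y /chevalley_Vminus.
exact: sub_lie_closure.
Qed.

Lemma chevalley_uplus x : uplus x -> uminus (chevalley x).
Proof.
apply: (lie_morph_closure chevalley_morph subalgebra_uminus) => y /chevalley_Vplus.
exact: sub_lie_closure.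
Qed.

(** ** The sum [u^+ + (g_J + h) + u^-] is everything *)

Lemma gJ_stable_h i : stabilizer gJ (h i).
Proof.
have [gJ_sub _] := subalgebra_gJ.
apply: normalize_closure => _ [] [j Jj <-].
  by rewrite lie_he; apply: (subZ gJ_sub); exact: gJ_e.
by rewrite lie_hf; apply: (subZ gJ_sub); exact: gJ_f.
Qed.

Lemma Vminus_orbit_h k i : stabilizer (Uorbit nJminus (f k)) (h i).
Proof.
rewrite /nJminus Uorbit_closure; apply: Uorbit_stabilizer.
  by rewrite lie_hf; apply: (subZ (Uorbit_subspace _ _)); exact: Uorbit_base.
move=> _ [j Jj <-] w Ww; rewrite lie_hf lieZl; apply: (subZ (Uorbit_subspace _ _)).
by apply: Uorbit_stable => //; exists j.
Qed.

(** For [k] outside [J], [f k] is a highest weight vector for [g_J], since [e j]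
    commutes with it for [j] in [J]; thus its [n_J^-]-orbit is stable under [g_J]. *)
Lemma Vminus_orbit_gJ k : ~ J k -> gJ `<=` stabilizer (Uorbit nJminus (f k)).
Proof.
move=> nJk; apply: stabilizer_closure; first exact: Uorbit_subspace.
move=> _ [] [j Jj <-]; rewrite /nJminus Uorbit_closure; last first.
  by apply: Uorbit_stable; exists j.
apply: Uorbit_stabilizer.
  rewrite lie_ef0; first exact: (sub0 (Uorbit_subspace _ _)).
  by move=> jk; apply: nJk; rewrite -jk.
move=> _ [l Jl <-]; have [<-|jl] := pselect (j = l).
  by rewrite lie_ef -Uorbit_closure; exact: Vminus_orbit_h.
rewrite lie_ef0 // => w _; rewrite lie0x; exact: (sub0 (Uorbit_subspace _ _)).
Qed.

Definition levi : set g := [set x + y | x in gJ & y in hspan].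

Lemma subspace_levi : subspace levi.
Proof. by apply: subspace_sum; [case: subalgebra_gJ | exact: subspace_hspan]. Qed.

Lemma levi_gJ : gJ `<=` levi.
Proof. by move=> x gx; exists x => //; exists 0; [exact: (sub0 subspace_hspan) | rewrite addr0]. Qed.
Lemma levi_hspan : hspan `<=` levi.
Proof.
have [gJ_sub _] := subalgebra_gJ.
by move=> x hx; exists 0; [exact: (sub0 gJ_sub) | exists x => //; rewrite add0r].
Qed.

(** [levi] is generated by [g_J] and the [h i], so stability is checked there. *)
Lemma levi_stabilizer W : subspace W -> gJ `<=` stabilizer W ->
  (forall i, stabilizer W (h i)) -> levi `<=` stabilizer W.
Proof.
move=> W_sub gW hW _ [x gx [y hy <-]]; have [S_sub _] := stabilizer_subalgebra W_sub.
apply: (subD S_sub); first exact: gW.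
move: y hy; apply: lspan_sub => // _ [i _ <-]; exact: hW.
Qed.

Lemma levi_stable : levi `<=` stabilizer levi.
Proof.
have [gJ_sub gJ_lie] := subalgebra_gJ.
have gJ_h x i : gJ x -> gJ (lie x (h i)).
  by move=> gx; rewrite lieC; apply: (subN gJ_sub); exact: gJ_stable_h.
have gJ_hspan x : gJ x -> forall y, hspan y -> gJ (lie x y).
  move=> gx; apply: (lspan_map (linear_lier x) gJ_sub) => _ [i _ <-]; exact: gJ_h.
apply: levi_stabilizer; first exact: subspace_levi.
  move=> x gx _ [y gy [z hz <-]]; rewrite lieDr; apply: levi_gJ.
  by apply: (subD gJ_sub); [exact: gJ_lie | exact: gJ_hspan].
move=> i _ [y gy [z hz <-]]; rewrite lieDr; apply: levi_gJ.
apply: (subD gJ_sub); first exact: gJ_stable_h.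
move: z hz; apply: (lspan_map (linear_lier _) gJ_sub) => _ [j _ <-].
by rewrite lie_hh; exact: sub0.
Qed.

Lemma Vminus_stable : levi `<=` stabilizer Vminus.
Proof.
apply: levi_stabilizer; first exact: subspace_Vminus.
  move=> x gx; apply: stabilizer_lspan => y [k nJk Wy]; apply: sub_lspan.
  by exists k => //; exact: Vminus_orbit_gJ.
move=> i; apply: stabilizer_lspan => y [k nJk Wy]; apply: sub_lspan.
by exists k => //; exact: Vminus_orbit_h.
Qed.

Lemma uminus_stable : levi `<=` stabilizer uminus.
Proof.
move=> x lx; apply: normalize_closure => y Vy; apply: sub_lie_closure.
exact: Vminus_stable.
Qed.

Lemma chevalley_levi x : levi x -> levi (chevalley x).
Proof.
move=> [y gy [z hz <-]]; rewrite (lmapD (proj1 chevalley_morph)).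
exists (chevalley y); first exact: chevalley_gJ.
by exists (chevalley z) => //; exact: chevalley_hspan.
Qed.

Lemma chevalley_stable (W W' : set g) : (forall x, W x -> W' (chevalley x)) ->
  (forall x, W' x -> W (chevalley x)) -> forall x,
  stabilizer W (chevalley x) -> stabilizer W' x.
Proof.
move=> WW' W'W x sx w W'w; rewrite -(chevalleyK w) -[x]chevalleyK -(proj2 chevalley_morph).
by apply: WW'; apply: sx; exact: W'W.
Qed.

Lemma Vplus_stable : levi `<=` stabilizer Vplus.
Proof.
move=> x /chevalley_levi /Vminus_stable; apply: chevalley_stable.
  exact: chevalley_Vminus.
exact: chevalley_Vplus.
Qed.

Lemma uplus_stable : levi `<=` stabilizer uplus.
Proof.
move=> x /chevalley_levi /uminus_stable; apply: chevalley_stable.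
  exact: chevalley_uminus.
exact: chevalley_uplus.
Qed.

Lemma Vplus_e k : ~ J k -> Vplus (e k).
Proof. by move=> nJk; apply: sub_lspan; exists k => //; exact: Uorbit_base. Qed.
Lemma Vminus_f k : ~ J k -> Vminus (f k).
Proof. by move=> nJk; apply: sub_lspan; exists k => //; exact: Uorbit_base. Qed.

(** For [i] outside [J], [e i] commutes with [n_J^-], so that it sends the orbit
    of [f k] to the orbit of [lie (e i) (f k)], which is in [levi]. *)
Lemma e_Vminus i y : ~ J i -> Vminus y -> levi (lie (e i) y).
Proof.
move=> nJi; move: y; apply: (lspan_map (linear_lier _) subspace_levi) => y [k nJk].
rewrite /nJminus Uorbit_closure; move: y.
apply: (@Uorbit_sub _ _ _ _ [set y | levi (lie (e i) y)]).
- split; first by rewrite /= liex0; exact: (sub0 subspace_levi).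
  by move=> c x y lx ly; rewrite /= lie_linearr; case: subspace_levi => _; apply.
- rewrite /=; have [<-|ik] := pselect (i = k).
    by rewrite lie_ef; apply: levi_hspan; exact: hspan_h.
  by rewrite lie_ef0 //; exact: (sub0 subspace_levi).
move=> _ [j Jj <-] y /= ly; rewrite lie_leibniz lie_ef0 ?lie0x ?add0r.
  by apply: levi_stable => //; apply: levi_gJ; exact: gJ_f.
by move=> ij; apply: nJi; rewrite ij.
Qed.

Let sumP (W W' : set g) : set g := [set x + y | x in W & y in W'].

Lemma e_uminus i y : ~ J i -> uminus y -> sumP levi uminus (lie (e i) y).
Proof.
move=> nJi; apply: closure_into_normalizer; first exact: subspace_levi.
  exact: uminus_stable.
by move=> x Vx; exact: e_Vminus.
Qed.

Lemma e_levi i y : ~ J i -> levi y -> Vplus (lie (e i) y).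
Proof.
move=> nJi ly; rewrite lieC; apply: (subN subspace_Vplus).
by apply: Vplus_stable => //; exact: Vplus_e.
Qed.

Definition triangular : set g := sumP (sumP uplus levi) uminus.

Lemma subspace_triangular : subspace triangular.
Proof.
have [up_sub _] := subalgebra_uplus; have [um_sub _] := subalgebra_uminus.
by apply: subspace_sum => //; apply: subspace_sum => //; exact: subspace_levi.
Qed.

Let triangular_uplus x : uplus x -> triangular x.
Proof.
have [um_sub _] := subalgebra_uminus.
move=> ux; exists x; last by exists 0; [exact: sub0 | rewrite addr0].
by exists x => //; exists 0; [exact: (sub0 subspace_levi) | rewrite addr0].
Qed.

Let triangular_mid x : sumP levi uminus x -> triangular x.
Proof.
have [up_sub _] := subalgebra_uplus.
move=> [l ll [u uu <-]]; exists l; last by exists u.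
by exists 0; [exact: (sub0 up_sub) | exists l => //; rewrite add0r].
Qed.

Let triangular_levi x : levi x -> triangular x.
Proof.
have [um_sub _] := subalgebra_uminus.
by move=> lx; apply: triangular_mid; exists x => //; exists 0; [exact: sub0 | rewrite addr0].
Qed.

Let triangular_uminus x : uminus x -> triangular x.
Proof.
move=> ux; apply: triangular_mid; exists 0; first exact: (sub0 subspace_levi).
by exists x => //; rewrite add0r.
Qed.

Let chevalley_triangular x : triangular x -> triangular (chevalley x).
Proof.
move=> [_ [p up [l ll <-]] [m um <-]]; have [wl _] := chevalley_morph.
rewrite !(lmapD wl); apply: (subD subspace_triangular); first apply: (subD subspace_triangular).
- by apply: triangular_uminus; exact: chevalley_uplus.
- by apply: triangular_levi; exact: chevalley_levi.
- by apply: triangular_uplus; exact: chevalley_uminus.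
Qed.

Let triangular_split (x : g) : (forall u, uplus u -> triangular (lie x u)) ->
  (forall l, levi l -> triangular (lie x l)) ->
  (forall u, uminus u -> triangular (lie x u)) -> stabilizer triangular x.
Proof.
move=> xp xl xm _ [_ [p up [l ll <-]] [m um <-]]; rewrite !lieDr.
apply: (subD subspace_triangular); last exact: xm.
by apply: (subD subspace_triangular); [exact: xp | exact: xl].
Qed.

Let triangular_stable_levi : levi `<=` stabilizer triangular.
Proof.
move=> x lx; apply: triangular_split => u uu.
- by apply: triangular_uplus; exact: uplus_stable.
- by apply: triangular_levi; exact: levi_stable.
- by apply: triangular_uminus; exact: uminus_stable.
Qed.

Let triangular_stable_e i : stabilizer triangular (e i).
Proof.
have [Ji|nJi] := pselect (J i).
  by apply: triangular_stable_levi; apply: levi_gJ; exact: gJ_e.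
have [_ up_lie] := subalgebra_uplus.
apply: triangular_split => u uu.
- apply: triangular_uplus; apply: up_lie => //.
  by apply: sub_lie_closure; exact: Vplus_e.
- by apply: triangular_uplus; apply: sub_lie_closure; exact: e_levi.
- by apply: triangular_mid; exact: e_uminus.
Qed.

Let triangular_e i : triangular (e i).
Proof.
have [Ji|nJi] := pselect (J i).
  by apply: triangular_levi; apply: levi_gJ; exact: gJ_e.
by apply: triangular_uplus; apply: sub_lie_closure; exact: Vplus_e.
Qed.

(** By the Chevalley involution it suffices to bracket with the [e i] and the
    [h i]. *)
Lemma triangularT x : triangular x.
Proof.
apply: (borcherds_stable subspace_triangular) => i; split.
- by apply: triangular_levi; apply: levi_hspan; exact: hspan_h.
- exact: triangular_e.
- by rewrite -chevalley_e; exact: chevalley_triangular.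
- by apply: triangular_stable_levi; apply: levi_hspan; exact: hspan_h.
- exact: triangular_stable_e.
- apply: (@chevalley_stable triangular triangular) => //.
  by rewrite chevalley_f; exact: triangular_stable_e.
Qed.

(** ** Directness *)

Section TorusWeights.
Context (c : I -> K) (c_neq0 : forall i, c i != 0) (cJ : forall j, J j -> c j = 1).
Local Notation T := (torus c).

Let T_morph : lie_morph T. Proof. by have [] := torusP c_neq0. Qed.

Lemma torus_gJ x : gJ x -> T x = x.
Proof.
have [[Tl Tb] _ Te Tf] := torusP c_neq0.
move: x; apply: (@lie_closure_sub _ _ _ [set x | T x = x]).
  split; first split.
  - by rewrite /= lmap0.
  - by move=> a x y /= Tx Ty; rewrite Tl Tx Ty.
  - by move=> x y /= Tx Ty; rewrite Tb Tx Ty.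
by move=> _ [] [j Jj <-] /=; rewrite ?Te ?Tf cJ // ?invr1 scale1r.
Qed.

Lemma torus_levi x : levi x -> T x = x.
Proof.
have [[Tl Tb] Th _ _] := torusP c_neq0.
move=> [y gy [z hz <-]]; rewrite (lmapD Tl) torus_gJ //; congr (_ + _).
move: z hz; apply: (@lspan_sub _ _ _ [set x | T x = x]); last by move=> _ [i _ <-] /=; rewrite Th.
by split=> [|a x1 x2 /= Tx Ty]; rewrite /= ?lmap0 // Tl Tx Ty.
Qed.

Let torus_orbit (n : set g) v a : T v = a *: v -> (forall x, n x -> T x = x) ->
  forall x, Uorbit n v x -> T x = a *: x.
Proof.
have [[Tl Tb] _ _ _] := torusP c_neq0.
move=> Tv Tn; apply: (@Uorbit_sub _ _ _ _ [set x | T x = a *: x]) => //.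
  split=> [|b x y /= Tx Ty]; first by rewrite /= lmap0 // scaler0.
  by rewrite Tl Tx Ty scalerDr !scalerA mulrC.
by move=> x nx y /= Ty; rewrite Tb Ty Tn // lieZr.
Qed.

Lemma torus_orbit_f k x : Uorbit nJminus (f k) x -> T x = (c k)^-1 *: x.
Proof.
have [_ _ _ Tf] := torusP c_neq0; apply: torus_orbit => // y yn; apply: torus_gJ.
by apply: lie_closureS yn => z; right.
Qed.

Lemma torus_orbit_e k x : Uorbit nJplus (e k) x -> T x = c k *: x.
Proof.
have [_ _ Te _] := torusP c_neq0; apply: torus_orbit => // y yn; apply: torus_gJ.
by apply: lie_closureS yn => z; left.
Qed.

End TorusWeights.

Lemma subfield_char0 n : (n.+1%:R : K) != 0.
Proof. by rewrite -(fmorph_eq0 iota) rmorph_nat pnatr_eq0. Qed.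

Let two_neq0 : (2 : K) != 0. Proof. exact: (subfield_char0 1). Qed.

Lemma expr2_neq1 n : (2 ^+ n.+1 : K) != 1.
Proof.
have pow_gt1 : (1 < 2 ^ n.+1)%N by rewrite (ltn_exp2l 0).
rewrite -natrX -subr_eq0 -(natrB _ (ltnW pow_gt1)).
by rewrite (_ : (2 ^ n.+1 - 1)%N = (2 ^ n.+1 - 2).+1) ?subfield_char0 //; lia.
Qed.

Let orbit_independent (W : I -> set g) (a : K) : a != 1 ->
  (forall i, exists2 T : g -> g, linear_map T & forall k x, ~ J k -> W k x ->
     T x = (if k == i then a else 1) *: x) ->
  independent_family (~` J) W.
Proof.
move=> a1 WT r x r_uniq xW sx0 i ir; have [T Tl TW] := WT i.
move: sx0; rewrite (bigD1_seq i) //= => /eqP; rewrite addr_eq0 => /eqP xE.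
have Tx : T (x i) = a *: x i by have [nJ Wi] := xW i ir; rewrite (TW i) // eqxx.
have : T (x i) = x i.
  rewrite xE (lmapN Tl) (lmap_sum Tl); congr (- _); rewrite big_seq_cond [RHS]big_seq_cond.
  apply: eq_bigr => k /andP[kr ki]; have [nJ Wk] := xW k kr.
  by rewrite (TW k) // (negPf ki) scale1r.
rewrite Tx => /eqP; rewrite -subr_eq0 -{2}(scale1r (x i)) -scalerBl scaler_eq0.
by rewrite subr_eq0 (negPf a1) => /eqP.
Qed.

Let spot (i k : I) : K := if k == i then 2 else 1.
Let spot_neq0 i k : spot i k != 0.
Proof. by rewrite /spot; case: ifP => _; rewrite ?oner_eq0. Qed.

Let spotJ i : ~ J i -> forall j, J j -> spot i j = 1.
Proof. by move=> nJi j Jj; rewrite /spot; case: eqP => // ji; case: nJi; rewrite -ji. Qed.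

Let two_neq1 : (2 : K) != 1. Proof. exact: (expr2_neq1 0). Qed.

(** The torus element scaling [e i] alone by [2] has the eigenvalue [2^-1] on the
    orbit of [f i] and fixes the other orbits. *)
Lemma independent_f : independent_family (~` J) (fun i => Uorbit nJminus (f i)).
Proof.
apply: (@orbit_independent _ 2^-1) => [|i].
  by rewrite -(inj_eq invr_inj) invrK invr1.
have [Ji|nJi] := pselect (J i).
  exists id => // k x nJk _; case: eqP => [ki|_]; last by rewrite scale1r.
  by case: nJk; rewrite ki.
exists (torus (spot i)); first by have [[]] := torusP (spot_neq0 i).
move=> k x nJk /(torus_orbit_f (spot_neq0 i) (spotJ nJi))->.
by rewrite /spot; case: eqP; rewrite ?invr1.
Qed.

Lemma independent_e : independent_family (~` J) (fun i => Uorbit nJplus (e i)).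
Proof.
apply: (@orbit_independent _ 2) => // i.
have [Ji|nJi] := pselect (J i).
  exists id => // k x nJk _; case: eqP => [ki|_]; last by rewrite scale1r.
  by case: nJk; rewrite ki.
exists (torus (spot i)); first by have [[]] := torusP (spot_neq0 i).
by move=> k x nJk /(torus_orbit_e (spot_neq0 i) (spotJ nJi))->.
Qed.

(** The torus element scaling [e i], for [i] outside [J], by [2] has eigenvalues
    [2 ^ n] with [n > 0] on [u^+], [n = 0] on [g_J + h] and [n < 0] on [u^-]. *)
Let ctorus (i : I) : K := if `[< J i >] then 1 else 2.
Let ctorus_neq0 i : ctorus i != 0.
Proof. by rewrite /ctorus; case: ifP => _; rewrite ?oner_eq0. Qed.
Let ctorusJ j : J j -> ctorus j = 1. Proof. by move=> Jj; rewrite /ctorus asboolT. Qed.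
Let ctorusI k : ~ J k -> ctorus k = 2. Proof. by move=> Jj; rewrite /ctorus asboolF. Qed.
Let T := torus ctorus.
Let T_morph : lie_morph T. Proof. by have [] := torusP ctorus_neq0. Qed.
Let pos_eig : set K := range (fun n : nat => 2 ^+ n.+1).
Let neg_eig : set K := range (fun n : nat => 2 ^- n.+1).

Let eig_span_subalgebra (E : set K) : (forall a b, E a -> E b -> E (a * b)) ->
  lie_subalgebra (eig_span T E).
Proof.
by move=> EM; split=> [|x y]; [exact: subspace_lspan | exact: eig_span_lie].
Qed.

Let uplus_eig : uplus `<=` eig_span T pos_eig.
Proof.
apply: lie_closure_sub.
  apply: eig_span_subalgebra => _ _ [n _ <-] [m _ <-]; exists (n + m).+1 => //.
  by rewrite -exprD addSn addnS.
apply: lspan_sub; first exact: subspace_lspan.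
move=> x [k nJk /(torus_orbit_e ctorus_neq0 ctorusJ)]; rewrite ctorusI // => Tx.
by apply: sub_lspan; exists 2 => //; exists 0%N.
Qed.

Let uminus_eig : uminus `<=` eig_span T neg_eig.
Proof.
apply: lie_closure_sub.
  apply: eig_span_subalgebra => _ _ [n _ <-] [m _ <-]; exists (n + m).+1 => //.
  by rewrite -invfM -exprD addSn addnS.
apply: lspan_sub; first exact: subspace_lspan.
move=> x [k nJk /(torus_orbit_f ctorus_neq0 ctorusJ)]; rewrite ctorusI // => Tx.
by apply: sub_lspan; exists 2^-1 => //; exists 0%N.
Qed.

Let levi_eig : levi `<=` eig_span T [set 1].
Proof.
move=> x lx; apply: sub_lspan; exists 1 => //.
by rewrite scale1r; exact: (torus_levi ctorus_neq0 ctorusJ).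
Qed.

(** As [p] is the opposite of [l + m], it lies in two spans of eigenvectors
    without a common eigenvalue; then the same holds for [l] and [- m]. *)
Lemma triangular_direct p l m : uplus p -> levi l -> uminus m -> p + l + m = 0 ->
  [/\ p = 0, l = 0 & m = 0].
Proof.
move=> /uplus_eig up ll /uminus_eig um; have [Tl _] := T_morph.
have /levi_eig llN := subN subspace_levi ll; move: ll => /levi_eig ll.
have umN := subN (subspace_lspan _) um; have upN := subN (subspace_lspan _) up.
have span_lm (u v : g) (E : set K) : eig_span T E u -> eig_span T [set 1] v ->
    eig_span T (E `|` [set 1]) (v + u).
  move=> Eu v1; apply: (subD (subspace_lspan _)); first exact: eig_spanS v1.
  exact: eig_spanS Eu.
move=> plm0; have p0 : p = 0.
  apply: (eig_span_disjoint Tl (E := pos_eig) (F := neg_eig `|` [set 1])) => //; last first.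
    have -> : p = - l + - m by apply/eqP; rewrite -opprD -addr_eq0 addrA plm0.
    exact: span_lm.
  move=> _ [[n _ <-] [[k _]|/esym/eqP]]; last by rewrite eq_sym (negPf (expr2_neq1 _)).
  move/eqP; rewrite -(inj_eq (mulfI (expf_neq0 k.+1 two_neq0))) divff ?expf_neq0 //.
  by rewrite -exprD addSn eq_sym (negPf (expr2_neq1 _)).
split=> //; move: plm0; rewrite p0 add0r => /eqP; rewrite addr_eq0 => /eqP lE.
  apply: (eig_span_disjoint Tl (E := [set 1]) (F := neg_eig)) => //; last by rewrite lE.
  move=> _ [-> [k _ /eqP]]; rewrite -(inj_eq invr_inj) invrK invr1.
  by rewrite (negPf (expr2_neq1 _)).
apply: (eig_span_disjoint Tl (E := [set 1]) (F := neg_eig)) => //.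
  move=> _ [-> [k _ /eqP]]; rewrite -(inj_eq invr_inj) invrK invr1.
  by rewrite (negPf (expr2_neq1 _)).
by rewrite -[m]opprK -lE.
Qed.

Lemma decomposition : direct_sum3 uplus levi uminus.
Proof.
move=> x; have [_ [p up [l ll <-]] [m um <-]] := triangularT x.
exists (p, l, m); split=> // -[[p' l'] m'] /= [up' ll' um' E].
have [] := @triangular_direct (p - p') (l - l') (m - m').
- by apply: subB up up'; case: subalgebra_uplus.
- by apply: subB ll ll'; exact: subspace_levi.
- by apply: subB um um'; case: subalgebra_uminus.
- by rewrite [LHS](AC (2*2*2) ((1*3*5)*(2*4*6)))%AC /= E -!opprD subrr.
by move=> /eqP; rewrite subr_eq0 => /eqP-> /eqP; rewrite subr_eq0 => /eqP-> /eqP; rewrite subr_eq0 => /eqP->.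
Qed.

End BorcherdsStructure.

(** * Real root vectors act locally nilpotently *)

Section LieAutomorphisms.
Context (K : fieldType) (K_char0 : forall n, (n.+1%:R : K) != 0).
Context (L : lieAlgType K).

Lemma exp_ad_morph (x : L) : locally_nilpotent (lie x) -> lie_morph (lnexp (lie x)).
Proof.
move=> x_nil; split; first exact: lnexp_lin (linear_lier x) x_nil.
move=> y z; exact: (@lnexp_leibniz K K_char0 L L L (@lie _ L) (@linear_liel _ L)
  (@linear_lier _ L) _ _ _ (linear_lier x) (linear_lier x) (linear_lier x)
  (lie_leibniz x)).
Qed.

Definition lie_auto (t : L -> L) : Prop :=
  lie_morph t /\ exists2 t', lie_morph t' & cancel t t' /\ cancel t' t.

Lemma lie_auto_id : lie_auto id.
Proof. by split=> //; exists id. Qed.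

Lemma lie_auto_comp s t : lie_auto s -> lie_auto t -> lie_auto (s \o t).
Proof.
move=> [sm [s' s'm [sK s'K]]] [tm [t' t'm [tK t'K]]]; split.
  exact: lie_morph_comp.
by exists (t' \o s'); [exact: lie_morph_comp | split; exact: can_comp].
Qed.

Lemma lie_auto_inv s t : lie_auto s -> cancel s t -> cancel t s -> lie_auto t.
Proof.
move=> [sm [s' s'm [sK s'K]]] sTK tK; split; last by exists s.
suff -> : t = s' by [].
by apply/funext => x; rewrite -{2}(tK x) sK.
Qed.

Lemma locally_nilpotent_adN (x : L) :
  locally_nilpotent (lie x) -> locally_nilpotent (lie (- x)).
Proof.
rewrite (_ : lie (- x) = fun y => - lie x y); last by apply/funext => y; rewrite lieNl.
exact: locally_nilpotentN (linear_lier x).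
Qed.

Lemma exp_ad_auto (x : L) : locally_nilpotent (lie x) -> lie_auto (lnexp (lie x)).
Proof.
move=> x_nil; split; first exact: exp_ad_morph.
exists (lnexp (lie (- x))); first exact/exp_ad_morph/locally_nilpotent_adN.
rewrite (_ : lie (- x) = fun y => - lie x y); last by apply/funext => y; rewrite lieNl.
by split; [apply: lnexpK | apply: lnexpNK] => //; exact: linear_lier.
Qed.

Lemma locally_nilpotent_auto t (x : L) : lie_auto t -> locally_nilpotent (lie x) ->
  locally_nilpotent (lie (t x)).
Proof.
move=> [[tl tb] [t' _ [tK t'K]]] x_nil y; have [n nE] := x_nil (t' y); exists n.
suff tE m z : iter m (lie (t x)) (t z) = t (iter m (lie x) z).
  by rewrite -(t'K y) tE nE lmap0.
by elim: m => //= m ->; rewrite tb.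
Qed.

Lemma locally_nilpotent_adZ c (x : L) :
  locally_nilpotent (lie x) -> locally_nilpotent (lie (c *: x)).
Proof.
move=> x_nil y; have [n nE] := x_nil y; exists n.
suff -> : iter n (lie (c *: x)) y = c ^+ n *: iter n (lie x) y by rewrite nE scaler0.
elim: n {nE} => [|n /= ->]; first by rewrite expr0 scale1r.
by rewrite lieZl lieZr scalerA -exprS.
Qed.

End LieAutomorphisms.

(** The reflection of an sl2-triple: the classical element
    [exp (ad e) exp (- ad f) exp (ad e)] sends [h] to [- h]. *)
Section SL2.
Context (K : fieldType) (K_char0 : forall n, (n.+1%:R : K) != 0).
Context (L : lieAlgType K) (e f h : L).
Context (ef : lie e f = h) (he : lie h e = 2 *: e) (hf : lie h f = - 2 *: f).
Context (e_nil : locally_nilpotent (lie e)) (f_nil : locally_nilpotent (lie f)).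

Definition sl2_reflection : L -> L :=
  lnexp (lie e) \o lnexp (lie (- f)) \o lnexp (lie e).

Lemma sl2_reflection_auto : lie_auto sl2_reflection.
Proof.
have f_auto := exp_ad_auto K_char0 (locally_nilpotent_adN f_nil).
have e_auto := exp_ad_auto K_char0 e_nil.
by apply: lie_auto_comp => //; exact: lie_auto_comp.
Qed.

Lemma sl2_reflection_h : sl2_reflection h = - h.
Proof.
have two0 : (2 : K) != 0 by exact: (K_char0 1).
have eh : lie e h = - (2 *: e) by rewrite lieC he.
have exp2 (x y z : L) : lie x y = z -> lie x z = 0 -> lnexp (lie x) y = y + z.
  move=> xy xz; rewrite (lnexpE (linear_lier x) (n := 2)) /= ?xy //.
  by rewrite !big_ord_recl big_ord0 addr0 /divpow /= fact0 invr1 !scale1r xy.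
have exp_h : lnexp (lie e) h = h - 2 *: e.
  by apply: exp2 => //; rewrite lieNr lieZr liexx scaler0 oppr0.
have exp_e : lnexp (lie e) e = e.
  by rewrite (exp2 e e 0) ?addr0 ?liexx ?liex0.
have fh : lie (- f) h = - (2 *: f) by rewrite lieNl lieC hf scaleNr opprK.
have expf_h : lnexp (lie (- f)) h = h - 2 *: f.
  by apply: exp2 => //; rewrite lieNl lieNr lieZr liexx scaler0 !oppr0.
have fe : lie (- f) e = h by rewrite lieNl lieC ef opprK.
have expf_e : lnexp (lie (- f)) e = e + h - f.
  rewrite (lnexpE (linear_lier (- f)) (n := 3)) /=; last first.
    by rewrite fe fh lieNl lieNr lieZr liexx scaler0 !oppr0.
  rewrite !big_ord_recl big_ord0 addr0 /divpow /= fact0 invr1 !scale1r fe fh addrA.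
  by rewrite scalerN scalerA mulVf // scale1r.
have [el _] := exp_ad_morph K_char0 e_nil.
have [fl _] := exp_ad_morph K_char0 (locally_nilpotent_adN f_nil).
rewrite /sl2_reflection /= exp_h (lmapB fl) (lmapZ fl) expf_h expf_e.
rewrite (_ : _ - _ = - h - 2 *: e) ?(lmapB el) ?(lmapN el) ?(lmapZ el) ?exp_h ?exp_e.
  by rewrite opprB addrC addrA addNr add0r.
rewrite !scalerDr scalerN !opprD opprK !scaler_nat !mulr2n !opprD !addrA.
rewrite [LHS](ACl (6*4*5*(1*7)*(2*8)*(3*9)))%AC /=.
by rewrite subrr !addNr !addr0.
Qed.

End SL2.

Section RealRoots.
Context (R : realType) (K : fieldType) (iota : {rmorphism K -> R[i]}).
Context (I : countType) (A : I -> I -> K).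
Context (B1 : forall i j, A i j = A j i).
Context (B2 : forall i j, i <> j -> iota (A i j) <= 0).
Context (B3 : forall i j, 0 < iota (A i i) ->
          exists m : int, 2 * A i j / A i i = m%:~R).
Local Notation g := (borcherds iota A).
Local Notation h := (bh iota A).
Local Notation e := (be iota A).
Local Notation f := (bf iota A).
Local Notation J := (J iota A).
Local Notation degree_space := (degree_space iota A).

Lemma intr_eq0_K (m : int) : ((m%:~R : K) == 0) = (m == 0).
Proof. by rewrite -(fmorph_eq0 iota) rmorph_int intr_eq0. Qed.

Lemma J_neq0 j : J j -> A j j != 0.
Proof. by rewrite /Defs.J => jj; rewrite -(fmorph_eq0 iota) lt0r_neq0. Qed.

Lemma serre_exponent i j : i <> j -> J i ->
  exists n : nat, n%:R = - (2 * A i j / A i i) + 1.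
Proof.
move=> ij Ji; have [m mE] := @B3 i j Ji.
have m_le0 : m <= 0.
  have : iota (2 * A i j / A i i) <= 0.
    rewrite !rmorphM /= fmorphV pmulr_lle0 ?invr_gt0 //.
    by rewrite rmorph_nat pmulr_rle0 ?ltr0n //; exact: B2.
  by rewrite mE rmorph_int lerz0.
exists (`|m|%N).+1; rewrite mE -natr1 -[X in X + 1 = _]/((Posz `|m|%N)%:~R).
by rewrite abszE ler0_norm // mulrNz.
Qed.

(** It suffices to check nilpotency on generators, where it is given by the Serre
    relations and by the action of an sl2-triple on itself. *)
Lemma ad_e_nilpotent i : J i -> locally_nilpotent (lie (e i)).
Proof.
move=> Ji y.
have := @lie_closure_sub _ _ _ _ (nil_ad_subalgebra (subfield_char0 iota) (e i)) _ y (presented_gen y).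
apply=> _ [[j|j|j] _ <-].
- by exists 2%N => /=; rewrite (lieC (e i) (h j)) lie_he lieNr lieZr liexx scaler0 oppr0.
- have [<-|ij] := pselect (i = j); first by exists 1%N; rewrite /= liexx.
  by have [n nE] := serre_exponent ij Ji; exists n; exact: serre_e nE.
- have [<-|ij] := pselect (i = j); last by exists 1%N; rewrite /= lie_ef0.
  exists 3%N; rewrite /= lie_ef (lieC (e i) (h i)) lie_he lieNr lieZr liexx.
  by rewrite scaler0 oppr0.
Qed.

Lemma ad_f_nilpotent i : J i -> locally_nilpotent (lie (f i)).
Proof.
move=> Ji; rewrite -chevalley_e; apply: locally_nilpotent_auto; last exact: ad_e_nilpotent.
by split; [exact: chevalley_morph | exists (@chevalley R K iota I A);
  [exact: chevalley_morph | split; exact: chevalleyK]].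
Qed.

(* Scaling [f j] by [2 / a_jj] normalizes the triple, so that [h] acts on [e j]
   by [2]. *)
Definition reflection (j : I) : g -> g := sl2_reflection (e j) ((2 / A j j) *: f j).

Section SimpleReflection.
Context (j : I) (Jj : J j).
Let hj : g := (2 / A j j) *: h j.

Let lie_e_f : lie (e j) ((2 / A j j) *: f j) = hj.
Proof. by rewrite lieZr lie_ef. Qed.
Let lie_h_e : lie hj (e j) = 2 *: e j.
Proof. by rewrite lieZl lie_he scalerA divfK // J_neq0. Qed.
Let lie_h_f : lie hj ((2 / A j j) *: f j) = - 2 *: ((2 / A j j) *: f j).
Proof.
rewrite lieZl lieZr lie_hf !scalerA; congr (_ *: _).
by field; exact: J_neq0.
Qed.

Lemma reflection_auto : lie_auto (reflection j).
Proof.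
apply: sl2_reflection_auto; [exact: (subfield_char0 iota) | exact: ad_e_nilpotent |].
by apply: locally_nilpotent_adZ; exact: ad_f_nilpotent.
Qed.

Lemma reflection_h : reflection j hj = - hj.
Proof.
apply: sl2_reflection_h; [exact: (subfield_char0 iota) | by [] | by [] | by [] |exact: ad_e_nilpotent |].
by apply: locally_nilpotent_adZ; exact: ad_f_nilpotent.
Qed.

Let pairing (alpha : {malg int[I]}) : K := mmap intr (A^~ j) alpha.

Lemma root_form_simple (alpha : {malg int[I]}) : root_form A alpha << j >> = pairing alpha.
Proof.
rewrite /root_form /pairing mmapE; apply: eq_bigr => i _.
by rewrite msuppU oner_eq0 big_seq_fset1 mcoeffUU mulr1.
Qed.

Lemma subspace_degree (alpha : {malg int[I]}) : subspace (degree_space alpha).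
Proof. by split=> [|c x y]; [exact: ds_0 | exact: ds_lin]. Qed.

Lemma degree_pairing (alpha : {malg int[I]}) x : degree_space alpha x ->
  lie (h j) x = pairing alpha *: x.
Proof.
elim=> {alpha x}.
- by move=> i; rewrite lie_he /pairing mmapU mul1r B1.
- by move=> i; rewrite lie_hf /pairing mmapN mmapU mul1r B1.
- by move=> i; rewrite lie_hh /pairing mmap0 scale0r.
- move=> al be x y _ IHx _ IHy; rewrite /pairing mmapD -!/(pairing _).
  by rewrite lie_leibniz IHx IHy lieZl lieZr -scalerDl.
- by move=> al; rewrite liex0 scaler0.
- by move=> al c x y _ IHx _ IHy; rewrite lie_linearr IHx IHy scalerDr !scalerA mulrC.
Qed.

(** The reflected vector lies in the sum of the degrees [alpha + k alpha_j] and
    is an eigenvector of [h j], which has distinct eigenvalues on those degrees. *)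
Lemma reflection_degree (alpha : {malg int[I]}) (m : int) x :
  degree_space alpha x -> m%:~R = 2 * root_form A alpha << j >> / A j j ->
  degree_space (alpha - << j >> *~ m) (reflection j x).
Proof.
move=> ax; rewrite root_form_simple => mE.
pose W (k : int) := degree_space (alpha + << j >> *~ k).
pose S := lspan [set y | exists k, W k y].
have S_sub : subspace S by exact: subspace_lspan.
have WE (u : g) (k : int) : degree_space (<< j >> *~ k) u -> stabilizer S u.
  move=> ju; apply: stabilizer_lspan => y [l Wy]; apply: sub_lspan; exists (k + l).
  by rewrite /W mulrzDr addrCA; exact: ds_lie.
have Se : stabilizer S (e j) by apply: (WE _ 1); exact: ds_e.
have Sf c : stabilizer S (c *: f j).
  by apply: (WE _ (-1)); apply: (subZ (subspace_degree _)); rewrite mulrNz; exact: ds_f.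
have e_nil := ad_e_nilpotent Jj.
have f_nil : locally_nilpotent (lie (- ((2 / A j j) *: f j))).
  by apply: locally_nilpotent_adN; apply: locally_nilpotent_adZ; exact: ad_f_nilpotent.
have Srx : S (reflection j x).
  apply: (lnexp_preserve (linear_lier _) e_nil S_sub Se).
  apply: (lnexp_preserve (linear_lier _) f_nil S_sub).
    by move=> w; rewrite -scaleNr; exact: Sf.
  apply: (lnexp_preserve (linear_lier _) e_nil S_sub Se).
  by apply: sub_lspan; exists 0; rewrite /W mulr0z addr0.
have hW k y : W k y -> lie hj y = (m + 2 * k)%:~R *: y.
  move=> /degree_pairing hy; rewrite lieZl hy scalerA; congr (_ *: _).
  rewrite /pairing mmapD raddfMz /= mmapU mul1r -/(pairing _) intrD intrM mE.
  by rewrite -mulrzr; field; exact: J_neq0.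
have hrx : lie hj (reflection j x) = (- m)%:~R *: reflection j x.
  have [[rl rb] _] := reflection_auto.
  have := congr1 (reflection j) (hW 0 x _); rewrite /W mulr0z addr0 mulr0 addr0 => /(_ ax).
  rewrite rb reflection_h lieNl (lmapZ rl) => /eqP; rewrite eqr_oppLR => /eqP->.
  by rewrite mulrNz scaleNr.
have H_lin := linear_lier hj.
pose E : set K := [set a | exists2 k : int, k <> - m & a = (m + 2 * k)%:~R].
have [y0 [y1 [Wy0 Ey1 rE]]] : exists y0 y1,
    [/\ W (- m) y0, eig_span (lie hj) E y1 & reflection j x = y0 + y1].
  suff : S `<=` [set y0 + y1 | y0 in W (- m) & y1 in eig_span (lie hj) E].
    by move=> /(_ _ Srx)[y0 Wy0 [y1 Ey1 <-]]; exists y0, y1.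
  apply: lspan_sub; first by apply: subspace_sum (subspace_degree _) (subspace_lspan _).
  move=> y [k Wy]; have [kE|km] := pselect (k = - m).
    exists y; first by rewrite -kE.
    by exists 0; [exact: (sub0 (subspace_lspan _)) | rewrite addr0].
  exists 0; first exact: ds_0.
  exists y; last by rewrite add0r.
  by apply: sub_lspan; exists (m + 2 * k)%:~R; [exists k | exact: hW].
(* [y1] is an eigenvector for [- m] and a sum of eigenvectors for the values
   [m + 2 k] with [k] different from [- m]. *)
suff y1_0 : y1 = 0 by rewrite rE y1_0 addr0 -mulrNz.
apply: (eig_span_disjoint H_lin (E := E) (F := [set (- m)%:~R])) Ey1 _.
  move=> _ [[k km ->] /eqP]; rewrite -subr_eq0 -intrB intr_eq0_K => /eqP; lia.
apply: sub_lspan; exists (- m)%:~R => //.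
have -> : y1 = reflection j x - y0 by rewrite rE addrC addKr.
rewrite (lmapB H_lin) hrx (hW (- m)) // scalerBr; congr (_ - _ *: _).
by congr (_%:~R); lia.
Qed.

End SimpleReflection.

(** ** Vectors whose degree is a simple root *)

Let two_neq0 : (2 : K) != 0. Proof. exact: (subfield_char0 iota 1). Qed.

Lemma two_pow_inj (k l : int) : (2 : K) ^ k = 2 ^ l -> k = l.
Proof.
move=> /eqP; rewrite -(inj_eq (mulIf (expfz_neq0 (- l) two_neq0))) -!expfzDr //.
rewrite subrr expr0z; case: (k - l) (subrK l k) => [[|n]|n] <-.
- by rewrite add0r.
- by rewrite -exprnP (negPf (expr2_neq1 iota n)).
- by rewrite NegzE -exprnN -(inj_eq invr_inj) invrK invr1 (negPf (expr2_neq1 iota n)).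
Qed.

(** Diagonal automorphisms with integral powers of [2] as scalars read off an
    additive weight on the root lattice. *)
Lemma torus_degree (wt : {additive {malg int[I]} -> int}) alpha x :
  degree_space alpha x ->
  torus (iota := iota) (A := A) (fun i => 2 ^ wt << i >>) x = 2 ^ wt alpha *: x.
Proof.
have c_neq0 i : (2 : K) ^ wt << i >> != 0 by rewrite expfz_neq0.
have [[Tl Tb] Th Te Tf] := @torusP R K iota I A _ c_neq0.
elim=> {alpha x}.
- by move=> i; rewrite Te.
- by move=> i; rewrite Tf raddfN /= invr_expz.
- by move=> i; rewrite Th raddf0 expr0z scale1r.
- move=> al be x y _ IHx _ IHy; rewrite Tb IHx IHy lieZl lieZr scalerA raddfD /=.
  by rewrite expfzDr.
- by move=> al; rewrite lmap0 // scaler0.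
- by move=> al c x y _ IHx _ IHy; rewrite Tl IHx IHy scalerDr !scalerA mulrC.
Qed.

Definition nplus : set g := lie_closure (range e).
Definition nminus : set g := lie_closure (range f).

Let hspan_stable (W : set g) : subspace W -> (forall i, stabilizer W (h i)) ->
  hspan iota A `<=` stabilizer W.
Proof.
move=> W_sub hW; apply: lspan_sub; first by case: (stabilizer_subalgebra W_sub).
by move=> _ [i _ <-].
Qed.

Let subspace_nplus : subspace nplus. Proof. by case: (lie_subalgebra_closure (range e)). Qed.
Let subspace_nminus : subspace nminus. Proof. by case: (lie_subalgebra_closure (range f)). Qed.

Let nplus_h i : stabilizer nplus (h i).
Proof.
apply: normalize_closure => _ [k _ <-]; rewrite lie_he; apply: (subZ subspace_nplus).
by apply: sub_lie_closure; exists k.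
Qed.

Let nplus_f i u : nplus u ->
  [set x + y | x in hspan iota A & y in nplus] (lie (f i) u).
Proof.
apply: closure_into_normalizer; first exact: subspace_hspan.
  by apply: hspan_stable; [exact: subspace_nplus | exact: nplus_h].
have hN := subspace_hspan iota A; move=> _ [k _ <-]; rewrite lieC.
have [<-|ki] := pselect (k = i); last by rewrite lie_ef0 // oppr0; exact: sub0.
by rewrite lie_ef; apply: (subN hN); exact: hspan_h.
Qed.

Let chevalley_nplus x : nplus x -> nminus (chevalley x).
Proof.
apply: (lie_morph_closure (chevalley_morph iota A)); first exact: lie_subalgebra_closure.
by move=> _ [i _ <-]; rewrite chevalley_e; apply: sub_lie_closure; exists i.
Qed.

Let chevalley_nminus x : nminus x -> nplus (chevalley x).
Proof.
apply: (lie_morph_closure (chevalley_morph iota A)); first exact: lie_subalgebra_closure.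
by move=> _ [i _ <-]; rewrite chevalley_f; apply: sub_lie_closure; exists i.
Qed.

(* The triangular decomposition of the whole algebra. *)
Let htri : set g :=
  [set x + y | x in [set x + y | x in hspan iota A & y in nplus] & y in nminus].

Let subspace_htri : subspace htri.
Proof. by do 2?[apply: subspace_sum => //]; exact: subspace_hspan. Qed.

Let htri_hp x : [set x + y | x in hspan iota A & y in nplus] x -> htri x.
Proof. by move=> hx; exists x => //; exists 0; [exact: sub0 subspace_nminus | rewrite addr0]. Qed.

Let htri_h x : hspan iota A x -> htri x.
Proof.
by move=> hx; apply: htri_hp; exists x => //; exists 0; [exact: sub0 subspace_nplus | rewrite addr0].
Qed.

Let htri_p x : nplus x -> htri x.
Proof.
move=> px; apply: htri_hp; exists 0; first exact: sub0 (subspace_hspan iota A).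
by exists x => //; rewrite add0r.
Qed.

Let htri_chevalley x : htri x -> htri (chevalley x).
Proof.
have [wl _] := chevalley_morph iota A.
move=> [_ [y hy [z pz <-]] [t mt <-]]; rewrite !(lmapD wl).
apply: (subD subspace_htri); last by apply: htri_p; exact: chevalley_nminus.
apply: (subD subspace_htri); first by apply: htri_h; exact: chevalley_hspan.
exists 0; first exact: sub0 (subspace_sum (subspace_hspan _ _) subspace_nplus).
by exists (chevalley z); [exact: chevalley_nplus | rewrite add0r].
Qed.

Let htri_m x : nminus x -> htri x.
Proof.
by move=> mx; rewrite -(chevalleyK x); apply: htri_chevalley; apply: htri_p; exact: chevalley_nminus.
Qed.

Let htri_stable_h i : stabilizer htri (h i).
Proof.
move=> _ [_ [y hy [z pz <-]] [t mt <-]]; rewrite !lieDr.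
apply: (subD subspace_htri); first apply: (subD subspace_htri).
- apply: htri_h; move: y hy; apply: (lspan_map (linear_lier _) (subspace_hspan _ _)).
  by move=> _ [j _ <-]; rewrite lie_hh; exact: sub0 (subspace_hspan _ _).
- by apply: htri_p; exact: nplus_h.
- apply: htri_m; move: t mt; apply: (@chevalley_stable _ _ _ _ _ nplus nminus) => //.
  rewrite chevalley_h => t pt; rewrite lieNl; apply: (subN subspace_nplus); exact: nplus_h.
Qed.

Let htri_stable_f i : stabilizer htri (f i).
Proof.
have [_ n_lie] := lie_subalgebra_closure (range f).
move=> _ [_ [y hy [z pz <-]] [t mt <-]]; rewrite !lieDr.
apply: (subD subspace_htri); first apply: (subD subspace_htri).
- apply: htri_m; move: y hy; apply: (lspan_map (linear_lier _) subspace_nminus).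
  move=> _ [j _ <-]; rewrite lieC lie_hf scaleNr opprK; apply: (subZ subspace_nminus).
  by apply: sub_lie_closure; exists i.
- by apply: htri_hp; exact: nplus_f.
- by apply: htri_m; apply: n_lie => //; apply: sub_lie_closure; exists i.
Qed.

Lemma htriT x : htri x.
Proof.
have fE i : htri (f i) by apply: htri_m; apply: sub_lie_closure; exists i.
apply: (borcherds_stable subspace_htri) => i; split=> //.
- by apply: htri_h; exact: hspan_h.
- by rewrite -chevalley_f; exact: htri_chevalley.
- by apply: (@chevalley_stable _ _ _ _ _ htri htri) => //; rewrite chevalley_e.
Qed.

(** Scaling all [e i] by [2] isolates the degree-one part of [n^+], which is the
    span of the [e i]; scaling [e j] alone then isolates [e j]. *)
Let high : set K := range (fun n : nat => 2 ^ (Posz n.+2)).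
Let low : set K := range (fun n : nat => 2 ^ (- Posz n.+1)).

Lemma simple_root_space (j : I) x : degree_space << j >> x -> exists c, x = c *: e j.
Proof.
pose ht : {additive {malg int[I]} -> int} := mmap idfun (fun _ => 1 : int).
have ht1 i : ht << i >> = 1 by rewrite /ht /= mmapU mulr1.
pose T := torus (iota := iota) (A := A) (fun i => (2 : K) ^ ht << i >>).
have [[Tl Tb] Th Te Tf] : [/\ lie_morph T, forall i, T (h i) = h i,
    forall i, T (e i) = (2 : K) *: e i & forall i, T (f i) = (2 : K)^-1 *: f i].
  have [] := @torusP R K iota I A (fun i => (2 : K) ^ ht << i >>).
    by move=> i; rewrite expfz_neq0.
  by move=> ? ? Te Tf; split=> // i; rewrite /T ?Te ?Tf ht1 expr1z.
have Hsub := subspace_lspan; move=> jx.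
have /= := torus_degree ht jx; rewrite -/T ht1 expr1z => Tx.
have [_ [y hy [z pz <-]] [t mt tE]] := htriT x.
have Ty : eig_span T [set 1] y.
  apply: (lspanS _ hy) => _ [i _ <-]; exists 1 => //; rewrite Th scale1r //.
have Tt : eig_span T low t.
  apply: (lie_closure_sub _ _ mt); last first.
    move=> _ [i _ <-]; apply: sub_lspan; exists 2^-1 => //; exists 0%N => //.
  split=> [|u v]; first exact: Hsub.
  apply: eig_span_lie => // _ _ [n _ <-] [m _ <-]; exists (n + m).+1 => //.
  by rewrite -expfzDr //; congr (_ ^ _); lia.
have [z1 z1e [z2 z2T zE]] : [set u + v | u in lspan (range e) & v in eig_span T high] z.
  have e_T u : lspan (range e) u -> eig_span T [set 2] u.
    by apply: lspanS => _ [i _ <-]; exists 2 => //; rewrite Te.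
  have prod_high E F u v : (forall a b, E a -> F b -> high (a * b)) ->
      eig_span T E u -> eig_span T F v -> eig_span T high (lie u v).
    by move=> EF; exact: eig_span_lie.
  apply: (lie_closure_sub _ _ pz); last first.
    move=> _ [i _ <-]; exists (e i); first by apply: sub_lspan; exists i.
    by exists 0; [exact: sub0 (Hsub _ _ _) | rewrite addr0].
  split; first by apply: subspace_sum; exact: Hsub.
  move=> _ _ [u1 u1e [u2 u2T <-]] [v1 v1e [v2 v2T <-]].
  exists 0; first exact: sub0 (Hsub _ _ _).
  exists (lie (u1 + u2) (v1 + v2)); last by rewrite add0r.
  rewrite lieDl !lieDr; have T_sub := Hsub _ _ [set v | exists2 a, high a & T v = a *: v].
  apply: (subD T_sub); apply: (subD T_sub).
  - apply: (prod_high [set 2] [set 2]); try exact: e_T.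
    by move=> _ _ -> ->; exists 0%N.
  - apply: (prod_high [set 2] high) => //; last exact: e_T.
    move=> _ _ -> [n _ <-]; exists n.+1 => //.
  - apply: (prod_high high [set 2]) => //; last exact: e_T.
    move=> _ _ [n _ <-] ->; exists n.+1 => //.
    by rewrite -[X in _ * X]expr1z -expfzDr //; congr (_ ^ _); lia.
  - apply: (prod_high high high) => // _ _ [n _ <-] [m _ <-]; exists (n + m).+2 => //.
    by rewrite -expfzDr //; congr (_ ^ _); lia.
(* [x - z1] is an eigenvector for [2], but a sum of eigenvectors for other
   powers of [2]. *)
have xE : x = z1.
  apply/eqP; rewrite -subr_eq0; apply/eqP.
  apply: (eig_span_disjoint Tl (E := [set 2]) (F := [set 1] `|` high `|` low)).
  - move=> a [/= -> [[/=|[n _]]|[n _]]].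
    + by rewrite -[X in X = _]expr1z -[X in _ = X](expr0z 2) => /two_pow_inj.
    + by rewrite -[X in _ = X]expr1z => /two_pow_inj.
    + by rewrite -[X in _ = X]expr1z => /two_pow_inj.
  - apply: sub_lspan; exists 2 => //; rewrite (lmapB Tl) Tx scalerBr; congr (_ - _).
    move: z1e; apply: (@lspan_sub _ _ _ [set u | T u = 2 *: u]); last by move=> _ [i _ <-] /=.
    split; first by rewrite /= lmap0 // scaler0.
    by move=> c u v /= Tu Tv; rewrite Tl Tu Tv scalerDr !scalerA mulrC.
  have -> : x - z1 = y + z2 + t by rewrite -tE -zE !addrA [LHS](ACl (1*3*4*(2*5)))%AC /= subrr addr0.
  have T_sub := Hsub _ _ [set v | exists2 a, ([set 1] `|` high `|` low) a & T v = a *: v].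
  apply: (subD T_sub); first apply: (subD T_sub).
  - by apply: eig_spanS Ty => a ->; left; left.
  - by apply: eig_spanS z2T => a ha; left; right.
  - by apply: eig_spanS Tt => a ha; right.
pose ct : {additive {malg int[I]} -> int} := mcoeff j.
have ctE i : ct << i >> = (i == j)%:R by rewrite /ct /= mcoeffU.
pose S := torus (iota := iota) (A := A) (fun i => (2 : K) ^ ct << i >>).
have [[Sl Sb] _ Se _] : [/\ lie_morph S, forall i, S (h i) = h i,
    forall i, S (e i) = (2 : K) ^ ct << i >> *: e i &
    forall i, S (f i) = ((2 : K) ^ ct << i >>)^-1 *: f i].
  by apply: torusP => i; rewrite expfz_neq0.
have /= := torus_degree ct jx; rewrite -/S ctE eqxx expr1z => Sx.
have [_ [c _ <-] [v Sv vE]] : [set u + v | u in range (fun c => c *: e j) & v in [set v | S v = v]] z1.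
  apply: (lspan_sub _ _ z1e); last first.
    move=> _ [i _ <-]; have [->|ij] := pselect (i = j).
      exists (e j); first by exists 1 => //; rewrite scale1r.
      by exists 0; [rewrite /= lmap0 | rewrite addr0].
    exists 0; first by exists 0 => //; rewrite scale0r.
    exists (e i); last by rewrite add0r.
    by rewrite /= Se ctE (_ : (i == j) = false) ?expr0z ?scale1r //; apply/eqP.
  apply: subspace_sum.
    split; first by exists 0 => //; rewrite scale0r.
    move=> a _ _ [c _ <-] [d _ <-]; exists (a * c + d) => //.
    by rewrite scalerDl scalerA.
  split; first by rewrite /= lmap0.
  by move=> a u v /= Su Sv; rewrite Sl Su Sv.
exists c; rewrite xE -vE.
(* Now [v] is scaled by [2] and fixed by the same automorphism. *)
suff -> : v = 0 by rewrite addr0.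
move: Sx; rewrite xE -vE (lmapD Sl) (lmapZ Sl) Se ctE eqxx expr1z Sv scalerDr !scalerA mulrC.
by move=> /addrI /eqP; rewrite scaler_nat mulr2n -subr_eq0 opprD addrA subrr sub0r oppr_eq0 => /eqP.
Qed.

(** A real root is a Weyl conjugate of a simple root [alpha_j], and the
    reflections lift to automorphisms, so its root vectors are conjugate to
    multiples of [e j]. *)
Lemma real_root_vector alpha x : real_root iota A alpha -> degree_space alpha x ->
  exists t j c, [/\ lie_auto t, J j & x = t (c *: e j)].
Proof.
move=> rr; elim: rr x => {alpha} [j Jj|be j m rr IH Jj mE] x.
  move=> /simple_root_space[c ->]; exists id, j, c; split=> //; exact: lie_auto_id.
move=> dx; have [rm [r' r'm [rK r'K]]] := reflection_auto Jj.
have /(reflection_degree Jj dx) : (- m)%:~R = 2 * root_form A (be - << j >> *~ m) << j >> / A j j.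
  rewrite root_form_simple mmapB raddfMz /= mmapU mul1r -root_form_simple.
  by rewrite mulrBr mulrBl -mE -mulrzr mulrNz; field; exact: J_neq0.
rewrite mulrNz opprK subrK => /IH[t [k [c [ta Jk rxE]]]].
exists (r' \o t), k, c; split=> //; last by rewrite /= -rxE rK.
apply: lie_auto_comp => //; exact: lie_auto_inv (reflection_auto Jj) rK r'K.
Qed.

Lemma real_root_nilpotent alpha x : real_root iota A alpha -> degree_space alpha x ->
  locally_nilpotent (lie x).
Proof.
move=> rr /(real_root_vector rr)[t [j [c [ta Jj ->]]]].
by apply: locally_nilpotent_auto => //; apply: locally_nilpotent_adZ; exact: ad_e_nilpotent.
Qed.

End RealRoots.

(** * The free associative algebra and its Lie elements *)

Lemma malg_scaleAr (K : fieldType) (M : monomType) (k : K)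
    (a b : {malg K[M]}) : a * (k *: b) = k *: (a * b).
Proof.
apply/malgP => x; rewrite mcoeffZ.
rewrite (mcoeffMlw _ (fsubset_refl _) (msuppZ_le k b)) mcoeffMl mulr_sumr.
apply: eq_bigr => k1 _; rewrite mulr_sumr; apply: eq_bigr => k2 _.
by rewrite mcoeffZ mulrCA mulrnAr.
Qed.

Section RingIdentities.
Context (B : nzRingType).
Implicit Types x y z : B.

Lemma leibniz_mul3 s u v ds du dv :
  ds * (u * v) + s * (du * v + u * dv) = (ds * u + s * du) * v + s * u * dv :> B.
Proof. by rewrite mulrDr mulrDl !mulrA addrA. Qed.

Lemma leibniz_commutator x y dx dy :
  dx * y + x * dy - (dy * x + y * dx) = (dx * y - y * dx) + (x * dy - dy * x) :> B.
Proof. by rewrite opprD [LHS](AC (2*2) ((1*4)*(2*3)))%AC. Qed.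

Lemma leibniz_bracket a b p q r t pq qp rt tr :
  (pq * b + q * r + (p * t + a * tr)) - (qp * b + p * t + (q * r + a * rt))
  = (pq - qp) * b + a * (tr - rt) :> B.
Proof.
rewrite mulrBl mulrBr !opprD [LHS](AC ((2*2)*(2*2)) ((1*5)*(4*8)*(2*7)*(3*6)))%AC /=.
by rewrite !subrr !addr0.
Qed.
Lemma cross_terms s p q r p' q' r' :
  p + (q + s * r) - (p' + q + (q' + s * r')) = p - q' - p' + s * (r - r') :> B.
Proof.
rewrite mulrBr !opprD !addrA [LHS](ACl (1*6*4*3*7*(2*5)))%AC /=.
by rewrite subrr addr0.
Qed.

Lemma commutator_mul x y z :
  (x * y - y * x) * z = x * (y * z) - y * (x * z) :> B.
Proof. by rewrite mulrBl !mulrA. Qed.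

Lemma opp_leibniz x y dx dy :
  - (dx * y + x * dy) = - dx * y + x * - dy :> B.
Proof. by rewrite opprD mulNr mulrN. Qed.

End RingIdentities.

Section FreeAlgebraTheory.
Context (K : fieldType) (S : choiceType).
Local Notation T := (free_alg K S).
Implicit Types (a b c : T) (s : S) (w : seq S).

Lemma linear_mulr a : linear_map ( *%R a).
Proof. by move=> k x y; rewrite mulrDr malg_scaleAr. Qed.
Lemma linear_mull b : linear_map (fun a => a * b).
Proof. by move=> k x y; rewrite mulrDl scalerAl. Qed.

Definition word w : T := \prod_(t <- w) fvar K t.

Lemma word_cat w1 w2 : word (w1 ++ w2) = word w1 * word w2.
Proof. exact: big_cat. Qed.
Lemma word_cons s w : word (s :: w) = fvar K s * word w.
Proof. exact: big_cons. Qed.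
Lemma word_nil : word [::] = 1.
Proof. exact: big_nil. Qed.
Lemma word1 s : word [:: s] = fvar K s.
Proof. exact: big_seq1. Qed.

Lemma wordE (m : {fmonom S}) : << m >> = word m.
Proof.
rewrite -{1}(fmK m); elim: (m : seq S) => [|s w IHw].
  by rewrite word_nil -fmoneE.
rewrite word_cons -IHw malgM_def fgmulUU mulr1; congr (<< _ >>).
by apply/eqP; rewrite fmP fmM fmU.
Qed.

Lemma word_ext (V : lmodType K) (f g : T -> V) : linear_map f -> linear_map g ->
  (forall w, f (word w) = g (word w)) -> f =1 g.
Proof. by move=> fl gl fg; apply: malg_ext => // m; rewrite wordE. Qed.

Lemma word_sub (W : set T) : subspace W -> (forall w, W (word w)) -> forall a, W a.
Proof. by move=> W_sub WX; apply: malg_sub => // m; rewrite wordE. Qed.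

Lemma free_alg_ind (W : set T) : subspace W -> W 1 ->
  (forall s a, W a -> W (fvar K s * a)) -> forall a, W a.
Proof.
move=> W_sub W1 WM; apply: word_sub => // w; elim: w => [|s w IHw]; first by rewrite word_nil.
by rewrite word_cons; exact: WM.
Qed.

Lemma free_alg_ext (V : lmodType K) (f g : T -> V) : linear_map f -> linear_map g ->
  f 1 = g 1 -> (forall s a, f a = g a -> f (fvar K s * a) = g (fvar K s * a)) -> f =1 g.
Proof.
move=> fl gl fg1 fgM; apply: (@free_alg_ind [set a | f a = g a]) => //.
by split=> [|k x y /= fx fy]; rewrite /= ?(lmap0 fl) ?(lmap0 gl) // fl gl fx fy.
Qed.

Definition word_map (V : lmodType K) (phi : seq S -> V) (a : T) : V :=
  lincomb (fun m : {fmonom S} => phi m) a.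

Lemma word_map_lin (V : lmodType K) (phi : seq S -> V) : linear_map (word_map phi).
Proof. exact: lincomb_linear. Qed.

Lemma word_mapE (V : lmodType K) (phi : seq S -> V) w : word_map phi (word w) = phi w.
Proof. by rewrite -[word w](wordE (FMonom w)) /word_map lincombU. Qed.

Lemma bilinear_ext (V : lmodType K) (f g : T -> T -> V) :
  (forall a, linear_map (f a)) -> (forall b, linear_map (f^~ b)) ->
  (forall a, linear_map (g a)) -> (forall b, linear_map (g^~ b)) ->
  (forall w1 w2, f (word w1) (word w2) = g (word w1) (word w2)) ->
  forall a b, f a b = g a b.
Proof.
move=> flr fll glr gll fg a b.
apply: (@word_ext _ (f^~ b) (g^~ b)) => // w1.
by apply: word_ext => // w2.
Qed.

Definition derivation (D : T -> T) : Prop :=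
  linear_map D /\ forall a b, D (a * b) = D a * b + a * D b.

Lemma derivation1 D : derivation D -> D 1 = 0.
Proof.
case=> _ DM; have := DM 1 1; rewrite !(mul1r, mulr1) => /eqP.
by rewrite -{1}[D 1]addr0 (inj_eq (addrI _)) eq_sym => /eqP.
Qed.

(** The elements where two derivations agree form a subalgebra. *)
Lemma derivation_ext D D' : derivation D -> derivation D' ->
  (forall s, D (fvar K s) = D' (fvar K s)) -> D =1 D'.
Proof.
move=> dD dD' DD'; have [Dl DM] := dD; have [D'l D'M] := dD'.
apply: free_alg_ext => //; first by rewrite !derivation1.
by move=> s a Da; rewrite DM D'M Da DD'.
Qed.

Lemma free_derivation_lin (d : S -> T) : linear_map (free_derivation d).
Proof. exact: lincomb_linear. Qed.

Lemma free_derivation_word (d : S -> T) w :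
  free_derivation d (word w) = word_derivation d w.
Proof. exact: word_mapE. Qed.

Lemma free_derivation_fvar (d : S -> T) s : free_derivation d (fvar K s) = d s.
Proof.
by rewrite -word1 free_derivation_word /= big_nil mulr1 mulr0 addr0.
Qed.

Lemma free_derivationP (d : S -> T) : derivation (free_derivation d).
Proof.
have Dl := free_derivation_lin d; split=> //.
apply: (@bilinear_ext _ (fun a b => free_derivation d (a * b))
  (fun a b => free_derivation d a * b + a * free_derivation d b)).
- by move=> a; exact: (linear_map_comp Dl (linear_mulr a)).
- by move=> b; exact: (linear_map_comp Dl (linear_mull b)).
- move=> a; apply: linear_mapD; first exact: linear_mulr.
  exact: (linear_map_comp (linear_mulr a) Dl).
- move=> b; apply: linear_mapD; last exact: linear_mull.
  exact: (linear_map_comp (linear_mull b) Dl).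
move=> w1 w2; rewrite -word_cat !free_derivation_word.
elim: w1 => [|s w1 IHw] /=; first by rewrite mul0r add0r word_nil mul1r.
rewrite IHw -/(word _) -/(word w1) word_cat word_cons.
exact: leibniz_mul3.
Qed.

Lemma derivationB D D' : derivation D -> derivation D' ->
  derivation (fun a => D (D' a) - D' (D a)).
Proof.
move=> [Dl DM] [D'l D'M]; split.
  apply: linear_mapD; first exact: linear_map_comp.
  apply: linear_mapN; exact: linear_map_comp.
have compE F F' : derivation F -> derivation F' -> forall a b,
    F (F' (a * b)) = F (F' a) * b + F' a * F b + (F a * F' b + a * F (F' b)).
  move=> [Fl FM] [F'l F'M] a b; rewrite F'M (lmapD Fl).
  by congr (_ + _); exact: FM.
move=> a b; rewrite (compE D D' (conj Dl DM) (conj D'l D'M)).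
rewrite (compE D' D (conj D'l D'M) (conj Dl DM)); exact: leibniz_bracket.
Qed.

(** ** Homogeneous elements *)

Lemma homogeneousE n a : homogeneous n a -> a = \sum_(m <- msupp a) a@_m *: word m.
Proof.
by move=> _; rewrite {1}(malg_lincomb a); apply: eq_bigr => m _; rewrite wordE.
Qed.

Lemma subspace_homogeneous n : subspace (@homogeneous K S n).
Proof.
split=> [w|c x y xn yn w]; first by rewrite msupp0 inE.
move=> /(fsubsetP (msuppD_le _ _)); rewrite in_fsetU => /orP[|/yn//].
by move=> /(fsubsetP (msuppZ_le _ _)) /xn.
Qed.

Lemma homogeneous_word w : homogeneous (size w) (word w).
Proof.
rewrite -[word w](wordE (FMonom w)) => m; rewrite msuppU oner_eq0 inE => /eqP->.
by rewrite fdegE.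
Qed.

Lemma homogeneous_fvar s : homogeneous 1 (fvar K s).
Proof. by rewrite -word1; exact: homogeneous_word. Qed.

(** A homogeneous element is a combination of words of its degree. *)
Lemma homogeneous_sub n (W : set T) : subspace W ->
  (forall w, size w = n -> W (word w)) -> forall a, homogeneous n a -> W a.
Proof.
move=> W_sub Ww a an; rewrite (homogeneousE an); apply: sub_sum => // m ma.
by apply: subZ => //; apply: Ww; rewrite -fdegE; exact: an.
Qed.

Lemma homogeneousM n m a b : homogeneous n a -> homogeneous m b ->
  homogeneous (n + m) (a * b).
Proof.
have h_sub := subspace_homogeneous (n + m).
move=> an bm; move: a an.
apply: (@homogeneous_sub n [set a | homogeneous (n + m) (a * b)]).
  split; first by rewrite /= mul0r; exact: sub0 h_sub.
  move=> k x y xb yb; rewrite /= (linear_mull b).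
  by case: h_sub => _ h_lin; exact: (h_lin k _ _ xb yb).
move=> w1 w1n /=; move: b bm.
apply: (@homogeneous_sub m [set b | homogeneous (n + m) (word w1 * b)]).
  split; first by rewrite /= mulr0; exact: sub0 h_sub.
  move=> k x y xb yb; rewrite /= (linear_mulr _).
  by case: h_sub => _ h_lin; exact: (h_lin k _ _ xb yb).
move=> w2 w2m /=; rewrite -word_cat -w1n -w2m -size_cat; exact: homogeneous_word.
Qed.

Lemma homogeneous_lie n m a b : homogeneous n a -> homogeneous m b ->
  homogeneous (n + m) (lie a b).
Proof.
move=> an bm; apply: (subB (subspace_homogeneous _)); first exact: homogeneousM.
by rewrite addnC; exact: homogeneousM.
Qed.

Lemma derivation_homogeneous D n a : derivation D ->
  (forall s, homogeneous 1 (D (fvar K s))) -> homogeneous n a -> homogeneous n (D a).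
Proof.
move=> dD D1; have [Dl DM] := dD; have h_sub := subspace_homogeneous; move: a.
apply: (@homogeneous_sub n (D @^-1` homogeneous n)).
  split; rewrite /preimage /=; first by rewrite lmap0 //; exact: sub0 (h_sub _).
  by move=> k x y Dx Dy; rewrite Dl; case: (h_sub n) => _; apply.
move=> w <-; rewrite /preimage /=; elim: w => [|s w IHw] /=.
  by rewrite word_nil (derivation1 dD); exact: sub0 (h_sub _).
rewrite word_cons DM -add1n; apply: (subD (h_sub _)).
  by apply: homogeneousM => //; exact: homogeneous_word.
by apply: homogeneousM => //; exact: homogeneous_fvar.
Qed.

Lemma derivation_freeLie D : derivation D -> (forall s, freeLie K S (D (fvar K s))) ->
  forall a, freeLie K S a -> freeLie K S (D a).
Proof.
move=> [Dl DM] Ds; have [fL_sub fL_lie] := lie_subalgebra_closure (range (@fvar K S)).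
have sub : freeLie K S `<=` (freeLie K S `&` (D @^-1` freeLie K S)).
  apply: lie_closure_sub; last first.
    by move=> _ [s _ <-]; split; [apply: sub_lie_closure; exists s | exact: Ds].
  split; first split.
  - by split; rewrite /preimage /= ?lmap0 //; exact: sub0 fL_sub.
  - move=> k x y [Lx LDx] [Ly LDy]; split; first by case: fL_sub => _; apply.
    by rewrite /preimage /= Dl; case: fL_sub => _; apply.
  - move=> x y [Lx LDx] [Ly LDy]; split; first exact: fL_lie.
    rewrite /preimage /mkset; have -> : D (lie x y) = lie (D x) y + lie x (D y).
      apply: etrans (lmapB Dl (x * y) (y * x)) _.
      exact: etrans (congr2 (fun p q => p - q) (DM x y) (DM y x)) (leibniz_commutator _ _ _ _).
    by apply: (subD fL_sub); exact: fL_lie.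
by move=> a /sub[].
Qed.

(** ** The universal property of the free Lie algebra *)

(** Dynkin's map sends the word [s1 ... sn] to
    [lie (beta s1) (... lie (beta s(n-1)) (beta sn))]. In characteristic zero,
    dividing it by the degree gives on Lie elements the morphism that extends
    [beta]: for Lie elements [a], [b] of degrees [n], [m] the map sends
    [a * b - b * a] to [ad a] of the image of [b] minus [ad b] of the image of
    [a], which is [n + m] times the bracket of the images of [a] and [b] under
    the divided map. *)
Section Dynkin.
Context (K_char0 : forall n, (n.+1%:R : K) != 0).
Context (L : lieAlgType K) (beta : S -> L).

Definition act_word (x : L) (w : seq S) : L := foldr (fun s => lie (beta s)) x w.
Definition act (a : T) (x : L) : L := word_map (act_word x) a.

Fixpoint dynkin_word (w : seq S) : L :=
  if w is s :: w' then if w' is [::] then beta s else lie (beta s) (dynkin_word w')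
  else 0.
Definition dynkin : T -> L := word_map dynkin_word.

Definition free_lie_lift : T -> L :=
  word_map (fun w => (size w)%:R^-1 *: dynkin_word w).

Lemma free_lie_lift_lin : linear_map free_lie_lift.
Proof. exact: word_map_lin. Qed.

Lemma free_lie_lift_fvar s : free_lie_lift (fvar K s) = beta s.
Proof. by rewrite -word1 /free_lie_lift word_mapE /= invr1 scale1r. Qed.

Let act_linl x : linear_map (act^~ x). Proof. exact: word_map_lin. Qed.

Let act_linr a : linear_map (act a).
Proof.
move=> k x y.
apply: (@word_ext _ (act^~ (k *: x + y)) (fun a => k *: act a x + act a y)) => //.
  by apply: linear_mapD => //; exact: linear_mapZ.
move=> w; rewrite /act !word_mapE; elim: w => //= s w ->.
by rewrite lie_linearr.
Qed.

Let actM a b x : act (a * b) x = act a (act b x).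
Proof.
apply: (@bilinear_ext _ (fun a b => act (a * b) x) (fun a b => act a (act b x))) => //.
- by move=> {}a; exact: (linear_map_comp (act_linl x) (linear_mulr a)).
- by move=> {}b; exact: (linear_map_comp (act_linl x) (linear_mull b)).
- by move=> {}a; exact: (linear_map_comp (act_linr a) (act_linl x)).
- by move=> w1 w2; rewrite -word_cat /act !word_mapE /act_word foldr_cat.
Qed.

Let dynkinM n a b : homogeneous n.+1 b -> dynkin (a * b) = act a (dynkin b).
Proof.
have dl := word_map_lin dynkin_word; move: b.
apply: (@homogeneous_sub _ [set b | dynkin (a * b) = act a (dynkin b)]).
  split=> [|k x y /= Dx Dy]; first by rewrite /= mulr0 /dynkin !lmap0.
  rewrite linear_mulr; apply: etrans (dl k (a * x) (a * y)) _.
  apply: etrans _ (esym (congr1 (act a) (dl k x y))); rewrite act_linr.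
  exact: (congr2 (fun p q : L => k *: p + q) Dx Dy).
move=> w2 w2n /=; move: a.
apply: (@word_ext _ (fun a => dynkin (a * word w2)) (fun a => act a (dynkin (word w2)))) => //.
  exact: (linear_map_comp dl (linear_mull _)).
move=> w1; rewrite -word_cat /act /dynkin !word_mapE.
elim: w1 => //= s w1 ->; case: w1 => //=; by case: w2 w2n.
Qed.

Let lift_homogeneous n a : homogeneous n a -> dynkin a = n%:R *: free_lie_lift a.
Proof.
have dl := word_map_lin dynkin_word; have ll := free_lie_lift_lin; move: a.
apply: (@homogeneous_sub _ [set a | dynkin a = n%:R *: free_lie_lift a]).
  split=> [|k x y /= Dx Dy]; first by rewrite /= lmap0 ?(lmap0 ll) ?scaler0.
  by rewrite /dynkin dl ll -!/(dynkin _) Dx Dy scalerDr !scalerA mulrC.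
move=> w <- /=; rewrite /dynkin /free_lie_lift !word_mapE scalerA.
case: w => [|s w]; first by rewrite scaler0.
by rewrite divff ?scale1r // K_char0.
Qed.

(* On such elements the associative action is given by the bracket with the
   image; this is what makes the induction on brackets work. *)
Let lie_like n : set T := [set a | homogeneous n.+1 a /\
  forall y, act a y = lie (free_lie_lift a) y].

Let lie_like_lie n m a b : lie_like n a -> lie_like m b ->
  free_lie_lift (lie a b) = lie (free_lie_lift a) (free_lie_lift b) /\
  lie_like (n + m).+1 (lie a b).
Proof.
move=> [an aL] [bm bL]; have hab : homogeneous (n + m).+2 (lie a b).
  by rewrite -addSn -addnS; exact: homogeneous_lie.
have liftE : free_lie_lift (lie a b) = lie (free_lie_lift a) (free_lie_lift b).
  apply: (scalerI (K_char0 (n + m).+1)); rewrite -lift_homogeneous //.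
  apply: etrans (lmapB (word_map_lin dynkin_word) (a * b) (b * a)) _.
  apply: etrans (congr2 (fun p q : L => p - q) (dynkinM a bm) (dynkinM b an)) _.
  rewrite aL bL (lift_homogeneous an) (lift_homogeneous bm).
  rewrite !lieZr [lie (free_lie_lift b) _]lieC scalerN opprK -scalerDl.
  by rewrite -natrD addSn addnS addnC.
split=> //; split=> // y; rewrite liftE lie_lie -!aL -!bL.
exact: etrans (lmapB (act_linl y) (a * b) (b * a))
  (congr2 (fun p q : L => p - q) (actM a b y) (actM b a y)).
Qed.

Lemma free_lie_lift_hom : lie_hom_on (freeLie K S) free_lie_lift.
Proof.
pose F := [set a | exists n, lie_like n a].
have [F_sub [F_lin F_lie]] : lie_subalgebra (lspan F) /\ lie_hom_on (lspan F) free_lie_lift.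
  apply: lspan_lie_hom; first exact: free_lie_lift_lin.
  move=> a b [n an] [m bm]; have [E lab] := lie_like_lie an bm; split; first exact: E.
  by apply: sub_lspan; exists (n + m).+1.
have sub : freeLie K S `<=` lspan F.
  apply: lie_closure_sub F_sub _ => _ [s _ <-]; apply: sub_lspan; exists 0%N.
  split; first exact: homogeneous_fvar.
  by move=> y; rewrite free_lie_lift_fvar -word1 /act word_mapE.
split=> [k x y _ _|x y /sub Fx /sub Fy]; first exact: free_lie_lift_lin.
exact: F_lie.
Qed.

End Dynkin.

End FreeAlgebraTheory.

(** * The representation on the tensor algebra *)

Section Coordinates.
Context (K : fieldType) (V : lmodType K) (S : choiceType) (W : set V) (b : S -> V).
Context (W_sub : subspace W) (b_basis : is_basis W b).

Lemma basis_in s : W (b s).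
Proof. by rewrite -(lincombU b s); case: b_basis => + _ _; apply. Qed.

Lemma basis_lincomb c : W (lincomb b c).
Proof. by case: b_basis => + _ _; apply. Qed.

Lemma coord_lincomb c : Defs.coord b (lincomb b c) = c.
Proof.
have [_ b_inj _] := b_basis; apply: b_inj; rewrite ?in_setT //.
by apply: (@xgetPex _ 0 [set d | lincomb b d = lincomb b c]); exists c.
Qed.

Lemma basisP v : W v -> exists c, v = lincomb b c.
Proof. by case: b_basis => _ _ + Wv => /(_ v Wv)[c _ <-]; exists c. Qed.

Lemma basis_sub (H : set V) : subspace H -> (forall s, H (b s)) -> W `<=` H.
Proof.
move=> H_sub Hb v /basisP[c ->]; apply: sub_sum => // s _; exact: subZ.
Qed.
End Coordinates.

Section TensorRepresentation.
Context (R : realType) (K : fieldType) (iota : {rmorphism K -> R[i]}).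
Context (I : countType) (A : I -> I -> K).
Context (A_neg : forall i j, ~ J iota A i -> ~ J iota A j -> i <> j ->
             iota (A i j) < 0).
Context (S : choiceType) (b : S -> borcherds iota A).
Context (b_basis : is_basis (Vminus iota A) b).
Local Notation g := (borcherds iota A).
Local Notation h := (bh iota A).
Local Notation e := (be iota A).
Local Notation f := (bf iota A).
Local Notation J := (J iota A).
Local Notation levi := (@levi R K iota I A).
Local Notation V' := (Vminus iota A).
Local Notation T := (free_alg K S).
Local Notation fvar := (fvar K).
Local Notation tens := (@tensor1 R K iota I A S b).
Local Notation D := (pi_rep b).

Let V_sub : subspace V'. Proof. exact: subspace_Vminus. Qed.

Lemma tensor1_lincomb c : tens (lincomb b c) = lincomb fvar c.
Proof. by rewrite /tensor1 (coord_lincomb b_basis). Qed.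

Lemma tensor1_b s : tens (b s) = fvar s.
Proof. by rewrite -(lincombU b s) tensor1_lincomb lincombU. Qed.

Lemma tensor1_lin k x y : V' x -> V' y -> tens (k *: x + y) = k *: tens x + tens y.
Proof.
move=> /(basisP b_basis)[c ->] /(basisP b_basis)[d ->].
by rewrite -lincomb_linear !tensor1_lincomb lincomb_linear.
Qed.

Lemma tensor1_0 : tens 0 = 0.
Proof. by rewrite -(lmap0 (lincomb_linear b)) tensor1_lincomb (lmap0 (lincomb_linear _)). Qed.

Lemma tensor1_homogeneous v : homogeneous 1 (tens v).
Proof.
have h_sub := @subspace_homogeneous K S 1.
by apply: (sub_sum h_sub) => s _; apply: (subZ h_sub); exact: homogeneous_fvar.
Qed.

Lemma tensor1_freeLie v : freeLie K S (tens v).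
Proof.
have [fL_sub _] := lie_subalgebra_closure (range (@Defs.fvar K S)).
by apply: (sub_sum fL_sub) => s _; apply: (subZ fL_sub); apply: sub_lie_closure; exists s.
Qed.

Lemma pi_rep_derivation x : derivation (D x).
Proof. exact: free_derivationP. Qed.
Lemma pi_rep_lin x : linear_map (D x).
Proof. exact: free_derivation_lin. Qed.
Lemma pi_rep_fvar x s : D x (fvar s) = tens (lie x (b s)).
Proof. exact: free_derivation_fvar. Qed.

Let levi_b x s : levi x -> V' (lie x (b s)).
Proof. by move=> lx; apply: Vminus_stable => //; exact: (basis_in b_basis). Qed.

Lemma pi_rep_tensor1 x v : levi x -> V' v -> D x (tens v) = tens (lie x v).
Proof.
move=> lx /(basisP b_basis)[c ->]; rewrite tensor1_lincomb; move: c.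
have Vlie c : V' (lie x (lincomb b c)).
  by apply: Vminus_stable => //; exact: (basis_lincomb b_basis).
apply: malg_ext.
- exact: linear_map_comp (pi_rep_lin x) (lincomb_linear _).
- by move=> k c d; rewrite (lincomb_linear b) lie_linearr tensor1_lin.
by move=> s; rewrite !lincombU pi_rep_fvar.
Qed.

Lemma pi_rep_linear k x y a : levi x -> levi y -> D (k *: x + y) a = k *: D x a + D y a.
Proof.
move=> lx ly; move: a; apply: derivation_ext; first exact: pi_rep_derivation.
  have [Dxl Dxm] := pi_rep_derivation x; have [Dyl Dym] := pi_rep_derivation y.
  split; first by apply: linear_mapD => //; exact: linear_mapZ.
  move=> a c; apply: etrans (congr2 (fun p q : T => k *: p + q) (Dxm a c) (Dym a c)) _.
  have E1 := linear_mull c k (D x a) (D y a); have E2 := linear_mulr a k (D x c) (D y c).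
  apply: etrans _ (esym (congr2 (fun p q : T => p + q) E1 E2)).
  by rewrite scalerDr addrACA.
by move=> s; rewrite !pi_rep_fvar lie_linearl tensor1_lin //; exact: levi_b.
Qed.

Lemma pi_rep_0 a : D 0 a = 0.
Proof.
have l0 := sub0 (subspace_levi iota A).
by have := pi_rep_linear (-1) a l0 l0; rewrite scaler0 addr0 scaleN1r addNr.
Qed.

Lemma pi_repZ k x a : levi x -> D (k *: x) a = k *: D x a.
Proof.
move=> lx; have := pi_rep_linear k a lx (sub0 (subspace_levi iota A)).
by rewrite !addr0 pi_rep_0 addr0.
Qed.

Lemma pi_rep_lie x y a : levi x -> levi y -> D (lie x y) a = D x (D y a) - D y (D x a).
Proof.
move=> lx ly; move: a; apply: derivation_ext; first exact: pi_rep_derivation.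
  by apply: derivationB; exact: pi_rep_derivation.
have VB u v : V' u -> V' v -> tens (u - v) = tens u - tens v.
  move=> Vu Vv; rewrite -scaleN1r addrC tensor1_lin // scaleN1r addrC //.
move=> s; have bs := basis_in b_basis s; rewrite !pi_rep_fvar lie_lie VB.
- by congr (_ - _); rewrite pi_rep_tensor1 //; exact: levi_b.
- by apply: (Vminus_stable lx); exact: levi_b.
- by apply: (Vminus_stable ly); exact: levi_b.
Qed.

(** ** Raising operators *)

(** For [y] that maps [V'] into [levi], such as [e i] with [i] outside [J], this
    is the operator that kills [1] and whose commutator with the left
    multiplication by [v] is the derivation given by [lie y v]: the action of
    [y] on the module induced from the trivial module of [u^+ + levi]. *)
Fixpoint raise_word (y : g) (w : seq S) : T :=
  if w is s :: w' then D (lie y (b s)) (word K w') + fvar s * raise_word y w' else 0.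
Definition raise (y : g) : T -> T := word_map (raise_word y).

Definition lowering : set g := [set y | forall v, V' v -> levi (lie y v)].

Lemma raise_lin y : linear_map (raise y).
Proof. exact: word_map_lin. Qed.

Lemma raise1 y : raise y 1 = 0.
Proof. by rewrite -(word_nil K S) /raise word_mapE. Qed.

Lemma raise_fvar y s a : raise y (fvar s * a) = D (lie y (b s)) a + fvar s * raise y a.
Proof.
move: a; apply: word_ext.
- exact: linear_map_comp (raise_lin y) (linear_mulr _).
- apply: linear_mapD; first exact: pi_rep_lin.
  exact: linear_map_comp (linear_mulr _) (raise_lin y).
by move=> w; rewrite -word_cons /raise !word_mapE.
Qed.

(** Evaluation at [1] and commutators with left multiplications by letters
    determine an operator. All relations between raising operators and
    derivations follow from this by the Jacobi identity in [g]. *)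
Lemma raise_unique y (X : T -> T) : linear_map X -> X 1 = 0 ->
  (forall s a, X (fvar s * a) = D (lie y (b s)) a + fvar s * X a) -> X =1 raise y.
Proof.
move=> Xl X1 XM; apply: free_alg_ext Xl (raise_lin y) _ _; first by rewrite raise1.
move=> s a Xa; apply: etrans (XM s a) _.
by apply: etrans _ (esym (raise_fvar y s a)); rewrite Xa.
Qed.

Lemma subspace_lowering : subspace lowering.
Proof.
have l_sub := subspace_levi iota A; split=> [v _|k x y lx ly v Vv].
  by rewrite lie0x; exact: sub0 l_sub.
by rewrite lie_linearl; case: l_sub => _; apply; [exact: lx | exact: ly].
Qed.

Lemma levi_lie_lowering x y : levi x -> lowering y -> lowering (lie x y).
Proof.
move=> lx ly v Vv; rewrite lie_lie; apply: subB; first exact: subspace_levi.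
  by apply: levi_stable => //; exact: ly.
by apply: ly; exact: Vminus_stable.
Qed.

Lemma raise_tensor1 y v a : lowering y -> V' v ->
  raise y (tens v * a) = D (lie y v) a + tens v * raise y a.
Proof.
move=> ly /(basisP b_basis)[c ->]; rewrite tensor1_lincomb; move: c.
have Vc c : V' (lincomb b c) by exact: (basis_lincomb b_basis).
apply: malg_ext.
- apply: linear_map_comp (raise_lin y) _.
  exact: linear_map_comp (linear_mull a) (lincomb_linear _).
- apply: linear_mapD; last exact: linear_map_comp (linear_mull _) (lincomb_linear _).
  by move=> k c d; rewrite (lincomb_linear b) lie_linearr pi_rep_linear //; exact: ly.
by move=> s; rewrite !lincombU raise_fvar.
Qed.

Lemma raiseZ k y a : lowering y -> raise (k *: y) a = k *: raise y a.
Proof.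
move=> ly; have E : (fun a => k *: raise y a) =1 raise (k *: y).
  apply: raise_unique; first exact: linear_mapZ (raise_lin y).
    by rewrite raise1 scaler0.
  move=> s {}a; rewrite raise_fvar scalerDr lieZl pi_repZ.
    by congr (_ + _); rewrite (lmapZ (linear_mulr _)).
  by apply: ly; exact: (basis_in b_basis).
by rewrite -E.
Qed.

Lemma raise0 a : raise 0 a = 0.
Proof.
by rewrite -(scale0r (0 : g)) raiseZ ?scale0r //; exact: sub0 subspace_lowering.
Qed.

Lemma pi_rep_raise x y a : levi x -> lowering y ->
  D x (raise y a) - raise y (D x a) = raise (lie x y) a.
Proof.
move=> lx ly; move: a.
have [Dl DM] := pi_rep_derivation x; have rl := raise_lin y.
apply: raise_unique.
- exact: linear_mapD (linear_map_comp Dl rl) (linear_mapN (linear_map_comp rl Dl)).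
- rewrite raise1 (derivation1 (pi_rep_derivation x)) (lmap0 rl) (lmap0 Dl) subr0 //.
move=> s a; have bs := basis_in b_basis s; have lyb := ly _ bs.
have E1 : D x (raise y (fvar s * a)) = D x (D (lie y (b s)) a)
    + (tens (lie x (b s)) * raise y a + fvar s * D x (raise y a)).
  rewrite raise_fvar (lmapD Dl); congr (_ + _).
  by apply: etrans (DM _ _) _; rewrite pi_rep_fvar.
have E2 : raise y (D x (fvar s * a)) = D (lie y (lie x (b s))) a
    + tens (lie x (b s)) * raise y a + (D (lie y (b s)) (D x a) + fvar s * raise y (D x a)).
  apply: etrans (congr1 (raise y) (DM _ _)) _; rewrite pi_rep_fvar (lmapD rl).
  have Vx : V' (lie x (b s)) by exact: levi_b.
  by congr (_ + _); [exact: raise_tensor1 | exact: raise_fvar].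
have E3 : D (lie (lie x y) (b s)) a
    = D x (D (lie y (b s)) a) - D (lie y (b s)) (D x a) - D (lie y (lie x (b s))) a.
  have lxyb : levi (lie x (lie y (b s))) by exact: levi_stable.
  have lyxb : levi (lie y (lie x (b s))) by apply: ly; exact: levi_b.
  rewrite lie_lie -scaleN1r addrC pi_rep_linear // scaleN1r addrC.
  by rewrite pi_rep_lie.
transitivity (D x (D (lie y (b s)) a)
    + (tens (lie x (b s)) * raise y a + fvar s * D x (raise y a))
  - (D (lie y (lie x (b s))) a + tens (lie x (b s)) * raise y a
    + (D (lie y (b s)) (D x a) + fvar s * raise y (D x a)))).
  by congr (_ - _); [exact: E1 | exact: E2].
by rewrite E3; exact: cross_terms.
Qed.

End TensorRepresentation.

Section Freeness.
Context (R : realType) (K : fieldType) (iota : {rmorphism K -> R[i]}).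
Context (I : countType) (A : I -> I -> K).
Context (A_neg : forall i j, ~ J iota A i -> ~ J iota A j -> i <> j ->
             iota (A i j) < 0).
Context (S : choiceType) (b : S -> borcherds iota A).
Context (b_basis : is_basis (Vminus iota A) b).
Local Notation g := (borcherds iota A).
Local Notation h := (bh iota A).
Local Notation e := (be iota A).
Local Notation f := (bf iota A).
Local Notation J := (J iota A).
Local Notation levi := (@levi R K iota I A).
Local Notation lowering := (@lowering R K iota I A).
Local Notation V' := (Vminus iota A).
Local Notation T := (free_alg K S).

Let Dop (x : g) : endo T := Endo (pi_rep_lin b x).
Let lop (a : T) : endo T := Endo (linear_mulr a).
Let rop (y : g) : endo T := Endo (raise_lin b y).
Let tens (v : g) : T := tensor1 b v.

Let Dop_lie x y : levi x -> levi y -> lie (Dop x) (Dop y) = Dop (lie x y).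
Proof. by move=> lx ly; apply: endoP => a; apply/esym; exact: pi_rep_lie. Qed.

Let Dop_lop x v : levi x -> V' v -> lie (Dop x) (lop (tens v)) = lop (tens (lie x v)).
Proof.
move=> lx Vv; apply: endoP => a; have [_ DM] := pi_rep_derivation b x.
apply: etrans (congr1 (fun p : T => p - _) (DM (tens v) a)) _.
apply: etrans (addrK _ _) _; congr (_ * a); exact: pi_rep_tensor1.
Qed.

Let Dop_rop x y : levi x -> lowering y -> lie (Dop x) (rop y) = rop (lie x y).
Proof. by move=> lx ly; apply: endoP => a; exact: pi_rep_raise. Qed.

Let rop_lop y v : lowering y -> V' v -> lie (rop y) (lop (tens v)) = Dop (lie y v).
Proof.
move=> ly Vv; apply: endoP => a.
apply: etrans (congr1 (fun p : T => p - _) (raise_tensor1 b_basis a ly Vv)) _.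
exact: addrK.
Qed.

Let DopZ k x : levi x -> Dop (k *: x) = k *: Dop x.
Proof. by move=> lx; apply: endoP => a; exact: pi_repZ. Qed.
Let ropZ k y : lowering y -> rop (k *: y) = k *: rop y.
Proof. by move=> ly; apply: endoP => a; exact: raiseZ. Qed.
Let lop_lin : linear_map lop.
Proof. by move=> k x y; apply: endoP => c; exact: linear_mull. Qed.
Let lop_lie x y : lop (lie x y) = lie (lop x) (lop y).
Proof.
apply: endoP => c; change ((x * y - y * x) * c = x * (y * c) - y * (x * c)).
exact: commutator_mul.
Qed.
Let tens_lin k x y : V' x -> V' y -> tens (k *: x + y) = k *: tens x + tens y.
Proof. exact: tensor1_lin. Qed.
Let lopZ k v : V' v -> lop (tens (k *: v)) = k *: lop (tens v).
Proof.
move=> Vv; have V0 := sub0 (subspace_Vminus iota A); rewrite -(lmapZ lop_lin); congr lop.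
by have := tens_lin k Vv V0; rewrite !addr0 => ->; rewrite /tens tensor1_0 // addr0.
Qed.
Let Dop0 : Dop 0 = 0.
Proof. by apply: endoP => a; exact: pi_rep_0. Qed.
Let rop0 : rop 0 = 0.
Proof. by apply: endoP => a; exact: raise0. Qed.
Let lop0 : lop (tens 0) = 0.
Proof. by apply: endoP => a; rewrite /lop /tens /= tensor1_0 // mul0r. Qed.

Let levi_h i : levi (h i). Proof. by apply: levi_hspan; exact: hspan_h. Qed.
Let levi_e i : J i -> levi (e i). Proof. by move=> Ji; apply: levi_gJ; exact: gJ_e. Qed.
Let levi_f i : J i -> levi (f i). Proof. by move=> Ji; apply: levi_gJ; exact: gJ_f. Qed.
Let lower_e i : ~ J i -> lowering (e i). Proof. by move=> nJi v; exact: e_Vminus. Qed.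
Let Vf i : ~ J i -> V' (f i). Proof. exact: Vminus_f. Qed.

Let e_op i : endo T := if `[< J i >] then Dop (e i) else rop (e i).
Let f_op i : endo T := if `[< J i >] then Dop (f i) else lop (tens (f i)).

(* The iterated brackets of the Serre relations are transported by any map
   [op] to operators that intertwines the bracket with [x]. *)
Let iterP (P : g -> Prop) (op : g -> endo T) x n y : levi x -> P y ->
  (forall z, P z -> P (lie x z)) -> (forall z, P z -> lie (Dop x) (op z) = op (lie x z)) ->
  iter n (lie (Dop x)) (op y) = op (iter n (lie x) y).
Proof.
move=> lx Py xP xop; suff [] : P (iter n (lie x) y) /\
  iter n (lie (Dop x)) (op y) = op (iter n (lie x) y) by [].
elim: n => [|n [Pn En]] //=; split; first exact: xP.
by rewrite En xop.
Qed.

Let iter_Dop x n y : levi x -> levi y ->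
  iter n (lie (Dop x)) (Dop y) = Dop (iter n (lie x) y).
Proof.
by move=> lx ly; apply: (@iterP levi) => // z lz; [exact: levi_stable | exact: Dop_lie].
Qed.
Let iter_rop x n y : levi x -> lowering y ->
  iter n (lie (Dop x)) (rop y) = rop (iter n (lie x) y).
Proof.
by move=> lx ly; apply: (@iterP lowering) => // z lz; [exact: levi_lie_lowering | exact: Dop_rop].
Qed.
Let iter_lop x n y : levi x -> V' y ->
  iter n (lie (Dop x)) (lop (tens y)) = lop (tens (iter n (lie x) y)).
Proof.
move=> lx ly; apply: (@iterP V' (fun v => lop (tens v))) => // z lz; last exact: Dop_lop.
exact: Vminus_stable.
Qed.

(* Off-diagonal entries outside [J] do not vanish, so the relation
   [lie (e i) (e j) = 0] for [A i j = 0] involves [J] unless [i = j]. *)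
Let A_eq0 i j : ~ J i -> ~ J j -> A i j = 0 -> i = j.
Proof.
move=> nJi nJj A0; have [//|ij] := pselect (i = j).
by have := A_neg nJi nJj ij; rewrite A0 rmorph0 ltxx.
Qed.

(** The module induced from the trivial representation of [u^+ + levi]. *)
Lemma tensor_representation : exists rho : g -> endo (free_alg K S),
  [/\ lie_morph rho, forall i, rho (h i) = Dop (h i), forall i, rho (e i) = e_op i
   & forall i, rho (f i) = f_op i].
Proof.
apply: borcherds_lift => //.
- by move=> i j; rewrite Dop_lie // lie_hh Dop0.
- move=> i k; rewrite /e_op; case: asboolP => Jk.
    by rewrite Dop_lie ?lie_he ?DopZ //; exact: levi_e.
  by rewrite Dop_rop ?lie_he ?ropZ //; exact: lower_e.
- move=> i k; rewrite /f_op; case: asboolP => Jk.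
    by rewrite Dop_lie ?lie_hf ?DopZ //; exact: levi_f.
  apply: etrans (Dop_lop (levi_h i) (Vf Jk)) _; rewrite lie_hf; apply: lopZ; exact: Vf.
- move=> i; rewrite /e_op /f_op; case: asboolP => Ji.
    by rewrite Dop_lie ?lie_ef //; [exact: levi_e | exact: levi_f].
  by rewrite rop_lop ?lie_ef //; [exact: lower_e | exact: Vf].
- move=> i j ij; have ef0 := lie_ef0 iota A ij.
  rewrite /e_op /f_op; case: asboolP => Ji; case: asboolP => Jj.
  + by rewrite Dop_lie ?ef0 ?Dop0 //; [exact: levi_e | exact: levi_f].
  + by rewrite Dop_lop ?ef0 ?lop0 //; [exact: levi_e | exact: Vf].
  + rewrite lieC Dop_rop ?(lieC (f j)) ?ef0 ?oppr0 ?rop0 ?oppr0 //.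
      exact: levi_f.
    exact: lower_e.
  + by rewrite rop_lop ?ef0 ?Dop0 //; [exact: lower_e | exact: Vf].
- move=> i j n ij Ji nE; have se := serre_e ij Ji nE.
  rewrite /e_op asboolT //; case: asboolP => Jj.
    by rewrite iter_Dop ?se ?Dop0 //; exact: levi_e.
  by rewrite iter_rop ?se ?rop0 //; [exact: levi_e | exact: lower_e].
- move=> i j n ij Ji nE; have sf := serre_f ij Ji nE.
  rewrite /f_op asboolT //; case: asboolP => Jj.
    by rewrite iter_Dop ?sf ?Dop0 //; exact: levi_f.
  by rewrite iter_lop ?sf ?lop0 //; [exact: levi_f | exact: Vf].
- move=> i j Aij; have ee := lie_ee iota Aij.
  rewrite /e_op; case: asboolP => Ji; case: asboolP => Jj.
  + by rewrite Dop_lie ?ee ?Dop0 //; exact: levi_e.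
  + by rewrite Dop_rop ?ee ?rop0 //; [exact: levi_e | exact: lower_e].
  + rewrite lieC Dop_rop ?(lieC (e j)) ?ee ?oppr0 ?rop0 ?oppr0 //.
      exact: levi_e.
    exact: lower_e.
  + by rewrite (A_eq0 Ji Jj Aij) liexx.
- move=> i j Aij; have ff := lie_ff iota Aij.
  rewrite /f_op; case: asboolP => Ji; case: asboolP => Jj.
  + by rewrite Dop_lie ?ff ?Dop0 //; exact: levi_f.
  + by rewrite Dop_lop ?ff ?lop0 //; [exact: levi_f | exact: Vf].
  + rewrite lieC Dop_lop ?(lieC (f j)) ?ff ?oppr0 ?lop0 ?oppr0 //.
      exact: levi_f.
    exact: Vf.
  + by rewrite (A_eq0 Ji Jj Aij) liexx.
Qed.

(* [V'] is spanned by the orbits of the [f k], on which the representation is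
   given by left multiplications. *)
Let rho_Vminus rho v : lie_morph rho -> (forall i, rho (f i) = f_op i) -> V' v ->
  rho v = lop (tens v).
Proof.
move=> [rl rb] rf.
have sub : V' `<=` (V' `&` [set v | rho v = lop (tens v)]).
  have V_sub := subspace_Vminus iota A.
  have H_sub : subspace (V' `&` [set v | rho v = lop (tens v)]).
    split; first by split; [exact: sub0 V_sub | rewrite /= lop0; exact: lmap0 rl].
    move=> k x y [Vx rx] [Vy ry]; split; first by case: V_sub => _; apply.
    apply: etrans (rl k x y) _; rewrite rx ry -lop_lin; congr lop.
    by apply/esym; exact: tens_lin.
  apply: lspan_sub => // v0 [k nJk]; rewrite /nJminus Uorbit_closure; move: v0.
  apply: Uorbit_sub => //; first by split; [exact: Vf | rewrite /= rf /f_op asboolF].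
  move=> _ [j Jj <-] w [Vw rw]; have lf := levi_f Jj; split; first exact: Vminus_stable.
  apply: etrans (rb (f j) w) _; rewrite rf /f_op (asboolT Jj).
  apply: etrans (congr1 (lie _) rw) _; exact: (Dop_lop lf Vw).
by move=> /sub[].
Qed.

(** The lift of the basis maps the Lie elements onto [u^-]. Composed with the
    representation on the tensor algebra it becomes left multiplication, which
    recovers a Lie element as the image of [1]. *)
Lemma free_uminus : exists phi : free_alg K S -> g,
    [/\ set_bij (freeLie K S) (uminus iota A) phi, lie_hom_on (freeLie K S) phi
      & forall s, phi (fvar K s) = b s].
Proof.
have c0 := subfield_char0 iota.
exists (free_lie_lift b); split; [|exact: free_lie_lift_hom | exact: free_lie_lift_fvar].
have ll := free_lie_lift_lin b; have lh := free_lie_lift_hom c0 b.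
have lsub : forall a, freeLie K S a -> uminus iota A (free_lie_lift b a).
  apply: lie_hom_on_closure ll lh _ _; first exact: subalgebra_uminus.
  move=> _ [s _ <-]; rewrite free_lie_lift_fvar; apply: sub_lie_closure.
  exact: (basis_in b_basis).
split; first exact: lsub.
- move=> a a' /set_mem La /set_mem La' E.
  have [rho [rm _ _ rf]] := tensor_representation; have [rl rb] := rm.
  have rhoE : forall x, freeLie K S x -> rho (free_lie_lift b x) = lop x.
    apply: lie_hom_on_ext.
    - exact: linear_map_comp.
    - exact: lop_lin.
    - split=> [k x y _ _|x y Lx Ly]; first by rewrite ll rl.
      by rewrite (proj2 lh) // rb.
    - split=> [k x y _ _|x y _ _]; first exact: lop_lin.
      exact: lop_lie.
    - move=> _ [s _ <-]; rewrite free_lie_lift_fvar (rho_Vminus rm rf).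
        by rewrite /tens tensor1_b.
      exact: (basis_in b_basis).
  have E' : lop a = lop a' := etrans (esym (rhoE _ La)) (etrans (congr1 rho E) (rhoE _ La')).
  exact: etrans (esym (mulr1 a)) (etrans (congr1 (fun p : endo T => p 1) E') (mulr1 a')).
move=> x; move: x; apply: lie_closure_sub.
  by apply: lie_hom_on_image => //; exact: lie_subalgebra_closure.
apply: (basis_sub b_basis).
  case: (lie_hom_on_image (lie_subalgebra_closure (range (fvar K (S := S)))) ll lh).
  by [].
move=> s; exists (fvar K s); last exact: free_lie_lift_fvar.
by apply: sub_lie_closure; exists s.
Qed.

End Freeness.

Section FreeParts.
Context (R : realType) (K : fieldType) (iota : {rmorphism K -> R[i]}).
Context (I : countType) (A : I -> I -> K).
Context (A_neg : forall i j, ~ J iota A i -> ~ J iota A j -> i <> j ->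
             iota (A i j) < 0).

Lemma is_free_uminus : is_free_lie (Vminus iota A) (uminus iota A).
Proof. by move=> S b b_basis; exact: free_uminus. Qed.

(** The Chevalley involution maps a basis of [V] to one of [V']. *)
Lemma is_free_uplus : is_free_lie (Vplus iota A) (uplus iota A).
Proof.
move=> S b [b_in b_inj b_sur]; have [wl wb] := chevalley_morph iota A.
pose w := @chevalley R K iota I A.
have wlc c : lincomb (w \o b) c = w (lincomb b c).
  by rewrite /lincomb /w (lmap_sum wl); apply: eq_bigr => s _; rewrite (lmapZ wl).
have wb_basis : is_basis (Vminus iota A) (w \o b).
  split=> [c _|c d _ _|v Vv].
  - by rewrite wlc; apply: chevalley_Vplus; exact: b_in.
  - rewrite !wlc => /(congr1 w); rewrite /w !chevalleyK => E; by apply: b_inj; rewrite ?in_setT.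
  - have [c _ cE] := b_sur _ (chevalley_Vminus Vv).
    by exists c => //; rewrite wlc cE /w chevalleyK.
have [phi [[phi_in phi_inj phi_sur] [phil phib] phis]] := is_free_uminus wb_basis.
exists (w \o phi); split.
- split=> [a La|a a' La La' /(congr1 w)|x ux].
  + by apply: chevalley_uminus; exact: phi_in.
  + rewrite /= /w !chevalleyK; exact: (phi_inj _ _ La La').
  + have [a La aE] := phi_sur _ (chevalley_uplus ux).
    by exists a => //; rewrite /= aE; exact: chevalleyK.
- split=> [k x y Lx Ly|x y Lx Ly] /=; first by rewrite phil // wl.
  by rewrite phib // wb.
- by move=> s; rewrite /= phis /= /w chevalleyK.
Qed.

End FreeParts.

(** * The Kac-Moody group acts by graded automorphisms *)

Section GradedMorphisms.
Context (K : fieldType) (K_char0 : forall n, (n.+1%:R : K) != 0) (S : choiceType).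
Local Notation T := (free_alg K S).

Definition graded_morph (p : T -> T) : Prop :=
  [/\ linear_map p, p 1 = 1, forall x y, p (x * y) = p x * p y,
    forall n a, homogeneous n a -> homogeneous n (p a)
  & forall a, freeLie K S a -> freeLie K S (p a)].

Lemma graded_morph_comp p q : graded_morph p -> graded_morph q -> graded_morph (p \o q).
Proof.
move=> [pl p1 pM ph pL] [ql q1 qM qh qL]; split=> /=.
- exact: linear_map_comp.
- by rewrite q1.
- by move=> x y; apply: etrans (congr1 p (qM x y)) (pM _ _).
- by move=> n a /qh /ph.
- by move=> a /qL /pL.
Qed.

Definition graded_derivation (D : T -> T) : Prop :=
  [/\ derivation D, forall s, homogeneous 1 (D (fvar K s))
    & forall s, freeLie K S (D (fvar K s))].

Lemma graded_derivationN (D : T -> T) : graded_derivation D -> graded_derivation (fun a => - D a).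
Proof.
move=> [[Dl DM] D1 DL]; have [fL_sub _] := lie_subalgebra_closure (range (@fvar K S)).
split; first split; first exact: linear_mapN.
- by move=> a c; apply: etrans (congr1 -%R (DM a c)) _; exact: opp_leibniz.
- by move=> s; exact: (subN (@subspace_homogeneous K S 1) (D1 s)).
- by move=> s; exact: (subN fL_sub (DL s)).
Qed.

(** Nilpotency propagates from letters to words by the Leibniz rule. *)
Lemma derivation_nilpotent (D : T -> T) : derivation D ->
  (forall s, exists n, iter n D (fvar K s) = 0) -> locally_nilpotent D.
Proof.
move=> dD Ds; have [Dl DM] := dD.
apply: free_alg_ind; first exact: nil_subspace.
  by exists 1%N; exact: derivation1.
move=> s a [n na]; have [m ms] := Ds s; exists (m + n)%N.
exact: (@iter_leibniz_nil K K_char0 T T T (fun x y : T => x * y) (@linear_mull K S)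
  (@linear_mulr K S) D D D Dl Dl Dl DM).
Qed.

Lemma exp_graded_morph (D : T -> T) : graded_derivation D -> locally_nilpotent D ->
  graded_morph (lnexp D).
Proof.
move=> [dD D1 DL] D_nil; have [Dl DM] := dD; split.
- exact: lnexp_lin.
- rewrite (lnexpE Dl (n := 1)) /=; last exact: derivation1.
  by rewrite big_ord1 /divpow /= fact0 invr1 scale1r.
- move=> x y.
  exact: (@lnexp_leibniz K K_char0 T T T (fun x y : T => x * y) (@linear_mull K S)
    (@linear_mulr K S) D D D Dl Dl Dl DM).
- move=> n; apply: (lnexp_preserve Dl D_nil); first exact: subspace_homogeneous.
  by move=> w; exact: derivation_homogeneous.
- have [fL_sub _] := lie_subalgebra_closure (range (@fvar K S)).
  apply: (lnexp_preserve Dl D_nil fL_sub) => w; exact: derivation_freeLie.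
Qed.

End GradedMorphisms.

Section KacMoodyAction.
Context (R : realType) (K : fieldType) (iota : {rmorphism K -> R[i]}).
Context (I : countType) (A : I -> I -> K).
Context (B1 : forall i j, A i j = A j i).
Context (B2 : forall i j, i <> j -> iota (A i j) <= 0).
Context (B3 : forall i j, 0 < iota (A i i) ->
          exists m : int, 2 * A i j / A i i = m%:~R).
Context (S : choiceType) (b : S -> borcherds iota A).
Context (b_basis : is_basis (Vminus iota A) b).
Local Notation T := (free_alg K S).
Local Notation D := (pi_rep b).

Lemma pi_rep_graded x : graded_derivation (D x).
Proof.
split; first exact: pi_rep_derivation.
- by move=> s; rewrite pi_rep_fvar; exact: tensor1_homogeneous.
- by move=> s; rewrite pi_rep_fvar; exact: tensor1_freeLie.
Qed.

(** On letters, the derivation is the adjoint action on [V']. *)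
Lemma pi_rep_nilpotent alpha x : real_root iota A alpha -> gJ_root_space iota A alpha x ->
  locally_nilpotent (D x).
Proof.
move=> rr [gx dx]; have x_nil := real_root_nilpotent B1 B2 B3 rr dx.
apply: (derivation_nilpotent (subfield_char0 iota) (pi_rep_derivation b x)) => s.
have lx := levi_gJ gx; have [n nE] := x_nil (b s); exists n.
rewrite -(tensor1_b b_basis); suff [_ ->] : Vminus iota A (iter n (lie x) (b s)) /\
    iter n (D x) (tensor1 b (b s)) = tensor1 b (iter n (lie x) (b s)).
  by rewrite nE tensor1_0.
elim: n {nE} => [|n [Vn En]] /=; first by split=> //; exact: (basis_in b_basis).
by split; [exact: Vminus_stable | rewrite En pi_rep_tensor1].
Qed.

(** The inverse of [exp (pi x)] is [exp (- pi x)], again the exponential of a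
    graded derivation. *)
Lemma KM_group_graded g : KM_group b g ->
  exists g', [/\ KM_group b g', cancel g g', cancel g' g, graded_morph g & graded_morph g'].
Proof.
elim=> {g}.
- move=> alpha x rr rx; have x_nil := pi_rep_nilpotent rr rx.
  have c0 := subfield_char0 iota; have Dl := pi_rep_lin b x; have gD := pi_rep_graded x.
  have KMx : KM_group b (lnexp (D x)) by exact: KM_exp rr rx.
  have xK := lnexpK c0 Dl x_nil; have Kx := lnexpNK c0 Dl x_nil.
  exists (lnexp (fun a => - D x a)); split=> //; first exact: KM_inv KMx xK Kx.
    exact: exp_graded_morph.
  by apply: exp_graded_morph => //; [exact: graded_derivationN | exact: locally_nilpotentN].
- by exists id; split=> //; exact: KM_id.
- move=> g1 g2 _ [h1 [K1 gK1 hK1 gm1 hm1]] _ [h2 [K2 gK2 hK2 gm2 hm2]].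
  exists (h2 \o h1); split.
  + exact: KM_comp.
  + exact: can_comp.
  + exact: can_comp.
  + exact: graded_morph_comp.
  + exact: graded_morph_comp.
- move=> g g' Kg [h [Kh gK hK gm hm]] gK' g'K.
  have -> : g' = h by apply/funext => a; rewrite -{1}(hK a) gK'.
  by exists g; split.
Qed.

Lemma pi_rep_representation : pi_is_representation b.
Proof.
split=> [x gx|x v gx Vv|k x y a gx gy|x y a gx gy].
- exact: (pi_rep_derivation b x).
- have lx := levi_gJ gx; split; [exact: Vminus_stable | exact: pi_rep_tensor1].
- by apply: pi_rep_linear => //; exact: levi_gJ.
- by apply: pi_rep_lie => //; exact: levi_gJ.
Qed.

End KacMoodyAction.

(** * Formal power series over a non-commutative algebra *)

Section PowerSeries.
Context (K : fieldType) (B : algType K).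

Definition fps := nat -> B.
Implicit Types u v w : fps.

HB.instance Definition _ := gen_eqMixin fps.
HB.instance Definition _ := gen_choiceMixin fps.

Definition fps_add u v : fps := fun n => u n + v n.
Definition fps_opp u : fps := fun n => - u n.
Definition fps_mul u v : fps := fun n => \sum_(i < n.+1) u i * v (n - i)%N.
Definition fps_one : fps := fun n => if n == 0%N then 1 else 0.
Definition fps_scale (k : K) u : fps := fun n => k *: u n.

Let fps_addA : associative fps_add.
Proof. by move=> u v w; apply/funext => n; rewrite /fps_add addrA. Qed.
Let fps_addC : commutative fps_add.
Proof. by move=> u v; apply/funext => n; rewrite /fps_add addrC. Qed.
Let fps_add0 : left_id (fun=> 0 : B) fps_add.
Proof. by move=> u; apply/funext => n; rewrite /fps_add add0r. Qed.
Let fps_addN : left_inverse (fun=> 0 : B) fps_opp fps_add.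
Proof. by move=> u; apply/funext => n; rewrite /fps_add addNr. Qed.
HB.instance Definition _ := GRing.isZmodule.Build fps fps_addA fps_addC fps_add0 fps_addN.

(* Coefficients of products are those of products of polynomials. *)
Let fps_mulE u v (N n : nat) : (n < N)%N ->
  fps_mul u v n = ((\poly_(i < N) u i) * (\poly_(i < N) v i))`_n.
Proof.
move=> nN; rewrite coefM; apply: eq_bigr => i _.
by rewrite !coef_poly !(leq_ltn_trans _ nN) ?leq_subr // -ltnS.
Qed.

Let fps_mulA : associative fps_mul.
Proof.
move=> u v w; apply/funext => n.
pose P z := \poly_(i < n.+1) (z : fps) i.
transitivity ((P u * (P v * P w))`_n).
  rewrite coefM; apply: eq_bigr => i _.
  rewrite (fps_mulE _ _ (N := n.+1)) ?ltnS ?leq_subr //; congr (_ * _).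
  by rewrite coef_poly ltn_ord.
rewrite mulrA coefM; apply: eq_bigr => i _.
rewrite (fps_mulE _ _ (N := n.+1)) //; congr (_ * _).
by rewrite coef_poly ltnS leq_subr.
Qed.
Let fps_mul1 : left_id fps_one fps_mul.
Proof.
move=> u; apply/funext => n; rewrite /fps_mul big_ord_recl /= mul1r subn0 big1 ?addr0 //.
by move=> i _; rewrite mul0r.
Qed.
Let fps_mulr1 : right_id fps_one fps_mul.
Proof.
move=> u; apply/funext => n; rewrite /fps_mul big_ord_recr /= subnn mulr1 big1 ?add0r //.
by move=> i _; rewrite /fps_one subn_eq0 leqNgt ltn_ord /= mulr0.
Qed.
Let fps_mulDl : left_distributive fps_mul +%R.
Proof.
move=> u v w; apply/funext => n; rewrite [RHS]/GRing.add /= /fps_add -big_split /=.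
by apply: eq_bigr => i _; rewrite -mulrDl.
Qed.
Let fps_mulDr : right_distributive fps_mul +%R.
Proof.
move=> u v w; apply/funext => n; rewrite [RHS]/GRing.add /= /fps_add -big_split /=.
by apply: eq_bigr => i _; rewrite -mulrDr.
Qed.
Let fps_one_neq0 : fps_one != 0.
Proof. by apply/eqP => /(congr1 (fun u : fps => u 0%N)) /eqP; rewrite oner_eq0. Qed.
HB.instance Definition _ := GRing.Zmodule_isNzRing.Build fps
  fps_mulA fps_mul1 fps_mulr1 fps_mulDl fps_mulDr fps_one_neq0.

Let fps_scaleA c d u : fps_scale c (fps_scale d u) = fps_scale (c * d) u.
Proof. by apply/funext => n; rewrite /fps_scale scalerA. Qed.
Let fps_scale1 : left_id 1 fps_scale.
Proof. by move=> u; apply/funext => n; rewrite /fps_scale scale1r. Qed.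
Let fps_scaleDr : right_distributive fps_scale +%R.
Proof. by move=> c u v; apply/funext => n; rewrite /fps_scale scalerDr. Qed.
Let fps_scaleDl u : {morph fps_scale^~ u : c d / c + d}.
Proof. by move=> c d; apply/funext => n; rewrite /fps_scale scalerDl. Qed.
HB.instance Definition _ := GRing.Zmodule_isLmodule.Build K fps
  fps_scaleA fps_scale1 fps_scaleDr fps_scaleDl.

Let fps_scaleAl (c : K) u v : c *: (u * v) = (c *: u) * v.
Proof.
apply/funext => n; rewrite [LHS]scaler_sumr.
by apply: eq_bigr => i _; rewrite scalerAl.
Qed.
HB.instance Definition _ := GRing.Lmodule_isLalgebra.Build K fps fps_scaleAl.
Let fps_scaleAr (c : K) u v : c *: (u * v) = u * (c *: v).
Proof.
apply/funext => n; rewrite [LHS]scaler_sumr.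
by apply: eq_bigr => i _; rewrite scalerAr.
Qed.
HB.instance Definition _ := GRing.Lalgebra_isAlgebra.Build K fps fps_scaleAr.

Lemma fpsD u v n : (u + v) n = u n + v n. Proof. by []. Qed.
Lemma fpsN u n : (- u) n = - u n. Proof. by []. Qed.
Lemma fpsB u v n : (u - v) n = u n - v n. Proof. by []. Qed.
Lemma fpsZ (k : K) u n : (k *: u) n = k *: u n. Proof. by []. Qed.
Lemma fps1 n : (1 : fps) n = (n == 0%N)%:R.
Proof. by rewrite [LHS]/(fps_one n) /fps_one; case: eqP. Qed.
Lemma fpsM u v n : (u * v) n = \sum_(i < n.+1) u i * v (n - i)%N.
Proof. by []. Qed.
Lemma fps_sum (I : Type) (r : seq I) (P : pred I) (F : I -> fps) n :
  (\sum_(i <- r | P i) F i) n = \sum_(i <- r | P i) F i n.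
Proof. by elim/big_rec2: _ => //= i x y _ <-. Qed.

(** ** Truncation *)

Definition vanish (N : nat) u := forall n, (n < N)%N -> u n = 0.

Lemma vanish_le M N u : (M <= N)%N -> vanish N u -> vanish M u.
Proof. by move=> MN uN n nM; apply: uN; exact: leq_trans nM MN. Qed.
Lemma vanishD N u v : vanish N u -> vanish N v -> vanish N (u + v).
Proof. by move=> uN vN n nN; rewrite fpsD uN // vN // addr0. Qed.
Lemma vanishZ N (k : K) u : vanish N u -> vanish N (k *: u).
Proof. by move=> uN n nN; rewrite fpsZ uN // scaler0. Qed.
Lemma vanishN N u : vanish N u -> vanish N (- u).
Proof. by move=> uN n nN; rewrite fpsN uN // oppr0. Qed.
Lemma vanish_sum N (I : Type) (r : seq I) (P : pred I) (F : I -> fps) :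
  (forall i, P i -> vanish N (F i)) -> vanish N (\sum_(i <- r | P i) F i).
Proof. by move=> FN n nN; rewrite fps_sum big1 // => i Pi; exact: FN. Qed.

Lemma vanishM M N u v : vanish M u -> vanish N v -> vanish (M + N) (u * v).
Proof.
move=> uM vN n nMN; rewrite fpsM big1 // => i _.
have [iM|Mi] := ltnP i M; first by rewrite uM // mul0r.
by rewrite vN ?mulr0 //; have := ltn_ord i; lia.
Qed.

Lemma vanishMl N u v : vanish N u -> vanish N (u * v).
Proof. by move=> uN; rewrite -[N]addn0; exact: vanishM. Qed.
Lemma vanishMr N u v : vanish N v -> vanish N (u * v).
Proof. by move=> vN; rewrite -[N]add0n; exact: vanishM. Qed.

Lemma vanishX u n : vanish 1 u -> vanish n (u ^+ n).
Proof. by move=> u1; elim: n => // n IHn; rewrite exprS -add1n; exact: vanishM. Qed.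

Lemma vanish1 u : u 0%N = 0 -> vanish 1 u.
Proof. by move=> u0 [|n]. Qed.

Definition eqm (N : nat) u v := vanish N (u - v).

Lemma eqmP N u v : eqm N u v <-> forall n, (n < N)%N -> u n = v n.
Proof.
split=> uv n nN; last by rewrite fpsB uv // subrr.
by apply/eqP; rewrite -subr_eq0 -fpsB uv.
Qed.
Lemma eqm_refl N u : eqm N u u. Proof. by apply/eqmP. Qed.
Lemma eqm_sym N u v : eqm N u v -> eqm N v u.
Proof. by move=> /eqmP uv; apply/eqmP => n nN; rewrite uv. Qed.
Lemma eqm_trans N v u w : eqm N u v -> eqm N v w -> eqm N u w.
Proof. by move=> /eqmP uv /eqmP vw; apply/eqmP => n nN; rewrite uv // vw. Qed.
Lemma eqm_le M N u v : (M <= N)%N -> eqm N u v -> eqm M u v.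
Proof. exact: vanish_le. Qed.
Lemma eqmD N u u' v v' : eqm N u u' -> eqm N v v' -> eqm N (u + v) (u' + v').
Proof. by rewrite /eqm opprD addrACA; exact: vanishD. Qed.
Lemma eqmZ N (k : K) u v : eqm N u v -> eqm N (k *: u) (k *: v).
Proof. by rewrite /eqm -scalerBr; exact: vanishZ. Qed.
Lemma eqmN N u v : eqm N u v -> eqm N (- u) (- v).
Proof. by rewrite /eqm -opprD; exact: vanishN. Qed.
Lemma eqm_sum N (I : Type) (r : seq I) (P : pred I) (F G : I -> fps) :
  (forall i, P i -> eqm N (F i) (G i)) ->
  eqm N (\sum_(i <- r | P i) F i) (\sum_(i <- r | P i) G i).
Proof. by rewrite /eqm -sumrB; exact: vanish_sum. Qed.

Lemma mulrBB u u' v v' : u * v - u' * v' = (u - u') * v + u' * (v - v').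
Proof. by rewrite mulrBl mulrBr addrA subrK. Qed.

Lemma eqmM N u u' v v' : eqm N u u' -> eqm N v v' -> eqm N (u * v) (u' * v').
Proof.
by move=> uu' vv'; rewrite /eqm mulrBB; apply: vanishD; [exact: vanishMl | exact: vanishMr].
Qed.

(** Products of series without constant term gain one degree of precision. *)
Lemma eqmM1 N u u' v v' : vanish 1 v -> vanish 1 u' -> eqm N u u' -> eqm N v v' ->
  eqm N.+1 (u * v) (u' * v').
Proof.
move=> v1 u1 uu' vv'; rewrite /eqm mulrBB; apply: vanishD.
  by rewrite -addn1; exact: vanishM.
by rewrite -add1n; exact: vanishM.
Qed.

Lemma eqmX N u v n : eqm N u v -> eqm N (u ^+ n) (v ^+ n).
Proof.
by move=> uv; elim: n => [|n IHn]; [exact: eqm_refl | rewrite !exprS; exact: eqmM].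
Qed.

Lemma eqm_eq u v : (forall N, eqm N u v) -> u = v.
Proof. by move=> uv; apply/funext => n; have /eqmP := uv n.+1; exact. Qed.

(** ** Infinite sums of series of increasing order *)

Definition ssum (c : nat -> fps) : fps := fun n => \sum_(k < n.+1) c k n.

Lemma ssum_trunc N (c : nat -> fps) : (forall k, vanish k (c k)) ->
  eqm N (ssum c) (\sum_(k < N) c k).
Proof.
move=> c_van; apply/eqmP => n nN; rewrite fps_sum /ssum.
rewrite -!(big_mkord xpredT (fun k => c k n)) [RHS](big_cat_nat (n := n.+1)) //=.
rewrite [X in _ + X]big_nat_cond [X in _ + X]big1 ?addr0 //.
by move=> k /andP[/andP[nk _] _]; exact: c_van.
Qed.

Lemma ssumM (a c : nat -> fps) : (forall k, vanish k (a k)) -> (forall k, vanish k (c k)) ->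
  ssum a * ssum c = ssum (fun k => \sum_(i < k.+1) a i * c (k - i)%N).
Proof.
move=> a_van c_van; apply: eqm_eq => N.
have s_van k : vanish k (\sum_(i < k.+1) a i * c (k - i)%N).
  apply: vanish_sum => i _; have ik : (i <= k)%N by rewrite -ltnS.
  by have := vanishM (a_van i) (c_van (k - i)%N); rewrite subnKC.
apply: (eqm_trans (eqmM (ssum_trunc (N := N) a_van) (ssum_trunc (N := N) c_van))).
apply: eqm_sym; apply: (eqm_trans (ssum_trunc (N := N) s_van)).
rewrite mulr_suml; under [X in eqm _ _ X]eq_bigr => i _ do rewrite mulr_sumr.
pose f i j := if (i + j < N)%N then a i * c j else 0.
rewrite (eq_bigr (fun k : 'I_N => \sum_(i < k.+1) f i (k - i)%N)); last first.
  move=> k _; apply: eq_bigr => i _.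
  have ik : (i <= k)%N by rewrite -ltnS.
  by rewrite /f subnKC // ltn_ord.
rewrite triangle_sum; last by move=> i j Nij; rewrite /f ltnNge Nij.
apply: eqm_sum => i _; apply: eqm_sum => j _; rewrite /f.
case: ltnP => Nij; first exact: eqm_refl.
by apply: eqm_sym; rewrite /eqm subr0; apply: vanish_le Nij _; exact: vanishM.
Qed.

Lemma eq_ssum (a c : nat -> fps) : a =1 c -> ssum a = ssum c.
Proof. by move=> ac; apply/funext => n; apply: eq_bigr => k _; rewrite ac. Qed.

(** Operators for which the coefficients of the image below [N] depend on the
    coefficients below [N] only: they commute with infinite sums. *)
Definition nonexpansive (Y : fps -> fps) := forall N u, vanish N u -> vanish N (Y u).

Lemma nonexpansive_ssum (Y : fps -> fps) c : linear_map Y -> nonexpansive Y ->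
  (forall k, vanish k (c k)) -> Y (ssum c) = ssum (Y \o c).
Proof.
move=> Yl Yv c_van; apply: eqm_eq => N; apply: eqm_sym.
have Y_van k : vanish k ((Y \o c) k) by exact: Yv.
apply: (eqm_trans (ssum_trunc (N := N) Y_van)).
rewrite -(lmap_sum Yl) /eqm -(lmapB Yl); apply: Yv; apply: eqm_sym.
exact: ssum_trunc.
Qed.

(** ** The exponential *)

Section Exponential.
Context (K_char0 : forall n, (n.+1%:R : K) != 0).

Definition fexp u : fps := ssum (fun k => (k`!%:R : K)^-1 *: u ^+ k).

Lemma exp_term_vanish u k : vanish 1 u -> vanish k ((k`!%:R : K)^-1 *: u ^+ k).
Proof. by move=> u1; apply: vanishZ; exact: vanishX. Qed.

Lemma fexp_0 u : fexp u 0%N = 1.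
Proof. by rewrite /fexp /ssum big_ord1 fact0 invr1 scale1r. Qed.

Definition commute_op u (Y : fps -> fps) : fps -> fps := fun x => Y (u * x) - u * Y x.

(** [exp(-u) Y exp(u)] is the exponential of the commutator with [u], applied to
    [Y]: left and right multiplication by [u] commute, so that this is an
    instance of the product rule for the divided powers of their difference. *)
Lemma fexp_conj u (Y : fps -> fps) : vanish 1 u -> linear_map Y -> nonexpansive Y ->
  fexp (- u) * Y (fexp u) = ssum (fun k => (k`!%:R : K)^-1 *: iter k (commute_op u) Y 1).
Proof.
move=> u1 Yl Yv; have uN1 := vanishN u1.
rewrite /fexp (nonexpansive_ssum Yl Yv) => [|k]; last exact: exp_term_vanish.
rewrite ssumM => [|k|k]; last 2 first.
- exact: exp_term_vanish.
- by apply: Yv; exact: exp_term_vanish.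
apply: eq_ssum => k; pose YE := Endo Yl.
have mull_lin v : linear_map ( *%R v : fps -> fps).
  by move=> c x y; rewrite mulrDr -scalerAr.
have mulr_lin v : linear_map (fun x : fps => x * v).
  by move=> c x y; rewrite mulrDl -scalerAl.
pose m (x : fps) (Z : endo fps) : endo fps := endo_comp (Endo (mull_lin x)) Z.
pose D1 (x : fps) := - u * x.
pose D2 (Z : endo fps) : endo fps := endo_comp Z (Endo (mull_lin u)).
pose D3 (Z : endo fps) : endo fps := D2 Z - endo_comp (Endo (mull_lin u)) Z.
have m_linl Z : linear_map (m^~ Z).
  by move=> c x y; apply: endoP => z; exact: mulr_lin.
have m_linr x : linear_map (m x).
  by move=> c Z Z'; apply: endoP => z; exact: mull_lin.
have D1_lin : linear_map D1 by exact: mull_lin.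
have D2_lin : linear_map D2 by move=> c Z Z'; apply: endoP.
have D3_lin : linear_map D3.
  apply: linear_mapD => //; apply: linear_mapN => c Z Z'; apply: endoP => z.
  exact: mull_lin.
have D3_m x Z : D3 (m x Z) = m (D1 x) Z + m x (D2 Z).
  apply: endoP => z; rewrite /D3 /m /D1 /D2 /=.
  by rewrite addrC mulrA mulNr mulNr.
have iterD3 n : (iter n D3 YE : fps -> fps) = iter n (commute_op u) Y.
  by elim: n => //= n IHn; rewrite /D3 /commute_op -IHn.
have iterD1 n : iter n D1 1 = (- u) ^+ n.
  by elim: n => //= n ->; rewrite exprS.
have iterD2 n z : iter n D2 YE z = Y (u ^+ n * z).
  elim: n z => [|n IHn] z /=; first by rewrite expr0 mul1r.
  by rewrite IHn mulrA -exprSr.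
have := divpow_leibniz K_char0 m_linl m_linr D1_lin D2_lin D3_lin D3_m k 1 YE.
have -> : m 1 YE = YE by apply: endoP => z /=; rewrite mul1r.
move=> /(congr1 (fun Z : endo fps => Z 1)).
rewrite /divpow endo_scaleE -[X in _ *: X]/((iter k D3 YE : fps -> fps) 1) iterD3 => ->.
have sumE (F : 'I_k.+1 -> endo fps) z : (\sum_i F i) z = \sum_i F i z.
  by elim/big_rec2: _ => //= i x y _ <-.
rewrite sumE; apply: eq_bigr => i _.
by rewrite /= iterD1 iterD2 mulr1 (lmapZ Yl).
Qed.

(** Bracketing on the right: this is [- ad u]. *)
Definition adr u y : fps := y * u - u * y.

Lemma iter_commute_op_mul u y k x :
  iter k (commute_op u) (fun x => y * x) x = iter k (adr u) y * x.
Proof.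
elim: k x => //= k IHk x; rewrite /commute_op !IHk.
by rewrite /adr mulrBl !mulrA.
Qed.

Lemma fexp_conj_mul u y : vanish 1 u ->
  fexp (- u) * y * fexp u = ssum (fun k => (k`!%:R : K)^-1 *: iter k (adr u) y).
Proof.
move=> u1; rewrite -mulrA.
have Yl : linear_map ( *%R y : fps -> fps) by move=> c x z; rewrite mulrDr -scalerAr.
have Yv : nonexpansive ( *%R y) by move=> N v vN; exact: vanishMr.
rewrite (fexp_conj u1 Yl Yv); apply: eq_ssum => k.
by rewrite iter_commute_op_mul mulr1.
Qed.

Lemma fexpNK u : vanish 1 u -> fexp (- u) * fexp u = 1.
Proof.
move=> u1; rewrite -[fexp (- u)]mulr1 fexp_conj_mul //; apply/funext => n.
have ad0 k : iter k.+1 (adr u) 1 = 0.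
  elim: k => [|k IHk]; first by rewrite /= /adr mul1r mulr1 subrr.
  by rewrite iterS IHk /adr mul0r mulr0 subrr.
rewrite /ssum big_ord_recl fact0 invr1 scale1r big1 ?addr0 // => i _.
by rewrite lift0 ad0 scaler0.
Qed.

Lemma fexpKN u : vanish 1 u -> fexp u * fexp (- u) = 1.
Proof. by move=> /vanishN/fexpNK; rewrite opprK. Qed.

(** The degree derivation [t d/dt]. *)
Definition theta u : fps := fun n => (n%:R : K) *: u n.

Lemma theta_lin : linear_map theta.
Proof.
move=> c u v; apply/funext => n.
by rewrite /theta !fpsD !fpsZ scalerDr !scalerA mulrC.
Qed.

Lemma theta_vanish : nonexpansive theta.
Proof. by move=> N u uN n nN; rewrite /theta uN // scaler0. Qed.

Lemma thetaM u v : theta (u * v) = theta u * v + u * theta v.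
Proof.
apply/funext => n; rewrite fpsD /theta !fpsM scaler_sumr -big_split.
have in_ (i : 'I_n.+1) : (i <= n)%N by rewrite -ltnS.
by apply: eq_bigr => i _ /=; rewrite -scalerAl -scalerAr -scalerDl -natrD subnKC.
Qed.

Lemma theta1 : theta 1 = 0.
Proof. by apply/funext => -[|n]; rewrite /theta fps1 ?scale0r ?scaler0. Qed.

(** Since [theta] is a derivation, its commutator with the multiplication by [u]
    is the multiplication by [theta u], and the next ones are iterated brackets. *)
Lemma fexp_theta u : vanish 1 u -> fexp (- u) * theta (fexp u) =
  ssum (fun k => if k is k'.+1 then (k`!%:R : K)^-1 *: iter k' (adr u) (theta u) else 0).
Proof.
move=> u1; rewrite (fexp_conj u1 theta_lin theta_vanish); apply: eq_ssum => -[|k].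
  by rewrite /= theta1 scaler0.
rewrite iterSr; congr (_ *: _).
have -> : commute_op u theta = fun x => theta u * x.
  by apply/funext => x; rewrite /commute_op thetaM addrK.
by rewrite iter_commute_op_mul mulr1.
Qed.

End Exponential.
End PowerSeries.

(** ** The logarithm *)

Section TruncatedSeries.
Context (K : fieldType) (K_char0 : forall n, (n.+1%:R : K) != 0).

Definition log_coef (k : nat) : K := if k == 0%N then 0 else (-1) ^+ k.+1 / k%:R.
Definition exp_poly N : {poly K} := \poly_(k < N) (k`!%:R)^-1.
Definition log_poly N : {poly K} := \poly_(k < N) log_coef k.

(** The composite [G] satisfies [(1 + X) G' = G] up to truncation, with
    constant term [1], which determines its coefficients. *)
Lemma exp_log_poly N i : (i < N)%N -> (exp_poly N \Po log_poly N)`_i = (1 + 'X)`_i.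
Proof.
case: N => // M; set E := exp_poly M.+1; set L := log_poly M.+1; set G := E \Po L.
rewrite ltnS => iM.
have E_deriv : E = E^`() + ((M`!%:R)^-1) *: 'X^M.
  apply/polyP => k; rewrite coefD coefZ coefXn coef_deriv !coef_poly ltnS.
  have [kM|Mk|->] := ltngtP k M; rewrite /= ?mulr0 ?addr0.
  - by rewrite ltnS kM -[RHS]mulr_natl invfact_S.
  - by rewrite ltnS ltnNge (ltnW Mk) mul0rn.
  - by rewrite ltnn mul0rn add0r mulr1.
have L_deriv : (1 + 'X) * L^`() = 1 - (-1) ^+ M *: 'X^M.
  have L'E k : L^`()`_k = if (k < M)%N then (-1) ^+ k else 0.
    rewrite coef_deriv coef_poly ltnS; case: ifP => _; last by rewrite mul0rn.
    by rewrite /log_coef /= -[LHS]mulr_natr divfK // !exprS !mulN1r opprK.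
  apply/polyP => k; rewrite mulrDl mul1r coefD coefXM coefB coefZ coefXn coef1 !L'E.
  case: k => [|k] /=.
    by rewrite addr0; case: M {iM E L G E_deriv L'E} => [|M];
      rewrite ?expr0 ?mulr1 ?subrr ?mulr0 ?subr0.
  rewrite sub0r; have [kM|Mk|<-] := ltngtP k.+1 M; rewrite /= ?mulr0 ?oppr0.
  - by rewrite exprS mulN1r addNr.
  - by rewrite addr0.
  - by rewrite add0r mulr1 exprS mulN1r opprK.
have L0 : L`_0 = 0 by rewrite coef_poly.
have [L1 LE] : exists L1, L = 'X * L1.
  have /factor_theorem[L1 ->] : root L 0 by rewrite /root horner_coef0 L0.
  by exists L1; rewrite subr0 mulrC.
have G_ode k : (k < M)%N -> ((1 + 'X) * G^`())`_k = G`_k.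
  move=> kM; have GE : G = (E^`() \Po L) + ((M`!%:R)^-1) *: L ^+ M.
    by rewrite /G {1}E_deriv comp_polyD comp_polyZ comp_Xn_poly.
  rewrite deriv_comp mulrCA L_deriv mulrBr mulr1 [in RHS]GE coefB coefD LE exprMn.
  rewrite -scalerAr !coefZ coefMXn coefXnM kM !mulr0 subr0 addr0 -LE //.
have G_rec k : (k < M)%N -> k.+1%:R * G`_k.+1 = G`_k - k%:R * G`_k.
  move=> kM; rewrite -{1}(G_ode k kM) mulrDl mul1r coefD coefXM !coef_deriv.
  case: k kM => [|k] kM /=; first by rewrite addr0 mul0r subr0 mulr_natl.
  by rewrite !mulr_natl addrK.
have GE k : (k <= M)%N -> G`_k = (k < 2)%:R.
  elim: k => [|k IHk] kM.
    rewrite -horner_coef0 horner_comp horner_coef0 L0 horner_coef0 coef_poly /=.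
    by rewrite fact0 invr1.
  apply: (mulfI (K_char0 k)); rewrite (G_rec k kM) IHk ?(ltnW kM) //.
  by case: k {IHk kM} => [|[|k]];
    rewrite /= ?mulr0n ?mulr1n ?mul0r ?mul1r ?mulr0 ?mulr1 ?subr0 ?subrr.
rewrite GE // coefD coef1 coefX.
by case: i {iM} => [|[|i]]; rewrite /= ?addr0 ?add0r.
Qed.

End TruncatedSeries.

Section Logarithm.
Context (K : fieldType) (K_char0 : forall n, (n.+1%:R : K) != 0).
Context (B : algType K).
Local Notation fps := (fps B).
Implicit Types u v w g : fps.

Let ev u : {poly K} -> fps := horner_alg u.

Let ev_poly u N (c : nat -> K) : ev u (\poly_(i < N) c i) = \sum_(i < N) c i *: u ^+ i.
Proof.
rewrite poly_def /ev linear_sum; apply: eq_bigr => i _.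
by rewrite linearZ /= rmorphXn /= horner_algX mulr_algl.
Qed.

Let evE u (p : {poly K}) : ev u p = \sum_(i < size p) p`_i *: u ^+ i.
Proof. by rewrite -ev_poly coefK. Qed.

Let ev_comp u p q : ev u (p \Po q) = ev (ev u q) p.
Proof.
rewrite comp_polyE [RHS]evE /ev linear_sum; apply: eq_bigr => i _.
by rewrite linearZ /= rmorphXn mulr_algl.
Qed.

Let eqm_ev N u v p : eqm N u v -> eqm N (ev u p) (ev v p).
Proof. by move=> uv; rewrite !evE; apply: eqm_sum => i _; apply: eqmZ; exact: eqmX. Qed.

Let ev_eqm N u (p q : {poly K}) : vanish 1 u -> (forall i, (i < N)%N -> p`_i = q`_i) ->
  eqm N (ev u p) (ev u q).
Proof.
move=> u1 pq; rewrite /eqm -[_ - _]/(horner_alg u p - horner_alg u q) -rmorphB /= -/(ev u _).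
rewrite evE; apply: vanish_sum => i _; rewrite coefB.
have [iN|Ni] := ltnP i N; first by rewrite pq // subrr scale0r.
by apply: vanishZ; apply: vanish_le Ni _; exact: vanishX.
Qed.

Definition flog g : fps := ssum (fun k => log_coef K k *: (g - 1) ^+ k).

Let sub1_vanish g : g 0%N = 1 -> vanish 1 (g - 1).
Proof. by move=> g0; apply: vanish1; rewrite fpsB fps1 g0 subrr. Qed.

Lemma flog_vanish g : vanish 1 (flog g).
Proof. by apply: vanish1; rewrite /flog /ssum big_ord1 scale0r. Qed.

Lemma fexp_flog g : g 0%N = 1 -> fexp (flog g) = g.
Proof.
move=> g0; have w1 := sub1_vanish g0; apply: eqm_eq => N.
have logE : eqm N (flog g) (ev (g - 1) (log_poly K N)).
  by rewrite ev_poly; apply: ssum_trunc => k; apply: vanishZ; exact: vanishX.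
have expE : eqm N (fexp (flog g)) (ev (flog g) (exp_poly K N)).
  by rewrite ev_poly; apply: ssum_trunc => k; apply: exp_term_vanish; exact: flog_vanish.
apply: (eqm_trans expE); apply: (eqm_trans (eqm_ev (exp_poly K N) logE)).
rewrite -ev_comp; apply: (eqm_trans (ev_eqm w1 (exp_log_poly K_char0 (N := N)))).
by rewrite /ev rmorphD rmorph1 /= horner_algX addrC subrK; exact: eqm_refl.
Qed.

End Logarithm.

(** * The Magnus group *)

(** [P n] plays the part of the Lie elements of degree [n]. *)
Section MagnusGroup.
Context (K : fieldType) (K_char0 : forall n, (n.+1%:R : K) != 0).
Context (B : algType K) (P : nat -> set B).
Context (P_sub : forall n, subspace (P n)).
Context (P_lie : forall n m x y, P n x -> P m y -> P (n + m)%N (x * y - y * x)).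
Local Notation fps := (fps B).
Implicit Types u v w g : fps.

Definition lie_series : set fps := [set u | u 0%N = 0 /\ forall n, P n (u n)].

Lemma lie_series_vanish u : lie_series u -> vanish 1 u.
Proof. by case=> u0 _; exact: vanish1. Qed.

Lemma subspace_lie_series : subspace lie_series.
Proof.
split=> [|c u v [u0 Pu] [v0 Pv]]; first by split=> // n; exact: (sub0 (P_sub n)).
split; first by rewrite fpsD fpsZ u0 v0 scaler0 addr0.
by move=> n; rewrite fpsD fpsZ; case: (P_sub n) => _; apply.
Qed.

Lemma lie_series_ssum (c : nat -> fps) : (forall k, lie_series (c k)) -> lie_series (ssum c).
Proof.
move=> Lc; split; first by rewrite /ssum big_ord1; case: (Lc 0%N).
by move=> n; apply: (sub_sum (P_sub n)) => k _; case: (Lc k).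
Qed.

Lemma lie_series_adr u y : lie_series u -> lie_series y -> lie_series (adr u y).
Proof.
move=> [u0 Pu] [y0 Py]; split.
  by rewrite /adr fpsB !fpsM !big_ord1 u0 mul0r mulr0 subrr.
move=> n; rewrite /adr fpsB !fpsM.
rewrite [X in _ - X](reindex_inj rev_ord_inj) /= -sumrB.
apply: (sub_sum (P_sub n)) => i _; rewrite subSS subKn -1?ltnS //.
have in_ : (i <= n)%N by rewrite -ltnS.
by have := P_lie (Py i) (Pu (n - i)%N); rewrite subnKC.
Qed.

Lemma lie_series_theta u : lie_series u -> lie_series (theta u).
Proof.
move=> [u0 Pu]; split; first by rewrite /theta scale0r.
by move=> n; apply: (subZ (P_sub n)).
Qed.

Lemma lie_series_iter_adr k u y : lie_series u -> lie_series y ->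
  lie_series (iter k (adr u) y).
Proof. by move=> Lu Ly; elim: k => //= k; exact: lie_series_adr. Qed.

Lemma lie_series_conj u y : lie_series u -> lie_series y ->
  lie_series (fexp (- u) * y * fexp u).
Proof.
move=> Lu Ly; rewrite fexp_conj_mul //; last exact: lie_series_vanish.
apply: lie_series_ssum => k; apply: (subZ subspace_lie_series).
exact: lie_series_iter_adr.
Qed.

(** In degree [n] the logarithmic derivative [exp(-u) theta(exp(u))] is [n u_n]
    plus brackets of components of [u] of smaller degree; it is thus a Lie series
    exactly when [u] is one. *)
Lemma lie_series_theta_fexp u : lie_series u -> lie_series (fexp (- u) * theta (fexp u)).
Proof.
move=> Lu; rewrite fexp_theta //; last exact: lie_series_vanish.
apply: lie_series_ssum => -[|k]; first exact: (sub0 subspace_lie_series).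
apply: (subZ subspace_lie_series); apply: lie_series_iter_adr => //.
exact: lie_series_theta.
Qed.

Lemma lie_series_of_theta u : vanish 1 u ->
  lie_series (fexp (- u) * theta (fexp u)) -> lie_series u.
Proof.
move=> u1 [_ Py]; have u0 : u 0%N = 0 by exact: u1.
split=> // n; have [m] := ubnP n; elim: m n => // m IHm [|n] nm.
  by rewrite u0; exact: (sub0 (P_sub 0)).
have IH k : (k < n.+1)%N -> P k (u k) by move=> kn; apply: IHm; lia.
(* The truncation [u'] below degree [n + 1] is a Lie series by induction, and
   the brackets of [u] with [theta u] in degree [n + 1] only see [u']. *)
pose u' : fps := fun k => if (k < n.+1)%N then u k else 0.
have Lu' : lie_series u'.
  split; first by rewrite /u' ltn0Sn.
  by move=> k; rewrite /u'; case: ltnP => [/IH//|_]; exact: (sub0 (P_sub k)).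
have uu' : eqm n.+1 u u' by apply/eqmP => k kn; rewrite /u' kn.
have u'1 := lie_series_vanish Lu'.
have ad_eqm k : [/\ vanish 1 (iter k (adr u) (theta u)),
    vanish 1 (iter k (adr u') (theta u')),
    eqm n.+1 (iter k (adr u) (theta u)) (iter k (adr u') (theta u'))
  & (0 < k)%N -> eqm n.+2 (iter k (adr u) (theta u)) (iter k (adr u') (theta u'))].
  elim: k => [|k [v1 v2 e1 _]].
    split=> //; [exact: theta_vanish | exact: theta_vanish |].
    by move/eqmP: uu' => E; apply/eqmP => k kn; rewrite /= /theta E.
  have e2 : eqm n.+2 (iter k.+1 (adr u) (theta u)) (iter k.+1 (adr u') (theta u')).
    by apply: eqmD; [exact: eqmM1 | apply: eqmN; exact: eqmM1].
  split=> //; last exact: eqm_le e2.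
  - by apply: vanishD; [exact: vanishMl | apply: vanishN; exact: vanishMl].
  - by apply: vanishD; [exact: vanishMl | apply: vanishN; exact: vanishMl].
have Pn := Py n.+1; move: Pn; rewrite fexp_theta //; set c := (X in ssum X) => Pn.
have cE : ssum c n.+1 = theta u n.+1 + \sum_(i < n) c i.+2 n.+1.
  rewrite /ssum 2!big_ord_recl -[X in X + _ = _]/(0 : B) add0r; congr (_ + _).
  by rewrite /c /= factS fact0 muln1 invr1 scale1r.
have PS : P n.+1 (\sum_(i < n) c i.+2 n.+1).
  apply: (sub_sum (P_sub _)) => i _; rewrite /c fpsZ; apply: (subZ (P_sub _)).
  have [_ _ _ /(_ isT)/eqmP->//] := ad_eqm i.+1.
  by case: (lie_series_iter_adr i.+1 Lu' (lie_series_theta Lu')).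
have := subZ (P_sub n.+1) (n.+1%:R)^-1 (subB (P_sub _) Pn PS).
by rewrite cE addrK /theta scalerA mulVf ?scale1r.
Qed.

(** The logarithmic derivative may be computed with any left inverse [g']. *)
Lemma lie_series_flog g g' : g 0%N = 1 -> g' * g = 1 -> lie_series (g' * theta g) ->
  lie_series (flog g).
Proof.
move=> g0 g'g Lg; have w1 := flog_vanish g; have gE := fexp_flog K_char0 g0.
apply: lie_series_of_theta => //; rewrite gE.
suff -> : fexp (- flog g) = g' by [].
by rewrite -[LHS]mul1r -g'g -mulrA -{1}gE fexpKN // mulr1.
Qed.

Lemma flog_fexp_lie u : lie_series u -> lie_series (flog (fexp u)).
Proof.
move=> Lu; apply: (@lie_series_flog _ (fexp (- u))); first exact: fexp_0.
  by apply: fexpNK => //; exact: lie_series_vanish.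
exact: lie_series_theta_fexp.
Qed.

(** The logarithmic derivative of the product is the one of the second factor plus
    a conjugate of the one of the first. *)
Lemma fexp_mul u v : lie_series u -> lie_series v ->
  lie_series (flog (fexp u * fexp v)) /\
  fexp (flog (fexp u * fexp v)) = fexp u * fexp v.
Proof.
move=> Lu Lv; have u1 := lie_series_vanish Lu; have v1 := lie_series_vanish Lv.
have g0 : (fexp u * fexp v) 0%N = 1 by rewrite fpsM big_ord1 !fexp_0 mulr1.
split; last exact: fexp_flog.
apply: (@lie_series_flog _ (fexp (- v) * fexp (- u))) => //.
  by rewrite mulrA -(mulrA (fexp (- v))) fexpNK // mulr1 fexpNK.
rewrite thetaM mulrDr; apply: (subD subspace_lie_series).
  rewrite mulrA -(mulrA (fexp (- v))); apply: lie_series_conj => //.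
  exact: lie_series_theta_fexp.
rewrite mulrA -(mulrA (fexp (- v))) fexpNK // mulr1; exact: lie_series_theta_fexp.
Qed.

End MagnusGroup.

(** * Semi-direct products *)

Section SemidirectProduct.
Context (X Y : Type) (N : set X) (mulN : X -> X -> X) (e : X).
Context (H : set Y) (mulH : Y -> Y -> Y) (eH : Y) (act : Y -> X -> X).

Record semidirect := Semidirect { sd_pair :> X * Y; _ : N sd_pair.1 /\ H sd_pair.2 }.

HB.instance Definition _ := gen_eqMixin semidirect.
HB.instance Definition _ := gen_choiceMixin semidirect.

Lemma semidirect_inj (p q : semidirect) : sd_pair p = sd_pair q -> p = q.
Proof.
by case: p q => [p Pp] [q Pq] /= pq; rewrite pq in Pp *; rewrite (Prop_irrelevance Pp Pq).
Qed.

Lemma semidirect_group : is_group_on N mulN e -> is_group_on H mulH eH ->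
  (forall h n, H h -> N n -> N (act h n)) ->
  (forall h n n', H h -> N n -> N n' -> act h (mulN n n') = mulN (act h n) (act h n')) ->
  (forall h h' n, H h -> H h' -> N n -> act (mulH h h') n = act h (act h' n)) ->
  (forall n, N n -> act eH n = n) ->
  exists (G : groupType) (q : X -> Y -> G), is_semidirect_product N mulN H mulH act q.
Proof.
move=> [Ne NM NA N1 NV] [He HM HA H1 HV] aN aM aA a1.
(* An endomorphism of a group preserves the unit. *)
have actHe h : H h -> act h e = e.
  move=> Hh; have [n Nn [ne en]] := NV _ (aN _ _ Hh Ne).
  have := aM h e e Hh Ne Ne; rewrite (proj1 (N1 _ Ne)) => /(congr1 (mulN n)).
  by rewrite NA ?en ?(proj1 (N1 _ _)) //; exact: aN.
have inN n : {n' | N n -> N n' /\ mulN n n' = e /\ mulN n' n = e}.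
  apply: cid; have [Nn|Nn] := pselect (N n); last by exists n.
  by have [n' Nn' [nn' n'n]] := NV _ Nn; exists n'.
have inH h : {h' | H h -> H h' /\ mulH h h' = eH /\ mulH h' h = eH}.
  apply: cid; have [Hh|Hh] := pselect (H h); last by exists h.
  by have [h' Hh' [hh' h'h]] := HV _ Hh; exists h'.
have mul_in (p q : semidirect) :
    N (mulN p.1 (act p.2 q.1), mulH p.2 q.2).1 /\ H (mulN p.1 (act p.2 q.1), mulH p.2 q.2).2.
  case: p q => [[n h] /= [Nn Hh]] [[n' h'] /= [Nn' Hh']].
  by split; [apply: NM => //; exact: aN | exact: HM].
pose mul p q := Semidirect (mul_in p q).
pose one : semidirect := @Semidirect (e, eH) (conj Ne He).
have inv_in (p : semidirect) :
    let p' := (act (sval (inH p.2)) (sval (inN p.1)), sval (inH p.2)) in N p'.1 /\ H p'.2.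
  case: p => [[n h] /= [Nn Hh]].
  have [Nn' _] := svalP (inN n) Nn; have [Hh' _] := svalP (inH h) Hh.
  by split; [exact: aN | exact: Hh'].
pose inv p := Semidirect (inv_in p).
have mulA : associative mul.
  move=> [[n1 h1] [/= Nn1 Hh1]] [[n2 h2] [/= Nn2 Hh2]] [[n3 h3] [/= Nn3 Hh3]].
  apply: semidirect_inj => /=; rewrite aM ?aA ?HA ?NA //; try exact: aN.
  by apply: (aN) => //; exact: aN.
have mul1 : left_id one mul.
  move=> [[n h] [/= Nn Hh]]; apply: semidirect_inj => /=.
  by rewrite a1 // (proj1 (N1 _ Nn)) (proj1 (H1 _ Hh)).
have mulr1 : right_id one mul.
  move=> [[n h] [/= Nn Hh]]; apply: semidirect_inj => /=.
  by rewrite actHe // (proj2 (N1 _ Nn)) (proj2 (H1 _ Hh)).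
have mulV : left_inverse one inv mul.
  move=> [[n h] [/= Nn Hh]]; apply: semidirect_inj => /=.
  have [Nn' [nn' n'n]] := svalP (inN n) Nn; have [Hh' [hh' h'h]] := svalP (inH h) Hh.
  by rewrite -aM // n'n h'h actHe.
have mulrV : right_inverse one inv mul.
  move=> [[n h] [/= Nn Hh]]; apply: semidirect_inj => /=.
  have [Nn' [nn' n'n]] := svalP (inN n) Nn; have [Hh' [hh' h'h]] := svalP (inH h) Hh.
  by rewrite -aA // hh' a1 // nn'.
pose G : groupType := HB.pack semidirect (isGroup.Build semidirect mulA mul1 mulr1 mulV mulrV).
pose q (n : X) (h : Y) : G :=
  if pselect (N n /\ H h) is left nh then @Semidirect (n, h) nh else one.
have qE n h (nh : N n /\ H h) : q n h = @Semidirect (n, h) nh :> semidirect.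
  by rewrite /q; case: pselect => // nh'; exact: semidirect_inj.
exists G, q; split.
  split=> // [[n h] [n' h'] /set_mem [/= Nn Hh] /set_mem [/= Nn' Hh']|[[n h] nh] _].
    by rewrite (qE n h (conj Nn Hh)) (qE n' h' (conj Nn' Hh')) => /(congr1 sd_pair).
  by exists (n, h) => //; exact: qE.
move=> n1 h1 n2 h2 Nn1 Hh1 Nn2 Hh2.
have Nn : N (mulN n1 (act h1 n2)) by apply: NM => //; exact: aN.
have Hh : H (mulH h1 h2) by exact: HM.
split=> //; rewrite (qE n1 h1 (conj Nn1 Hh1)) (qE n2 h2 (conj Nn2 Hh2)).
by rewrite (qE _ _ (conj Nn Hh)); exact: semidirect_inj.
Qed.

End SemidirectProduct.

(** * The Magnus group of the free algebra *)

(** The free algebra with the two-sided algebra structure that power series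
    require of their coefficients. *)
Definition free_algebra (K : fieldType) (S : choiceType) := free_alg K S.

HB.instance Definition _ (K : fieldType) (S : choiceType) :=
  GRing.Lalgebra.on (free_algebra K S).
HB.instance Definition _ (K : fieldType) (S : choiceType) :=
  GRing.Lalgebra_isAlgebra.Build K (free_algebra K S)
    (fun c a b => esym (malg_scaleAr c a b)).

Section FreeMagnus.
Context (K : fieldType) (K_char0 : forall n, (n.+1%:R : K) != 0) (S : choiceType).
Local Notation T := (free_alg K S).
Local Notation fps := (fps (free_algebra K S)).
Implicit Types u v w : nat -> T.

Lemma spowE u k : spow u k = (u : fps) ^+ k.
Proof. by elim: k => [|k IHk] //; rewrite exprS -IHk. Qed.

Lemma sexpE u : sexp u = fexp (u : fps).
Proof. by apply/funext => n; apply: eq_bigr => k _; rewrite spowE. Qed.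

Lemma slogE u : slog u = flog (u : fps).
Proof.
apply/funext => n; rewrite /slog /flog /ssum big_ord_recl.
rewrite [X in _ = X + _](_ : _ = 0) ?add0r; last exact: scale0r.
rewrite big_add1 big_mkord; apply: eq_bigr => k _.
by rewrite spowE.
Qed.

Let P n : set (free_algebra K S) := [set a | freeLie K S a /\ homogeneous n a].

Let P_sub n : subspace (P n).
Proof.
have [fL_sub _] := lie_subalgebra_closure (range (@fvar K S)).
have h_sub := @subspace_homogeneous K S n.
split; first by split; [exact: sub0 fL_sub | exact: sub0 h_sub].
by move=> c x y [Lx hx] [Ly hy]; split; [case: fL_sub | case: h_sub] => _; apply.
Qed.

Let P_lie n m x y : P n x -> P m y -> P (n + m)%N (x * y - y * x).
Proof.
have [_ fL_lie] := lie_subalgebra_closure (range (@fvar K S)).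
by move=> [Lx hx] [Ly hy]; split; [exact: (fL_lie x y) | exact: homogeneous_lie].
Qed.

Lemma Lhat0 : Lhat K S (fun=> 0).
Proof. exact: sub0 (subspace_lie_series P_sub). Qed.

Lemma sexp0 : sexp (fun=> 0) = sone :> (nat -> T).
Proof.
rewrite sexpE; apply/funext => n; rewrite /fexp /ssum big_ord_recl fact0 invr1 scale1r.
rewrite big1 ?addr0 // => i _; rewrite lift0.
have -> : (0 : fps) ^+ i.+1 = 0 by rewrite expr0n.
by rewrite scaler0.
Qed.

Lemma LhatN u : Lhat K S u -> Lhat K S (fun n => - u n).
Proof. by move=> Lu; exact: (subN (subspace_lie_series P_sub) Lu). Qed.

Lemma magnus_sone : magnus K S sone.
Proof. by exists (fun=> 0); [exact: Lhat0 | exact: sexp0]. Qed.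

Lemma slog_sexp u : Lhat K S u -> Lhat K S (slog (sexp u)) /\ sexp (slog (sexp u)) = sexp u.
Proof.
move=> Lu; rewrite sexpE slogE sexpE; split.
  exact: (flog_fexp_lie K_char0 P_sub P_lie).
exact: (fexp_flog K_char0 (g := fexp (u : fps)) (fexp_0 _)).
Qed.

Lemma magnus_group : is_group_on (magnus K S) (@smul K S) sone.
Proof.
split=> [|_ _ [u Lu <-] [v Lv <-]|x y z _ _ _|x _|_ [u Lu <-]].
- exact: magnus_sone.
- have [Lw wE] := fexp_mul K_char0 P_sub P_lie Lu Lv.
  by exists (flog (fexp (u : fps) * fexp (v : fps))); rewrite ?sexpE.
- exact: (mulrA (x : fps) y z).
- by split; [exact: (mul1r (x : fps)) | exact: (mulr1 (x : fps))].
- have u1 := lie_series_vanish (P := P) Lu.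
  exists (sexp (fun n => - u n)); first by exists (fun n => - u n); [exact: LhatN | ].
  by rewrite !sexpE; split; [exact: (fexpKN K_char0 u1) | exact: (fexpNK K_char0 u1)].
Qed.

Section GradedAction.
Context (p : T -> T) (p_graded : graded_morph p).

Lemma Ad_smul u v : Ad p (smul u v) = smul (Ad p u) (Ad p v).
Proof.
have [pl _ pM _ _] := p_graded; apply/funext => n.
by apply: etrans (lmap_sum pl _ _ _) _; apply: eq_bigr => i _; exact: pM.
Qed.

Lemma Ad_sone : Ad p sone = sone.
Proof.
have [pl p1 _ _ _] := p_graded; apply/funext => -[|n]; first exact: p1.
exact: lmap0 pl.
Qed.

Lemma Ad_spow u k : Ad p (spow u k) = spow (Ad p u) k.
Proof.
by elim: k => [|k IHk]; [exact: Ad_sone | apply: etrans (Ad_smul _ _) _; rewrite IHk].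
Qed.

(** In each degree the exponential is a polynomial in the components. *)
Lemma Ad_sexp u : Ad p (sexp u) = sexp (Ad p u).
Proof.
have [pl _ _ _ _] := p_graded; apply/funext => n.
apply: etrans (lmap_sum pl _ _ _) _; apply: eq_bigr => k _.
by rewrite -Ad_spow; exact: lmapZ pl _ _.
Qed.

Lemma Ad_Lhat u : Lhat K S u -> Lhat K S (Ad p u).
Proof.
have [pl _ _ ph pL] := p_graded; move=> [u0 Lu]; split.
  by apply: etrans (congr1 p u0) _; exact: lmap0 pl.
by move=> n; have [Ln hn] := Lu n; split; [exact: pL | exact: ph].
Qed.

Lemma Ad_magnus u : magnus K S u -> magnus K S (Ad p u).
Proof. by move=> [v Lv <-]; exists (Ad p v); [exact: Ad_Lhat | rewrite Ad_sexp]. Qed.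

End GradedAction.

Lemma Ad_automorphism (p p' : T -> T) : graded_morph p -> graded_morph p' ->
  cancel p p' -> cancel p' p -> Lhat_automorphism (Ad p) /\ magnus_automorphism (Ad p).
Proof.
move=> pg pg' pK p'K; have [pl _ pM _ _] := pg.
have AdK u : Ad p' (Ad p u) = u by apply/funext => n; exact: pK.
have AdK' u : Ad p (Ad p' u) = u by apply/funext => n; exact: p'K.
have Ad_bij (W : set (nat -> T)) : (forall u, W u -> W (Ad p u)) ->
    (forall u, W u -> W (Ad p' u)) -> set_bij W W (Ad p).
  move=> Wp Wp'; split=> [u Wu|u v _ _ uv|u Wu].
  - exact: Wp.
  - by rewrite -(AdK u) uv AdK.
  - by exists (Ad p' u); [exact: Wp' | exact: AdK'].
split; split.
- by apply: Ad_bij; exact: Ad_Lhat.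
- by move=> c u v _ _; apply/funext => n; exact: pl.
- move=> u v _ _; apply/funext => n; apply: etrans (lmapB pl _ _) _.
  have E1 := congr1 (fun w => w n) (Ad_smul pg u v).
  have E2 := congr1 (fun w => w n) (Ad_smul pg v u).
  by congr (_ - _); [exact: E1 | exact: E2].
- by apply: Ad_bij; exact: Ad_magnus.
- by move=> u v _ _; exact: Ad_smul.
Qed.

End FreeMagnus.

(** * The semi-direct product of the Magnus and Kac-Moody groups *)

(** Inverses exist because the exponentials are bijective, and they belong to the
    group by definition. *)
Lemma KM_group_group (R : realType) (K : fieldType) (iota : {rmorphism K -> R[i]})
  (I : countType) (A : I -> I -> K)
  (B1 : forall i j, A i j = A j i)
  (B2 : forall i j, i <> j -> iota (A i j) <= 0)
  (B3 : forall i j, 0 < iota (A i i) ->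
          exists m : int, 2 * A i j / A i i = m%:~R)
  (S : choiceType) (b : S -> borcherds iota A)
  (b_basis : is_basis (Vminus iota A) b) :
  is_group_on (KM_group b) (fun g1 g2 => g1 \o g2) id.
Proof.
split=> //; first exact: KM_id.
  by move=> g1 g2; exact: KM_comp.
move=> g Kg; have [g' [Kg' gK g'K _ _]] := KM_group_graded B1 B2 B3 b_basis Kg.
by exists g' => //; split; apply/funext => a /=; [exact: g'K | exact: gK].
Qed.

Theorem theorem3p4
  (R : realType) (K : fieldType) (iota : {rmorphism K -> R[i]})
  (I : countType) (A : I -> I -> K)
  (A_real : forall i j, iota (A i j) \is Num.real)
  (B1 : forall i j, A i j = A j i)
  (B2 : forall i j, i <> j -> iota (A i j) <= 0)
  (B3 : forall i j, 0 < iota (A i i) ->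
          exists m : int, 2 * A i j / A i i = m%:~R)
  (A_neg : forall i j, ~ J iota A i -> ~ J iota A j -> i <> j ->
             iota (A i j) < 0)
  (S : choiceType) (b : S -> borcherds iota A)
  (b_basis : is_basis (Vminus iota A) b) :
  (* the decomposition of g, with u^- = L(V') and u^+ = L(V) *)
  [/\ direct_sum3 (uplus iota A)
        [set x + y | x in (gJ iota A) & y in (hspan iota A)]
        (uminus iota A),
      independent_family (~` J iota A)
        (fun i => Uorbit (nJminus iota A) (bf iota A i)),
      independent_family (~` J iota A)
        (fun i => Uorbit (nJplus iota A) (be iota A i)),
      is_free_lie (Vminus iota A) (uminus iota A)
    & is_free_lie (Vplus iota A) (uplus iota A)] /\
  (* G_J is the group of g_J relative to the representation pi on T(V') *)
  [/\ pi_is_representation b,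
      forall alpha x, real_root iota A alpha -> gJ_root_space iota A alpha x ->
        locally_nilpotent (pi_rep b x)
    & forall g, KM_group b g -> linear_map g /\ bijective g] /\
  (* G(S') is a group, on which G_J acts through automorphisms of Lhat(S') *)
  [/\ is_group_on (magnus K S) (@smul K S) sone,
      forall g, KM_group b g ->
        Lhat_automorphism (Ad g) /\ magnus_automorphism (Ad g)
    & forall g L, KM_group b g -> Lhat K S L ->
        Ad g (sexp L) = sexp (Ad g L)] /\
  (* the semi-direct product *)
  exists (G : groupType) (q : (nat -> free_alg K S) ->
                              (free_alg K S -> free_alg K S) -> G),
  [/\ is_semidirect_product (magnus K S) (@smul K S)
        (KM_group b) (fun g1 g2 => g1 \o g2) (@Ad K S) q,
      forall g L, KM_group b g -> Lhat K S L ->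
        (q sone g * q (sexp L) id * (q sone g)^-1)%g = q (Ad g (sexp L)) id /\
        q (Ad g (sexp L)) id = q (sexp (Ad g L)) id
    & forall n1 n2 g1 g2, magnus K S n1 -> magnus K S n2 ->
        KM_group b g1 -> KM_group b g2 ->
        let L := slog n2 in
        [/\ Lhat K S L, sexp L = n2
          & (q n1 g1 * q n2 g2)%g = q (smul n1 (sexp (Ad g1 L))) (g1 \o g2)]].
Proof.
have c0 := subfield_char0 iota.
have KMg g := KM_group_graded B1 B2 B3 b_basis (g := g).
have Ad_grad g : KM_group b g -> graded_morph g by move=> /KMg[g' []].
split; first split.
- exact: decomposition.
- exact: independent_f.
- exact: independent_e.
- exact: is_free_uminus.
- exact: is_free_uplus.
split; first split.
- exact: pi_rep_representation.
- by move=> alpha x; exact: pi_rep_nilpotent.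
- move=> g /KMg[g' [_ gK g'K [gl _ _ _ _] _]]; split=> //.
  by exists g'.
split; first split.
- exact: magnus_group.
- move=> g /KMg[g' [_ gK g'K gg gg']]; exact: Ad_automorphism gg gg' gK g'K.
- by move=> g L /Ad_grad gg _; exact: Ad_sexp.
have [G [q Gq]] : exists (G : groupType) (q : (nat -> free_alg K S) ->
    (free_alg K S -> free_alg K S) -> G),
    is_semidirect_product (magnus K S) (@smul K S) (KM_group b)
      (fun g1 g2 => g1 \o g2) (@Ad K S) q.
  apply: (semidirect_group (act := @Ad K S) (magnus_group c0 S)
    (KM_group_group B1 B2 B3 b_basis)) => //.
  - by move=> g n /Ad_grad gg; exact: Ad_magnus.
  - by move=> g n n' /Ad_grad gg _ _; exact: Ad_smul.
have [_ qM] := Gq; exists G, q; split=> //.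
- move=> g L Kg LL; have gg := Ad_grad g Kg; split; last by rewrite Ad_sexp.
  have K1 : KM_group b id by exact: KM_id.
  have Me := magnus_sone K S; have ML : magnus K S (sexp L) by exists L.
  have MgL := Ad_magnus gg ML; have [_ _ _ M1 _] := magnus_group c0 S.
  have [_ _ qgL] := qM _ _ _ _ Me Kg ML K1; have [_ _ qLg] := qM _ _ _ _ MgL K1 Me Kg.
  (* Both sides are the element with components [Ad g (sexp L)] and [g]. *)
  have E : (q sone g * q (sexp L) id = q (Ad g (sexp L)) id * q sone g)%g.
    have Ad1 : Ad id sone = sone :> (nat -> free_alg K S) by [].
    rewrite qgL qLg Ad1 (proj1 (M1 _ MgL)) (proj2 (M1 _ MgL)) //.
  by rewrite E mulgK.
move=> n1 n2 g1 g2 Mn1 [u Lu <-] Kg1 Kg2 L.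
have Mn2 : magnus K S (sexp u) by exists u.
have [LL LE] := slog_sexp c0 Lu.
split; [exact: LL | exact: LE |].
have [_ _ qE] := qM _ _ _ _ Mn1 Kg1 Mn2 Kg2; rewrite qE.
have LgE : Ad g1 (sexp u) = sexp (Ad g1 L).
  exact: etrans (congr1 (Ad g1) (esym LE)) (Ad_sexp (Ad_grad _ Kg1) L).
by congr (q (smul n1 _) _); exact: LgE.
Qed.
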